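(* Let $g:\mathbb{R}_+\to\mathbb{R}$ be such that $g^2$ is Lipschitz and $0<\varepsilon<g(t)<M<\infty$ for all $t$, for some constants $\varepsilon, M$; let $c$ be a constant with $c\ge\frac12\sup_tg^2(t)$, let $f:\mathbb{R}_+\to\mathbb{R}$ be continuous, and let $x>0$. Suppose that $(Z,C)$ is a weak solution of the stochastic differential equation $$dZ_v=g(C_v)\sqrt{Z_v}\,dW_v+\left(c+f(C_v)Z_v\right)dv,\quad Z_0=x;\qquad dC_v=Z_v\,dv,\quad C_0=0,$$ where $W$ is a standard Brownian motion. Let $V_t=\inf\{r\ge0:C_r>t\}$ and define $X=(X_t;t\ge0)$ by $$X_t=\int_0^{V_t}(Z_v-cv)Z_v\,dv.$$ Then $X$ is a Gaussian process with continuous sample paths. Its mean is $$\mu_t=xt+\int_0^t(t-s)f(s)\,ds$$ and its covariance function is $$\Gamma(t_1,t_2)=\int_0^{t_1}(t_2-s)(t_1-s)g^2(s)\,ds,\qquad t_1\le t_2.$$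
   Context: $\mathbb{R}_+=[0,\infty)$. A weak solution is a pair of continuous adapted processes $(Z,C)$, with $Z\geq 0$, on some filtered probability space carrying a Brownian motion $W$ such that the equations hold. *)

(* Defs.v *)
From HB Require Import structures.
From mathcomp Require Import all_boot all_order all_algebra.
From mathcomp Require Import all_classical all_reals all_analysis.

Set Implicit Arguments.
Unset Strict Implicit.
Unset Printing Implicit Defensive.

Import Order.TTheory GRing.Theory Num.Theory.
Import numFieldNormedType.Exports.

Local Open Scope classical_set_scope.
Local Open Scope ring_scope.

(* The time set [0, +oo[ is encoded in R: filtrations, processes and coefficient
   functions are indexed by R, and only their values at nonnegative times are
   ever constrained or used. *)

Section stochastic_basis.
Context (R : realType) (d : measure_display) (T : measurableType d).
Implicit Types (F : R -> set (set T)) (Y : R -> T -> R).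

Definition is_filtration F :=
  [/\ forall t, 0 <= t -> sigma_algebra [set: T] (F t),
      forall t, 0 <= t -> F t `<=` measurable
    & forall s t, 0 <= s -> s <= t -> F s `<=` F t].

Definition measurable_wrt (G : set (set T)) (xi : T -> R) :=
  forall B : set R, measurable B -> G (xi @^-1` B).

Definition adapted F Y := forall t, 0 <= t -> measurable_wrt (F t) (Y t).

Definition continuous_path Y (w : T) :=
  {within `[0, +oo[, continuous (fun t => Y t w)}.

End stochastic_basis.

Section gaussian.
Context (R : realType) (d : measure_display) (T : measurableType d).
Variable P : probability T R.

(* [normal_prob m 0] is not the Dirac mass at [m] in the library (it is the
   uniform law on [0, 1]), hence the case distinction. *)
Definition gaussian_law (m s : R) (B : set R) : \bar R :=
  if s == 0 then \d_m B else normal_prob m s B.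

Definition has_gaussian_law (m s : R) (xi : T -> R) :=
  measurable_fun [set: T] xi /\
  forall B : set R, measurable B -> P (xi @^-1` B) = gaussian_law m s B.

Definition gaussian_rv (xi : T -> R) :=
  exists m s : R, 0 <= s /\ has_gaussian_law m s xi.

Definition gaussian_process (Y : R -> T -> R) :=
  forall (n : nat) (a t : 'I_n -> R), (forall i, 0 <= t i) ->
    gaussian_rv (fun w => \sum_(i < n) a i * Y (t i) w).

Definition brownian_motion (F : R -> set (set T)) (W : R -> T -> R) :=
  [/\ adapted F W,
      forall w, continuous_path W w,
      {ae P, forall w, W 0 w = 0},
      forall s t, 0 <= s -> s <= t ->
        has_gaussian_law 0 (Num.sqrt (t - s)) (fun w => W t w - W s w)
    & forall s t, 0 <= s -> s <= t ->
        forall (A : set T) (B : set R), F s A -> measurable B ->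
        let incr := (fun w => W t w - W s w) in
        P (A `&` incr @^-1` B) = (P A * P (incr @^-1` B))%E].

End gaussian.

Section ito.
Context (R : realType) (d : measure_display) (T : measurableType d).
Variables (P : probability T R) (F : R -> set (set T)).
Local Notation mu := (@lebesgue_measure R).

Record simple_process := SimpleProcess {
  sp_size : nat ;
  sp_time : nat -> R ;
  sp_coef : nat -> T -> R }.
Implicit Type S : simple_process.

Definition simple_predictable S :=
  [/\ 0 <= sp_time S 0,
      forall i, (i < sp_size S)%N -> sp_time S i <= sp_time S i.+1,
      forall i, (i < sp_size S)%N ->
        measurable_wrt (F (sp_time S i)) (sp_coef S i)
    & forall i, (i < sp_size S)%N ->
        exists K : R, forall w, `|sp_coef S i w| <= K].

Definition simple_value S (s : R) (w : T) : R :=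
  \sum_(i < sp_size S)
    sp_coef S i w * \1_(`]sp_time S i, sp_time S i.+1]%classic) s.

Definition simple_integral S (W : R -> T -> R) (t : R) (w : T) : R :=
  \sum_(i < sp_size S) sp_coef S i w *
    (W (Num.min (sp_time S i.+1) t) w - W (Num.min (sp_time S i) t) w).

Definition cvg0_in_probability (xi : nat -> T -> \bar R) :=
  forall e : R, 0 < e ->
    (fun n => P [set w | (e%:E <= xi n w)%E]) @ \oo --> 0%E.

(* [I] is a continuous version of the Ito integral (\int_0^t H_s dW_s)_(t >= 0):
   the extension, by limits in probability, of the integral of simple
   predictable processes to measurable adapted processes [H] with locally
   square-integrable paths; the limit does not depend on the approximating
   sequence. [F] is not assumed to be complete, so [I t] is only required to be
   a random variable. *)
Definition ito_integral (W H I : R -> T -> R) :=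
  [/\ forall t, 0 <= t -> measurable_fun [set: T] (I t),
      forall w, continuous_path I w
    & exists S : nat -> simple_process,
        (forall n, simple_predictable (S n)) /\
        forall t, 0 <= t ->
          cvg0_in_probability (fun n w =>
            \int[mu]_(s in `[0%R, t])
              ((simple_value (S n) s w - H s w) ^+ 2)%:E)%E /\
          cvg0_in_probability (fun n w =>
            (`|simple_integral (S n) W t w - I t w|)%:E)].

End ito.

Section equation.
Context (R : realType) (d : measure_display) (T : measurableType d).
Local Notation mu := (@lebesgue_measure R).

(* [0 <= C] is what makes f(C_v) and g(C_v) meaningful, as f and g are functions
   on [0, +oo[. *)
Definition weak_solution (g f : R -> R) (c x : R) (P : probability T R)
    (F : R -> set (set T)) (W Z C : R -> T -> R) :=
  [/\ is_filtration F /\ brownian_motion P F W,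
      [/\ adapted F Z, forall w, continuous_path Z w
        & forall w t, 0 <= t -> 0 <= Z t w],
      [/\ adapted F C, forall w, continuous_path C w
        & forall w t, 0 <= t -> 0 <= C t w],
      exists2 I : R -> T -> R,
        ito_integral P F W (fun v w => g (C v w) * Num.sqrt (Z v w)) I
        & {ae P, forall w, forall v, 0 <= v ->
            Z v w = x + I v w
                    + \int[mu]_(u in `[0, v]) (c + f (C u w) * Z u w)}
    & {ae P, forall w, forall v, 0 <= v ->
        C v w = \int[mu]_(u in `[0, v]) Z u w}].

(* The infimum is taken in the extended reals: it is +oo if C stays below t. *)
Definition passage_time (C : R -> T -> R) (t : R) (w : T) : \bar R :=
  ereal_inf [set r%:E | r in [set r : R | 0 <= r /\ t < C r w]].

Definition time_changed_integral (c : R) (Z C : R -> T -> R) (t : R) (w : T)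
    : R :=
  \int[mu]_(v in [set v : R | 0 <= v /\ (v%:E <= passage_time C t w)%E])
    ((Z v w - c * v) * Z v w).

End equation.

(* Main.v *)
Require Import Defs.
From HB Require Import structures.
From mathcomp Require Import all_boot all_order all_algebra.
From mathcomp Require Import all_classical all_reals all_analysis.
From mathcomp Require Import measurable_realfun ring lra.

Set Implicit Arguments.
Unset Strict Implicit.
Unset Printing Implicit Defensive.

Import Order.TTheory GRing.Theory Num.Theory.
Import numFieldNormedType.Exports.

Local Open Scope classical_set_scope.
Local Open Scope ring_scope.

(** The process [X] is read off the solution by integrating along the clock [C].
    On a solution path [Z_v - c v = x + I_v + \int_0^(C_v) f], where [I] is the
    Ito integral of [g(C) sqrt Z].  Integrating against [dC_v = Z_v dv] over the
    set where [C <= t] and changing variable by the clock turns the first and last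
    terms into the mean [x t + \int_0^t (t - s) f(s) ds]
    ([sublevel_integralE]); what remains is the integral of [I dC] over that set,
    which by parts equals [\int (t - min(C, t)) dI].  Hence a linear combination
    of values of [X], once centred, is the terminal value of the stochastic
    integral [N_v] of the weight [sum_i a_i (t_i - min(C_v, t_i))] against [I].
    Its quadratic variation is a function of the clock alone: the same change of
    variable gives [Q_v = \int_0^(C_v) (sum_i a_i (t_i - min(s, t_i)))^2 g(s)^2 ds],
    and this is a constant [V], not random, as soon as the clock has passed every
    [t_i].  A stochastic integral whose terminal quadratic variation is the
    constant [V] has law [N(0, V)].

    That last principle is proved without stochastic calculus.  For a bounded
    continuous [h] and a level [q], the residual smoothing
    [u(N, Q) = E h(N + sqrt (q - Q) xi)], with [xi] standard normal, completes the
    pair by the Gaussian noise that is still missing.  Adding one Brownian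
    increment to [N] and its conditional variance to [Q] leaves the expectation
    of [u] unchanged, because Gaussian convolution adds variances
    ([ge0_integral_normal_convolution]); so [E u(N, Q) = u(0, 0)] for an integral
    of simple coefficients stopped before [Q] reaches [q]
    ([stopped_run_preserves]).  The coefficients approximating [I] are refined on
    a grid and weighted; gains and energies then converge almost surely along a
    diagonal subsequence, the stopping disappears in the limit, and the identity
    holds for the Ito integral itself ([ito_residual_smoothing]).  Letting [v] tend
    to infinity replaces [Q] by [V], and letting [q] decrease to [V] gives
    [E h(N) = E h(sqrt V xi)] ([gaussian_law_time_changed_integral]).

    The clock must pass every level almost surely.  On the event that it
    stays below [L], the weight [(2 L - min(C, 2 L)) - (L - min(C, L))] is the
    constant [L], so [L I_v] agrees there with an integral of bounded quadratic
    variation, and is tight.  But [I_v = Z_v - c v - (a bounded term)] with [c > 0],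
    and [Z_v] cannot stay large because its integral is at most [L]; so [I_v] would
    tend to [- oo] along most times, and the event is negligible
    ([bounded_clock_negligible]).

    The mean and covariance are then read off the Gaussian laws, the latter by
    polarization; paths of [X] are continuous because moving the level from [s]
    to [t] moves the clock by [t - s], over which [Z_v - c v] is bounded. *)

(** * Integration against Gaussian measures *)

Lemma integral_probability_cst {d} {T : measurableType d} {R : realType}
  (P : probability T R) (y : \bar R) : (\int[P]_w y = y)%E.
Proof.
have -> : (fun=> y) = @cst T (\bar R) y by [].
by rewrite integral_cst// [X in (_ * X)%E](_ : _ = 1%E) ?mule1//; exact: probability_setT.
Qed.

Section density.
Local Open Scope ereal_scope.
Context d (T : measurableType d) (R : realType).
Variables (mu nu : {measure set T -> \bar R}) (p : T -> R).
Hypothesis mp : measurable_fun [set: T] p.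
Hypothesis p0 : forall x, (0 <= p x)%R.
Hypothesis nuE : forall A, measurable A -> nu A = \int[mu]_(x in A) (p x)%:E.

Import HBNNSimple.

Let integral_density_nnsfun (h : {nnsfun T >-> R}) :
  \int[nu]_x (h x)%:E = \int[mu]_x ((h x)%:E * (p x)%:E).
Proof.
under [LHS]eq_integral do rewrite fimfunE -fsumEFin//.
rewrite [LHS]ge0_integral_fsum//; last 2 first.
  - by move=> r; exact/measurable_EFinP/measurableT_comp.
  - by move=> n x _; rewrite EFinM nnfun_muleindic_ge0.
under [RHS]eq_integral.
  move=> x xD; rewrite fimfunE -fsumEFin// ge0_mule_fsuml; last first.
    by move=> r; rewrite EFinM nnfun_muleindic_ge0.
  over.
rewrite [RHS]ge0_integral_fsum//; last 2 first.
  - move=> r; apply: emeasurable_funM; last exact/measurable_EFinP.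
    exact/measurable_EFinP/measurableT_comp.
  - move=> n x _; apply: mule_ge0; last by rewrite lee_fin.
    by rewrite EFinM nnfun_muleindic_ge0.
apply: eq_fsbigr => r _.
transitivity (r%:E * nu (h @^-1` [set r])).
  by rewrite integralZl_indic_nnsfun// integral_indic//= setIT.
have mr : measurable (h @^-1` [set r]).
  by rewrite -[X in measurable X]setTI; exact: (measurable_funP h).
rewrite nuE//.
have [r0|r0] := leP 0%R r; last first.
  have -> : h @^-1` [set r] = set0.
    by apply/seteqP; split => // x /= hx; move: r0; rewrite -hx ltNge fun_ge0.
  rewrite integral_set0 mule0; apply/esym.
  by under eq_integral do rewrite indic0 mulr0 mul0e; rewrite integral0.
rewrite -ge0_integralZl//; last 2 first.
  - exact/measurable_EFinP/measurable_funTS.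
  - by move=> x _; rewrite lee_fin.
rewrite integral_mkcond; apply: eq_integral => x _.
rewrite patchE indicE; case: ifPn => _; first by rewrite mulr1.
by rewrite mulr0 mul0e.
Qed.

(** Monotone approximation by simple functions reduces this to indicators, where
    it is the hypothesis that [p] is the density of [nu]. *)
Lemma ge0_integral_density (h : T -> \bar R) : measurable_fun [set: T] h ->
  (forall x, 0 <= h x) -> \int[nu]_x h x = \int[mu]_x (h x * (p x)%:E).
Proof.
move=> mh h0; pose g n := nnsfun_approx measurableT mh n.
transitivity (limn (fun n => \int[nu]_x (g n x)%:E)).
  rewrite -monotone_convergence//=.
  - by apply: eq_integral => x _; apply/esym/cvg_lim => //; exact: cvg_nnsfun_approx.
  - by move=> n; exact/measurable_EFinP.
  - by move=> n x _; rewrite lee_fin.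
  - by move=> x _ a b ab; rewrite lee_fin; exact/lefP/nd_nnsfun_approx.
under eq_fun do rewrite integral_density_nnsfun.
rewrite -monotone_convergence//=.
- apply: eq_integral => x _; apply/cvg_lim => //.
  apply: cvgeZr => //; exact: cvg_nnsfun_approx.
- move=> n; apply: emeasurable_funM; exact/measurable_EFinP.
- by move=> n x _; rewrite mule_ge0 ?lee_fin.
- move=> x _ a b ab; rewrite lee_pmul ?lee_fin//.
  exact/lefP/nd_nnsfun_approx.
Qed.

End density.

Section gaussian_integrals.
Local Open Scope ereal_scope.
Context (R : realType).
Implicit Types (m s a b y : R) (h : R -> R).
Local Notation mu := (@lebesgue_measure R).
Local Notation stdn := (normal_prob (0 : R) 1).

Lemma ge0_integral_normal_prob m s (h : R -> \bar R) :
  measurable_fun [set: R] h -> (forall x, 0 <= h x) ->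
  \int[normal_prob m s]_x h x = \int[mu]_x (h x * (normal_pdf m s x)%:E).
Proof.
move=> mh h0; apply: ge0_integral_density => //.
- exact: measurable_normal_pdf.
- by move=> x; exact: normal_pdf_ge0.
Qed.

Lemma ge0_integral_affine (h : R -> R) m s : (0 < s)%R -> continuous h ->
  (forall x, (0 <= h x)%R) ->
  \int[mu]_x (h x)%:E = \int[mu]_z (h (m + s * z)%R * s)%:E.
Proof.
move=> s0 ch h0; pose F z := (m + s * z)%R.
have dF (z : R) : is_derive z (1 : R)%R F s.
  have : is_derive z (1 : R)%R (cst m + s \*: id)%R (0 + s *: 1)%R by apply: is_deriveD.
  by rewrite add0r [X in is_derive _ _ _ X -> _]mulr1.
have F1E : derive1 F = cst s.
  by apply/funext => z; rewrite derive1E (@derive_val _ _ _ _ _ _ _ (dF z)).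
rewrite (@increasing_ge0_integration_by_substitutionT _ F) ?F1E//.
- by move=> x y xy; rewrite /F ltrD2l ltr_pM2l.
- by move=> x; exact: cvg_cst.
- exact: is_cvg_cst.
- exact: is_cvg_cst.
- apply: (@cvg_comp _ _ _ (fun z => s * z)%R (fun z => m + z)%R _ -oo%R).
    apply/gt0_cvgMrNy => //.
  exact: cvg_addrl_Ny.
- apply: (@cvg_comp _ _ _ (fun z => s * z)%R (fun z => m + z)%R _ +oo%R).
    apply/gt0_cvgMry => //.
  exact: cvg_addrl.
Qed.

Lemma normal_pdf_affine m s z : (0 < s)%R ->
  (normal_pdf m s (m + s * z) * s = normal_pdf 0 1 z)%R.
Proof.
move=> s0; rewrite !normal_pdfE ?oner_neq0 ?gt_eqF//= /normal_peak /normal_fun.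
rewrite expr1n mul1r subr0 addrAC subrr add0r.
rewrite (_ : - (s * z) ^+ 2 / (s ^+ 2 *+ 2) = - z ^+ 2 / (1 *+ 2))%R; last first.
  by field; rewrite gt_eqF.
rewrite mulrAC; congr (_ * _)%R.
rewrite -mulrnAr sqrtrM ?sqr_ge0// sqrtr_sqr gtr0_norm// invfM.
by rewrite mulrAC mulVf ?mul1r ?gt_eqF.
Qed.

Lemma integral_normal_affine h m s : (0 < s)%R -> continuous h ->
  (forall x, (0 <= h x)%R) ->
  \int[normal_prob m s]_x (h x)%:E = \int[stdn]_z (h (m + s * z)%R)%:E.
Proof.
move=> s0 ch h0.
have mh : measurable_fun [set: R] h by exact: continuous_measurable_fun.
have mh' : measurable_fun [set: R] (fun z => h (m + s * z)%R).
  by apply: measurableT_comp => //; apply: measurable_funD => //; exact: measurable_funM.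
rewrite (ge0_integral_normal_prob m s (h := EFin \o h)); last 2 first.
- exact/measurable_EFinP.
- by move=> x; rewrite lee_fin.
rewrite (ge0_integral_normal_prob 0 1 (h := fun z => (h (m + s * z)%R)%:E)); last 2 first.
- exact/measurable_EFinP.
- by move=> x; rewrite lee_fin.
under eq_integral do rewrite /= -EFinM.
rewrite (@ge0_integral_affine (fun x => h x * normal_pdf m s x)%R m s)//.
- by apply: eq_integral => z _; rewrite -mulrA normal_pdf_affine.
- move=> x; apply: cvgM; first exact: ch.
  by apply: continuous_normal_pdf; rewrite gt_eqF.
- by move=> x; rewrite mulr_ge0// normal_pdf_ge0.
Qed.

End gaussian_integrals.

Section gaussian_convolution.
Local Open Scope ereal_scope.
Context (R : realType).
Implicit Types (m s a b y : R) (h : R -> R).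
Local Notation mu := (@lebesgue_measure R).
Local Notation stdn := (normal_prob (0 : R) 1).

(** Completing the square: the joint density of a normal [x] and of [u] given [x],
    normal with mean [y + a x], factors as the law of [u] times the posterior law
    of [x]. *)
Lemma normal_pdf_mul y a s b x u : (0 < s)%R -> (0 < b)%R ->
  let sg := Num.sqrt (a ^+ 2 * s ^+ 2 + b ^+ 2) in
  (normal_pdf (y + a * x) b u * normal_pdf 0 s x =
   normal_pdf y sg u *
   normal_pdf (a * s ^+ 2 * (u - y) / sg ^+ 2) (s * b / sg) x)%R.
Proof.
move=> s0 b0 sg.
have sg2 : (sg ^+ 2 = a ^+ 2 * s ^+ 2 + b ^+ 2)%R.
  by rewrite sqr_sqrtr// addr_ge0 ?sqr_ge0// -exprMn sqr_ge0.
have sg0 : (0 < sg)%R.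
  by rewrite sqrtr_gt0 ltr_wpDl ?exprn_gt0// -exprMn sqr_ge0.
have sb0 : (0 < s * b / sg)%R by rewrite divr_gt0 ?mulr_gt0.
rewrite !normal_pdfE ?gt_eqF//= /normal_fun.
have -> (p q e1 e2 : R) : (p * expR e1 * (q * expR e2) = p * q * expR (e1 + e2))%R.
  by rewrite expRD; ring.
have -> (p q e1 e2 : R) : (p * expR e1 * (q * expR e2) = p * q * expR (e1 + e2))%R.
  by rewrite expRD; ring.
congr (_ * expR _)%R.
- rewrite /normal_peak -!invfM; congr (_^-1)%R.
  rewrite -!sqrtrM ?mulrn_wge0 ?mulr_ge0 ?sqr_ge0 ?pi_ge0 ?(ltW sg0) ?(ltW b0)//; congr (_ _).
  by field; rewrite gt_eqF.
- rewrite subr0 !mulNr -!opprD; congr (- _)%R.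
  have D0 : (a ^+ 2 * s ^+ 2 + b ^+ 2 != 0)%R by rewrite -sg2 expf_neq0// gt_eqF.
  rewrite expr_div_n exprMn sg2.
  by field; rewrite exprMn D0 !gt_eqF.
Qed.

Lemma continuous_affine y s : continuous (fun z : R => y + s * z)%R.
Proof.
by move=> z; apply: cvgD; [exact: cvg_cst|apply: cvgM; [exact: cvg_cst|exact: cvg_id]].
Qed.

(** Independent Gaussian variables add their variances: both sides are double
    integrals of the same joint density, integrated in the two orders. *)
Lemma ge0_integral_normal_convolution h y a s b : (0 < s)%R -> (0 < b)%R ->
  continuous h -> (forall x, (0 <= h x)%R) ->
  \int[normal_prob 0 s]_x \int[stdn]_z (h (y + a * x + b * z)%R)%:E =
  \int[stdn]_z (h (y + Num.sqrt (a ^+ 2 * s ^+ 2 + b ^+ 2) * z)%R)%:E.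
Proof.
move=> s0 b0 ch h0; set sg := Num.sqrt _.
have sg0 : (0 < sg)%R.
  by rewrite sqrtr_gt0 ltr_wpDl ?exprn_gt0// -exprMn sqr_ge0.
have mh : measurable_fun [set: R] h by exact: continuous_measurable_fun.
have mpdf2 : measurable_fun [set: R * R]
    (fun z : R * R => normal_pdf (y + a * z.1) b z.2).
  rewrite (_ : (fun _ => _) = (fun z : R * R => normal_pdf 0 b (z.2 - (y + a * z.1)))).
    apply: measurableT_comp; first exact: measurable_normal_pdf.
    apply: measurable_funB => //; apply: measurable_funD => //.
    exact: measurable_funM.
  apply/funext => z; rewrite !normal_pdfE ?gt_eqF//=.
  by rewrite /normal_fun subr0.
pose G (z : R * R) := (h z.2 * normal_pdf (y + a * z.1) b z.2 *
  normal_pdf 0 s z.1)%R.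
have mG : measurable_fun [set: R * R] (EFin \o G).
  apply/measurable_EFinP; apply: measurable_funM.
    by apply: measurable_funM => //; exact: measurableT_comp.
  by apply: measurableT_comp => //; exact: measurable_normal_pdf.
have G0 z : 0 <= (EFin \o G) z.
  by rewrite lee_fin !mulr_ge0// normal_pdf_ge0.
have dens m' s' : \int[normal_prob m' s']_u (h u)%:E =
    \int[mu]_u ((h u)%:E * (normal_pdf m' s' u)%:E).
  rewrite (ge0_integral_normal_prob _ _ (h := EFin \o h))//.
    exact/measurable_EFinP.
transitivity (\int[mu]_x \int[mu]_u (EFin \o G) (x, u)).
  under eq_integral do rewrite -integral_normal_affine//.
  rewrite ge0_integral_normal_prob; last 2 first.
  - under eq_fun do rewrite dens.
    apply: (@measurable_fun_fubini_tonelli_F _ _ _ _ R mu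
      (fun z : R * R => (h z.2)%:E * (normal_pdf (y + a * z.1) b z.2)%:E)).
      apply: emeasurable_funM; first by apply/measurable_EFinP; exact: measurableT_comp.
      exact/measurable_EFinP.
    by move=> z; rewrite mule_ge0 ?lee_fin// normal_pdf_ge0.
  - by move=> x; apply: integral_ge0 => u _; rewrite lee_fin.
  apply: eq_integral => x _; rewrite dens.
  rewrite -ge0_integralZr//; last 3 first.
  - apply: emeasurable_funM; first exact/measurable_EFinP.
    by apply/measurable_EFinP; exact: measurable_normal_pdf.
  - by move=> u _; rewrite mule_ge0 ?lee_fin// normal_pdf_ge0.
  - by rewrite lee_fin normal_pdf_ge0.
rewrite (@fubini_tonelli _ _ _ _ _ mu mu (EFin \o G))//.
rewrite -integral_normal_affine// dens.
apply: eq_integral => u _.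
under eq_integral => x _.
  rewrite /= /G/= -mulrA normal_pdf_mul// -/sg mulrA EFinM.
  over.
rewrite ge0_integralZl//.
- by rewrite integral_normal_pdf mule1 EFinM.
- by apply/measurable_EFinP; exact: measurable_normal_pdf.
- by move=> x _; rewrite lee_fin normal_pdf_ge0.
- by rewrite lee_fin mulr_ge0// normal_pdf_ge0.
Qed.

Lemma measurable_gaussian_smoothing h : continuous h -> (forall x, (0 <= h x)%R) ->
  measurable_fun [set: R * R]
    (fun p : R * R => \int[stdn]_z (h (p.1 + p.2 * z)%R)%:E).
Proof.
move=> ch h0.
apply: (@measurable_fun_fubini_tonelli_F _ _ _ _ R stdn
  (fun q : (R * R) * R => (h (q.1.1 + q.1.2 * q.2)%R)%:E)); last first.
  by move=> q; rewrite lee_fin.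
apply/measurable_EFinP; apply: measurableT_comp; first exact: continuous_measurable_fun.
apply: measurable_funD; first exact: measurableT_comp.
by apply: measurable_funM => //; exact: measurableT_comp.
Qed.

End gaussian_convolution.

(** * Integrals of functions of independent variables *)

Section sub_sigma_algebra_measurability.
Context {d} {T : measurableType d} {R : realType}.
Implicit Types G : set (set T).

Definition measurable_from d' (S : measurableType d') G (A : T -> S) :=
  forall U, measurable U -> G (A @^-1` U).

Lemma measurable_from_pair d1 d2 (S1 : measurableType d1)
    (S2 : measurableType d2) G (A1 : T -> S1) (A2 : T -> S2) :
  sigma_algebra [set: T] G -> measurable_from G A1 -> measurable_from G A2 ->
  measurable_from G (fun w => (A1 w, A2 w)).
Proof.
move=> sG m1 m2 U; rewrite measurable_prod_measurableType.
move: U; apply: smallest_sub.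
  have [G0 GC Gcup] := sG; split => /=.
  - by rewrite preimage_set0.
  - move=> A GA; rewrite setTD preimage_setC -setTD; exact: GC.
  - by move=> A GA; rewrite preimage_bigcup; exact: Gcup.
move=> _ [X mX [Y mY <-]].
have /(sigma_algebraP (fun X _ => @subsetT _ X))[_ _ _ GI] := sG.
exact: GI (m1 _ mX) (m2 _ mY).
Qed.

Lemma measurable_from_comp d1 d2 (S1 : measurableType d1)
    (S2 : measurableType d2) G (A : T -> S1) (k : S1 -> S2) :
  measurable_from G A -> measurable_fun [set: S1] k ->
  measurable_from G (k \o A).
Proof.
by move=> mA mk U mU; apply: (mA (k @^-1` U)); rewrite -[X in measurable X]setTI; exact: mk.
Qed.

End sub_sigma_algebra_measurability.

Section independence.
Local Open Scope ereal_scope.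
Context {d} {T : measurableType d} {R : realType} (P : probability T R).

(** The joint law of [A] and [X] is the product of their laws, as the two agree
    on rectangles; Fubini then integrates [X] first. *)
Lemma ge0_integral_independent d' (S : measurableType d') (G : set (set T))
    (A : T -> S) (X : T -> R) (k : S * R -> \bar R) :
  G `<=` measurable -> measurable_from G A ->
  measurable_fun [set: T] X ->
  (forall E B, G E -> measurable B -> P (E `&` X @^-1` B) = P E * P (X @^-1` B)) ->
  measurable_fun [set: S * R] k -> (forall p, 0 <= k p) ->
  \int[P]_w k (A w, X w) = \int[P]_w \int[P]_w' k (A w, X w').
Proof.
move=> Gm GA mX indep mk k0.
have mA : measurable_fun [set: T] A by move=> _ U mU; rewrite setTI; exact/Gm/GA.
have mAX : measurable_fun [set: T] (fun w => (A w, X w)) by exact: measurable_fun_pair.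
pose A' : {mfun T >-> S} := HB.pack A (isMeasurableFun.Build _ _ _ _ A mA).
pose X' : {mfun T >-> R} := HB.pack X (isMeasurableFun.Build _ _ _ _ X mX).
pose AX' : {mfun T >-> (S * R)%type} :=
  HB.pack (fun w => (A w, X w)) (isMeasurableFun.Build _ _ _ _ (fun w => (A w, X w)) mAX).
rewrite -[LHS](ge0_integral_distribution (P := P) AX')//.
have -> : \int[distribution P AX']_y k y =
    \int[distribution P A' \x distribution P X']_y k y.
  apply: eq_measure_integral => U mU _; apply/esym.
  apply: product_measure_unique => // B C mB mC.
  by rewrite /distribution /pushforward /= -indep//; exact: GA.
rewrite fubini_tonelli1//.
rewrite (ge0_integral_distribution (P := P) A')//; last 2 first.
- exact: measurable_fun_fubini_tonelli_F.
- by move=> y; apply: integral_ge0.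
apply: eq_integral => w _ /=; rewrite /fubini_F.
by rewrite (ge0_integral_distribution (P := P) X')//; exact: measurableT_comp.
Qed.

Lemma ge0_integral_gaussian_law (s : R) (X : T -> R) (k : R -> \bar R) :
  (0 < s)%R -> has_gaussian_law P 0 s X ->
  measurable_fun [set: R] k -> (forall p, 0 <= k p) ->
  \int[P]_w k (X w) = \int[normal_prob 0 s]_x k x.
Proof.
move=> s0 [mX lX] mk k0.
pose X' : {mfun T >-> measurableTypeR R} :=
  HB.pack X (isMeasurableFun.Build _ _ T (measurableTypeR R) X mX).
transitivity (\int[distribution P X']_y k y).
  by apply/esym; exact: ge0_integral_distribution.
apply: eq_measure_integral => U mU _.
by rewrite /= /distribution /pushforward /= lX// /gaussian_law gt_eqF.
Qed.

End independence.

(** * Gaussian smoothing along a stopped discrete integral *)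

Section discrete_scheme.
Local Open Scope ereal_scope.
Context {d} {T : measurableType d} {R : realType} (P : probability T R).
Variables (F : R -> set (set T)) (W : R -> T -> R).
Hypothesis filF : is_filtration F.
Hypothesis bmW : brownian_motion P F W.
Local Notation stdn := (normal_prob (0 : R) 1).

Record cell := Cell { cell_left : R ; cell_right : R ; cell_coef : T -> R }.
Implicit Types (c : cell) (s : seq cell).

Definition cell_gain c w : R :=
  (cell_coef c w * (W (cell_right c) w - W (cell_left c) w))%R.

Definition cell_energy c w : R :=
  (cell_coef c w ^+ 2 * (cell_right c - cell_left c))%R.

(** Each cell starts after the previous one ends, and its coefficient is known
    when it starts. *)
Fixpoint cell_chain (t : R) s : Prop :=
  if s is c :: s' then
    [/\ (t <= cell_left c)%R, (cell_left c <= cell_right c)%R,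
        measurable_wrt (F (cell_left c)) (cell_coef c) & cell_chain (cell_right c) s']
  else True.

Variable q : R.

(** The pair holds the value of the integral and its accumulated quadratic
    variation.  A step that would bring the latter to [q] is skipped rather than
    truncated: it is known at the left end of the cell, so skipping it is adapted,
    and the second component always stays below [q]. *)
Definition stopped_step (p : R * R) (g e : R) : R * R :=
  (if p.2 + e < q then (p.1 + g, p.2 + e) else p)%R.

Definition stopped_run s (st : T -> R * R) : T -> R * R :=
  foldl (fun st c w => stopped_step (st w) (cell_gain c w) (cell_energy c w)) st s.

(** Energies are nonnegative, so if their total stays below [q] no step of the
    run is skipped. *)
Lemma stopped_runE s (st : T -> R * R) w :
  ((st w).2 + \sum_(c <- s) cell_energy c w < q)%R ->
  (forall t, cell_chain t s ->
  stopped_run s st w = ((st w).1 + \sum_(c <- s) cell_gain c w,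
                        (st w).2 + \sum_(c <- s) cell_energy c w)%R).
Proof.
rewrite /stopped_run; elim: s st => /= [|c s IH] st.
  by rewrite !big_nil !addr0; case: (st w).
rewrite !big_cons => stq t [tc cc mc chs].
have e0 : (0 <= \sum_(j <- s) cell_energy j w)%R.
  elim: s (cell_right c) chs {IH stq} => [|c' s IH] u; first by rewrite big_nil.
  by move=> /= [_ c'c' _ /IH]; rewrite big_cons => ?; rewrite addr_ge0// mulr_ge0 ?sqr_ge0// subr_ge0.
have stc : ((st w).2 + cell_energy c w < q)%R.
  by apply: le_lt_trans stq; rewrite lerD2l lerDl.
have E : stopped_step (st w) (cell_gain c w) (cell_energy c w) =
   ((st w).1 + cell_gain c w, (st w).2 + cell_energy c w)%R.
  by rewrite /stopped_step stc.
by rewrite (IH _ _ _ chs) /= E//= -!addrA.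
Qed.

Lemma Brownian_increment_wrt a b : (0 <= a)%R -> (a <= b)%R ->
  measurable_wrt (F b) (fun w => W b w - W a w)%R.
Proof.
move=> a0 ab; have [sF _ mF] := filF; have [aW _ _ _ _] := bmW.
have b0 := le_trans a0 ab.
pose k (z : R * R) := (z.1 - z.2)%R.
have mW : measurable_from (F b) (fun w => (W b w, W a w)).
  apply: measurable_from_pair; first exact: sF.
  - exact: aW.
  - by move=> U mU; apply: (mF a b) => //; exact: aW.
have mk : measurable_fun [set: R * R] k by exact: measurable_funB.
exact: (measurable_from_comp mW mk).
Qed.

Variable h : R -> R.
Hypotheses (ch : continuous h) (h0 : forall x, (0 <= h x)%R).

(** Mean of [h] at the first component after adding an independent centred
    Gaussian variable carrying the variance [q - p.2] that remains to be spent;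
    it is the heat flow run backwards from level [q]. *)
Definition residual_smoothing (p : R * R) : \bar R :=
  \int[stdn]_z (h (p.1 + Num.sqrt (q - p.2) * z)%R)%:E.

Lemma measurable_residual_smoothing :
  measurable_fun [set: R * R] residual_smoothing.
Proof.
rewrite (_ : residual_smoothing =
  (fun p : R * R => \int[stdn]_z (h (p.1 + p.2 * z)%R)%:E) \o
  (fun p : R * R => (p.1, Num.sqrt (q - p.2))%R))//.
apply: measurableT_comp; first exact: measurable_gaussian_smoothing.
apply: measurable_fun_pair => //=; apply: measurableT_comp => //.
  by apply: continuous_measurable_fun; exact: sqrt_continuous.
exact: measurable_funB.
Qed.

Lemma residual_smoothing_ge0 p : 0 <= residual_smoothing p.
Proof. by apply: integral_ge0 => z _; rewrite lee_fin. Qed.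

Let K (D : R) (p : (R * R) * R * R) : \bar R :=
  residual_smoothing (stopped_step p.1.1 (p.1.2 * p.2) (p.1.2 ^+ 2 * D))%R.

Lemma measurable_stopped_step :
  measurable_fun [set: (R * R) * R * R]
    (fun p : (R * R) * R * R => stopped_step p.1.1 p.1.2 p.2).
Proof.
have m1 : measurable_fun [set: (R * R) * R * R] (fun p : (R * R) * R * R => p.1.1).
  exact: measurableT_comp.
have m11 : measurable_fun [set: (R * R) * R * R] (fun p : (R * R) * R * R => p.1.1.1).
  exact: (measurableT_comp measurable_fst m1).
have m12 : measurable_fun [set: (R * R) * R * R] (fun p : (R * R) * R * R => p.1.1.2).
  exact: (measurableT_comp measurable_snd m1).
have m2 : measurable_fun [set: (R * R) * R * R] (fun p : (R * R) * R * R => p.1.2).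
  exact: measurableT_comp.
have m3 : measurable_fun [set: (R * R) * R * R] (fun p : (R * R) * R * R => p.2).
  exact: measurable_snd.
apply: measurable_fun_ifT => //=.
  by apply: measurable_fun_ltr => //; exact: measurable_funD.
by apply: measurable_fun_pair => //=; exact: measurable_funD.
Qed.

Let measurable_K D : measurable_fun [set: (R * R) * R * R] (K D).
Proof.
rewrite /K; apply: measurableT_comp; first exact: measurable_residual_smoothing.
pose G (p : (R * R) * R * R) := ((p.1.1, p.1.2 * p.2), p.1.2 ^+ 2 * D)%R.
have mG : measurable_fun setT G.
  apply: measurable_fun_pair => /=.
    apply: measurable_fun_pair; first exact: measurableT_comp.
    by apply: measurable_funM => //; exact: measurableT_comp.
  apply: measurable_funM => //; apply: measurable_funX; exact: measurableT_comp.
exact: (measurableT_comp measurable_stopped_step mG).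
Qed.

(** Heat equation in discrete form: the noise of the step and the remaining noise
    add up to the noise remaining before the step. *)
Let integral_K (D : R) (p : (R * R) * R) : (0 < D)%R -> (p.1.2 < q)%R ->
  \int[normal_prob 0 (Num.sqrt D)]_x K D (p, x) = residual_smoothing p.1.
Proof.
move=> D0 pq; rewrite /K /stopped_step /=.
have [pDq|pDq] := ltP (p.1.2 + p.2 ^+ 2 * D)%R q; last first.
  by rewrite integral_probability_cst.
rewrite /residual_smoothing /=.
rewrite ge0_integral_normal_convolution ?sqrtr_gt0 ?subr_gt0//.
rewrite !sqr_sqrtr ?(ltW D0) ?subr_ge0 ?(ltW pDq)//.
by rewrite (_ : p.2 ^+ 2 * D + (q - (p.1.2 + p.2 ^+ 2 * D)) = q - p.1.2)%R//; ring.
Qed.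

(** One cell at a time: given the past, the increment of [W] is a Gaussian variable
    independent of the current pair and of the coefficient, so averaging over it
    recovers the smoothing at the start of the cell. *)
Lemma stopped_run_preserves s t (st : T -> R * R) : (0 <= t)%R ->
  cell_chain t s -> measurable_from (F t) st -> (forall w, (st w).2 < q)%R ->
  measurable_fun [set: T] (stopped_run s st) /\
  \int[P]_w residual_smoothing (stopped_run s st w) =
  \int[P]_w residual_smoothing (st w).
Proof.
have [sF Fm mF] := filF; have [_ _ _ lawW indW] := bmW.
elim: s t st => /= [|c s IH] t st t0.
  by move=> _ mst _; split=> // _ U mU; rewrite setTI; apply: (Fm t) => //; exact: mst.
move=> [tc cc mc chs] mst st0.
set st' := (X in stopped_run _ X).
have c0 := le_trans t0 tc; have c1 := le_trans c0 cc.
have mst' : measurable_from (F (cell_right c)) st'.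
  pose G (p : (R * R) * R * R) :=
    ((p.1.1, p.1.2 * p.2), p.1.2 ^+ 2 * (cell_right c - cell_left c))%R.
  have mG : measurable_fun setT G.
    apply: measurable_fun_pair => /=.
      apply: measurable_fun_pair; first exact: measurableT_comp.
      by apply: measurable_funM => //; exact: measurableT_comp.
    apply: measurable_funM => //; apply: measurable_funX; exact: measurableT_comp.
  have mA : measurable_from (F (cell_right c))
     (fun w => (st w, cell_coef c w, W (cell_right c) w - W (cell_left c) w)%R).
    apply: measurable_from_pair; [exact: sF| |exact: Brownian_increment_wrt].
    apply: measurable_from_pair; first exact: sF.
    - move=> U mU; apply: (mF t) => //; first exact: le_trans tc cc.
      exact: mst.
    - by move=> U mU; apply: (mF (cell_left c)) => //; exact: mc.
  exact: (measurable_from_comp mA (measurableT_comp measurable_stopped_step mG)).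
have st'0 w : ((st' w).2 < q)%R by rewrite /st' /stopped_step; case: ifPn.
have [mrun ->] := IH _ _ c1 chs mst' st'0.
split; first exact: mrun.
(* the law of a null increment is a Dirac mass, not a normal density *)
have [ceq|cneq] := eqVneq (cell_left c) (cell_right c).
  apply: eq_integral => w _; congr residual_smoothing.
  rewrite /st' /cell_gain /cell_energy ceq !subrr !mulr0 /stopped_step !addr0 st0.
  by case: (st w).
have D0 : (0 < cell_right c - cell_left c)%R by rewrite subr_gt0 lt_neqAle cneq.
have mA : measurable_from (F (cell_left c)) (fun w => (st w, cell_coef c w)).
  apply: measurable_from_pair => //; first exact: sF.
  by move=> U mU; apply: (mF t) => //; exact: mst.
have law := lawW _ _ c0 cc.
transitivity (\int[P]_w K (cell_right c - cell_left c)%R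
   ((st w, cell_coef c w), (W (cell_right c) w - W (cell_left c) w)%R)).
  by apply: eq_integral => w _.
rewrite (ge0_integral_independent (k := K _) (Fm _ c0) mA); last 4 first.
- by case: law.
- by move=> E B; exact: indW.
- exact: measurable_K.
- by move=> p; exact: residual_smoothing_ge0.
apply: eq_integral => w _.
rewrite (ge0_integral_gaussian_law (k := fun x => K (cell_right c - cell_left c)%R (st w, cell_coef c w, x)) _ law).
- exact: (integral_K (p := (st w, cell_coef c w)) D0 (st0 w)).
- by rewrite sqrtr_gt0.
- apply: (measurableT_comp (measurable_K _)); exact: measurable_fun_pair.
- by move=> p; exact: residual_smoothing_ge0.
Qed.

End discrete_scheme.

(** * Fundamental theorem of calculus and the second Gaussian moment *)

Section fundamental_theorem.
Context (R : realType).
Implicit Types (f F : R -> R) (a b : R).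
Local Notation mu := (@lebesgue_measure R).

Lemma is_derive_continuous F f : (forall x, is_derive x (1 : R) F (f x)) ->
  continuous F.
Proof.
move=> dF x; apply: differentiable_continuous; apply/derivable1_diffP.
by have [] := dF x.
Qed.

Lemma integral_is_derive F f a b : a <= b -> continuous F ->
  (forall x, a < x < b -> is_derive x (1 : R) F (f x)) -> continuous f ->
  (\int[mu]_(x in `[a, b]) (f x)%:E = (F b - F a)%:E)%E.
Proof.
move=> ab cF dF cf.
move: ab; rewrite le_eqVlt => /predU1P[<-|ab].
  by rewrite set_itv1 integral_set1 subrr.
rewrite (@continuous_FTC2 _ f F)// ?EFinB//.
- exact: continuous_subspaceT.
- split.
  + by move=> x; rewrite in_itv => /dF[].
  + exact/cvg_at_right_filter/cF.
  + exact/cvg_at_left_filter/cF.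
- by move=> x; rewrite in_itv => /dF[_ <-]; rewrite derive1E.
Qed.

Lemma Rintegral_is_derive F f a b : a <= b -> continuous F ->
  (forall x, a < x < b -> is_derive x (1 : R) F (f x)) -> continuous f ->
  \int[mu]_(x in `[a, b]) (f x) = F b - F a.
Proof. by move=> ab cF dF cf; rewrite /Rintegral (integral_is_derive ab cF dF cf). Qed.

Lemma is_derive_primitive f a x : continuous f -> a < x ->
  is_derive x (1 : R) (fun y => \int[mu]_(u in `[a, y]) f u) (f x).
Proof.
move=> cf ax.
have xx1 : x < x + 1 by rewrite ltrDl.
have fi : mu.-integrable `[a, x + 1] (EFin \o f).
  apply: continuous_compact_integrable; first exact: segment_compact.
  exact: continuous_subspaceT.
have [df fE] := continuous_FTC1_closed xx1 fi ax (cf x).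
apply: DeriveDef; [exact: df|by rewrite -fE derive1E].
Qed.

End fundamental_theorem.

Section gaussian_moments.
Local Open Scope ereal_scope.
Context (R : realType).
Local Notation mu := (@lebesgue_measure R).
Local Notation stdn := (normal_prob (0 : R) 1).
Let p := (normal_pdf (0 : R) 1).

Let pE z : p z = (normal_peak 1 * expR (- (z ^+ 2 / 2)))%R.
Proof.
by rewrite /p normal_pdfE ?oner_neq0// /normal_fun subr0 expr1n mulNr.
Qed.

Let is_derive_p (z : R) : is_derive z (1 : R)%R p (- z * p z)%R.
Proof.
have -> : p = ((cst (normal_peak 1) : R -> R) * (expR \o (fun z => - (z ^+ 2 / 2))))%R.
  by apply/funext => u; rewrite pE.
have D : is_derive z (1 : R)%R (fun z : R => - (z ^+ 2 / 2))%R (- z)%R.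
  have -> : (fun z : R => - (z ^+ 2 / 2))%R = ((- 2^-1) \*: (@id R ^+ 2))%R.
    by apply/funext => u /=; rewrite /GRing.scale/= fctE; field.
  have := is_deriveZ (- 2^-1)%R (is_deriveX 2 (is_derive_id z (1 : R)%R)).
  by move=> /is_derive_eq; apply; rewrite /GRing.scale/= expr1; field.
have := is_deriveM (is_derive_cst (normal_peak 1) z (1 : R)%R)
  (is_derive1_comp (is_derive_expR _) D).
by move=> /is_derive_eq; apply; rewrite /GRing.scale/= /cst/= !fctE; ring.
Qed.

(** From [p' = - z p] the integrand, reduced by [(a^2 + b^2) p], is the derivative
    of [- (b^2 z + 2 a b) p]; over a symmetric interval the boundary terms leave
    only [- 2 b^2 n p(n)], which vanishes as [n] grows. *)
Lemma integral_stdn_sqr_affine (a b : R) :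
  \int[stdn]_z ((a + b * z) ^+ 2)%:E = (a ^+ 2 + b ^+ 2)%:E.
Proof.
pose k z : R := ((a + b * z) ^+ 2 * p z)%R.
have k0 z : (0 <= k z)%R by rewrite mulr_ge0 ?sqr_ge0// normal_pdf_ge0.
have ck : continuous k.
  move=> z; apply: cvgM; last by apply: continuous_normal_pdf; rewrite oner_neq0.
  apply: (@cvgM _ _ _ _ (fun z => a + b * z)%R (fun z => a + b * z)%R);
  exact: continuous_affine.
have mk : measurable_fun [set: R] (EFin \o k).
  by apply/measurable_EFinP; exact: continuous_measurable_fun.
have ma : measurable_fun [set: R] (fun z => a + b * z)%R.
  by apply: continuous_measurable_fun; exact: continuous_affine.
rewrite (ge0_integral_normal_prob _ _ (h := fun z => ((a + b * z) ^+ 2)%:E)); last 2 first.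
- by apply/measurable_EFinP; exact: measurable_funX.
- by move=> x; rewrite lee_fin sqr_ge0.
under eq_integral do rewrite -EFinM -/p.
pose I n := [set` `[- n.+1%:R, n.+1%:R]%R] : set R.
have UI : \bigcup_n I n = setT.
  rewrite -subTset => z _; exists (Num.truncn `|z|) => //=.
  rewrite /I/= in_itv/= -ler_norml.
  by rewrite ltW// truncnS_gt.
have ndI : nondecreasing_seq I.
  move=> m n mn; apply/subsetPset => z; rewrite /I/= !in_itv/= -!ler_norml.
  by move=> /le_trans; apply; rewrite ler_nat ltnS.
have cvg1 : \int[mu]_(z in I n) (k z)%:E @[n --> \oo] --> \int[mu]_z (k z)%:E.
  rewrite -UI; apply: ge0_nondecreasing_set_cvg_integral => //.
  - by move=> n; exact: measurable_itv.
  - by move=> n; exact: measurable_funTS.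
  - by move=> n z _; rewrite lee_fin.
have cvg2 : \int[mu]_(z in I n) (p z)%:E @[n --> \oo] --> 1.
  rewrite -(integral_normal_pdf 0 1).
  rewrite -[in X in _ --> X]UI; apply: ge0_nondecreasing_set_cvg_integral => //.
  - by move=> n; exact: measurable_itv.
  - move=> n; apply/measurable_EFinP/measurable_funTS; exact: measurable_normal_pdf.
  - by move=> n z _; rewrite lee_fin normal_pdf_ge0.
pose G z : R := (- (b ^+ 2 * z + 2 * a * b) * p z)%R.
have key n : \int[mu]_(z in I n) (k z)%:E =
    (a ^+ 2 + b ^+ 2)%:E * \int[mu]_(z in I n) (p z)%:E -
    (2 * b ^+ 2 * n.+1%:R * p n.+1%:R)%:E.
  have dG z : is_derive z (1 : R)%R G (k z - (a ^+ 2 + b ^+ 2) * p z)%R.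
    have D1 : is_derive z (1 : R)%R (fun z => - (b ^+ 2 * z + 2 * a * b))%R (- b ^+ 2)%R.
      have -> : (fun z : R => - (b ^+ 2 * z + 2 * a * b))%R =
         ((- b ^+ 2) \*: @id R + cst (- (2 * a * b)))%R.
        apply/funext => u; rewrite [RHS](_ : _ = - b ^+ 2 * u + - (2 * a * b))%R//; ring.
      have := is_deriveD (is_deriveZ (- b ^+ 2)%R (is_derive_id z (1 : R)%R))
         (is_derive_cst (- (2 * a * b))%R z (1 : R)%R).
      by move=> /is_derive_eq; apply; rewrite /GRing.scale/=; ring.
    have := is_deriveM D1 (is_derive_p z).
    by move=> /is_derive_eq; apply; rewrite /k /GRing.scale/=; ring.
  have cp : continuous p by apply: continuous_normal_pdf; rewrite oner_neq0.
  have cG' : continuous (fun z => k z - (a ^+ 2 + b ^+ 2) * p z)%R.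
    move=> z; apply: (@cvgB _ R^o); first exact: ck.
    by apply: cvgM; [exact: cvg_cst|exact: cp].
  have nn : (- n.+1%:R <= n.+1%:R :> R)%R by rewrite -subr_ge0 opprK addr_ge0.
  have ip : mu.-integrable (I n) (EFin \o p).
    apply: continuous_compact_integrable; first exact: segment_compact.
    exact: continuous_subspaceT.
  have ik : mu.-integrable (I n) (EFin \o k).
    apply: continuous_compact_integrable; first exact: segment_compact.
    exact: continuous_subspaceT.
  have := integral_is_derive nn (is_derive_continuous dG) (fun z _ => dG z) cG'.
  have kE z : (k z - (a ^+ 2 + b ^+ 2) * p z)%:E =
    (k z)%:E - (a ^+ 2 + b ^+ 2)%:E * (p z)%:E by [].
  under eq_integral do rewrite kE.
  rewrite integralB//; last exact: integrableZl.
  rewrite integralZl//.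
  have fp : \int[mu]_(z in I n) (p z)%:E \is a fin_num by apply: integrable_fin_num => //; exact: measurable_itv.
  have fk : \int[mu]_(z in I n) (k z)%:E \is a fin_num by apply: integrable_fin_num => //; exact: measurable_itv.
  rewrite -(fineK fp) -(fineK fk) -!EFinM -!EFinB => -[/eqP].
  rewrite subr_eq => /eqP ->; congr (_%:E).
  have pN : p (- n.+1%:R) = p n.+1%:R by rewrite !pE sqrrN.
  by rewrite /G pN; ring.
have cvg3 : (2 * b ^+ 2 * n.+1%:R * p n.+1%:R)%:E @[n --> \oo] --> 0.
  have up n : (2 * b ^+ 2 * n.+1%:R * p n.+1%:R <=
      4 * b ^+ 2 * normal_peak 1 * (n.+1%:R)^-1)%R.
    rewrite pE expRN.
    set e := expR _; set k1 := n.+1%:R.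
    rewrite (_ : 2 * b ^+ 2 * k1 * (normal_peak 1 * e^-1) =
      normal_peak 1 * (2 * (b ^+ 2 * k1) * e^-1))%R; last by ring.
    rewrite (_ : 4 * b ^+ 2 * normal_peak 1 * k1^-1 =
      normal_peak 1 * (4 * b ^+ 2 * k1^-1))%R; last by ring.
    rewrite ler_wpM2l ?normal_peak_ge0//.
    have e0 : (n.+1%:R ^+ 2 / 2 <= expR (n.+1%:R ^+ 2 / 2) :> R)%R.
      by apply: le_trans (expR_ge1Dx _); rewrite lerDr.
    have : ((expR (n.+1%:R ^+ 2 / 2))^-1 <= (n.+1%:R ^+ 2 / 2)^-1 :> R)%R.
      by rewrite lef_pV2// posrE ?expR_gt0// divr_gt0// exprn_gt0.
    move=> h.
    have b0 : (0 <= 2 * (b ^+ 2 * n.+1%:R) :> R)%R.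
      by rewrite mulr_ge0// mulr_ge0// sqr_ge0.
    apply: (@le_trans _ _ (2 * (b ^+ 2 * n.+1%:R) * (n.+1%:R ^+ 2 / 2)^-1)%R).
      by rewrite ler_wpM2l.
    have k10 : k1 != 0%R by rewrite pnatr_eq0.
    rewrite -/k1; move: (k1) k10 => v v0.
    rewrite le_eqVlt; apply/orP; left; apply/eqP; field.
    exact: v0.
  apply: (@squeeze_cvge _ _ _ _ (cst 0) _
      (fun n => (4 * b ^+ 2 * normal_peak 1 * (n.+1%:R)^-1)%:E)).
  - apply: nearW => n; rewrite !lee_fin up andbT.
    by rewrite mulr_ge0 ?normal_pdf_ge0// mulr_ge0// mulr_ge0// sqr_ge0.
  - exact: cvg_cst.
  - apply: cvg_EFin; first exact: nearW.
    rewrite -[X in _ --> X](mulr0 (4 * b ^+ 2 * normal_peak 1)%R).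
    apply: cvgM; first exact: cvg_cst.
    exact: cvg_harmonic.
have cvg4 : \int[mu]_(z in I n) (k z)%:E @[n --> \oo] --> (a ^+ 2 + b ^+ 2)%:E.
  have c2 := cvgeZl (y := (a ^+ 2 + b ^+ 2)%:E) isT cvg2.
  have ad : (a ^+ 2 + b ^+ 2)%:E * 1 +? - (0 : \bar R).
    by rewrite oppe0 fin_num_adde_defl.
  have := cvgeB ad c2 cvg3.
  rewrite sube0 mule1; move=> h.
  by rewrite (eq_cvg _ _ key); exact: h.
exact: (cvg_unique _ cvg1 cvg4).
Qed.

End gaussian_moments.

(** * Laws tested against bounded continuous functions *)

Section bounded_convergence.
Local Open Scope ereal_scope.
Context {d} {T : measurableType d} {R : realType} (P : probability T R).

Lemma bounded_cvg_integral (f_ : nat -> T -> \bar R) (f : T -> \bar R) :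
  (forall n, measurable_fun [set: T] (f_ n)) -> measurable_fun [set: T] f ->
  (forall n w, 0 <= f_ n w <= 1) ->
  {ae P, forall w, f_ n w @[n --> \oo] --> f w} ->
  \int[P]_w f_ n w @[n --> \oo] --> \int[P]_w f w.
Proof.
move=> mf_ mf f01 f_f.
have [] // := @dominated_convergence _ T R P setT measurableT f_ f (cst 1) mf_ mf.
- by apply: filterS f_f => w fw _.
- exact: finite_measure_integrable_cst.
- by apply: aeW => w n _; rewrite gee0_abs; have /andP[] := f01 n w.
Qed.

End bounded_convergence.

Section test_functions.
Local Open Scope ereal_scope.
Context {R : realType}.

Definition test_function (h : R -> R) :=
  continuous h /\ forall x, (0 <= h x <= 1)%R.

Lemma test_functionW (h : R -> R) : test_function h -> forall x, (0 <= h x)%R.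
Proof. by move=> [_ h01] x; have /andP[] := h01 x. Qed.

Let ramp (x : R) (n : nat) (y : R) : R :=
  Num.min 1%R (Num.max 0%R (n%:R * (y - x))%R).

Let ramp_test x n : test_function (ramp x n).
Proof.
split => [y|y]; last first.
  by rewrite /ramp le_min ler01 le_max lexx ge_min lexx.
have cl : {for y, continuous (fun y => n%:R * (y - x) : R^o)%R}.
  apply: cvgM; first exact: cvg_cst.
  by apply: (@cvgB _ R^o); [exact: cvg_id|exact: cvg_cst].
have c0 (r : R) : {for y, continuous (cst r : R -> R^o)} by exact: cvg_cst.
exact: (continuous_min (c0 1%R) (continuous_max (c0 0%R) cl)).
Qed.

Let ramp_cvg x y : ramp x n y @[n --> \oo] --> (\1_(`]x, +oo[%classic) y : R).
Proof.
have [xy|yx] := ltP x y; last first.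
  rewrite indicE memNset; last by rewrite /= in_itv/= andbT ltNge yx.
  rewrite (_ : (fun n => _) = cst 0%R); first exact: cvg_cst.
  apply/funext => n; rewrite /ramp /=.
  rewrite (max_l (y := (n%:R * (y - x))%R)) ?min_r//.
  by rewrite mulr_ge0_le0// subr_le0.
rewrite indicE mem_set/=; last by rewrite /= in_itv/= andbT.
apply/cvgrPdist_lt => e e0; near=> n.
rewrite /ramp (max_r (x := 0%R)); last by rewrite mulr_ge0// subr_ge0 ltW.
rewrite min_l ?subrr ?normr0// -ler_pdivrMr ?subr_gt0// mul1r.
by near: n; exact: nbhs_infty_ger.
Unshelve. all: by end_near. Qed.

(** Continuous ramps converge to the indicators of the open half-lines bounded
    below, which generate the Borel sets. *)
Lemma eq_measure_test_functions (m1 m2 : probability (measurableTypeR R) R) :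
  (forall h, test_function h -> \int[m1]_x (h x)%:E = \int[m2]_x (h x)%:E) ->
  forall A, measurable A -> m1 A = m2 A.
Proof.
move=> h12 A mA.
have lim_half (m : probability (measurableTypeR R) R) x :
    \int[m]_y (ramp x n y)%:E @[n --> \oo] --> m `]x, +oo[%classic.
  have mI : @measurable _ (measurableTypeR R) `]x, +oo[%classic.
    exact: (@measurable_itv R `]x, +oo[%R).
  rewrite -[X in _ --> m X]setIT -integral_indic//.
  apply: bounded_cvg_integral.
  - move=> n; apply/measurable_EFinP.
    by apply: continuous_measurable_fun; have [] := ramp_test x n.
  - by apply/measurable_EFinP; exact: measurable_indic.
  - by move=> n y; rewrite !lee_fin; have [] := ramp_test x n.
  - by apply: aeW => y; apply: cvg_EFin; [exact: nearW|exact: ramp_cvg].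
pose g n : set R := [set` `](- n%:R)%R, +oo[].
apply: (@measure_unique _ R (measurableTypeR R) (@RGenOInfty.G R) g) => //.
- exact: RGenOInfty.measurableE.
- move=> _ _ [x ->] [y ->]; exists (Num.max x y).
  by apply/seteqP; split => z /=; rewrite !in_itv/= !andbT gt_max;
    [move=> [-> ->]|move=> /andP].
- by move=> n; exists (- n%:R)%R.
- rewrite -subTset => z _; exists (Num.truncn `|z|).+1 => //=.
  rewrite /g /= in_itv/= andbT ltrNl.
  by rewrite (le_lt_trans _ (truncnS_gt _))// -normrN ler_norm.
- move=> _ [x ->]; have L1 := lim_half m1 x; have L2 := lim_half m2 x.
  have E : (fun n => \int[m1]_y (ramp x n y)%:E) = (fun n => \int[m2]_y (ramp x n y)%:E).
    by apply/funext => n; exact: h12.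
  rewrite E in L1; exact: (cvg_unique _ L1 L2).
- move=> n; apply: (@le_lt_trans _ _ 1); last by rewrite ltry.
  apply: probability_le1; exact: (@measurable_itv R `](- n%:R)%R, +oo[%R).
Qed.

Context {d} {T : measurableType d} (P : probability T R).

Lemma has_gaussian_law_test_functions m s (xi : T -> R) :
  measurable_fun [set: T] xi -> (0 <= s)%R ->
  (forall h, test_function h -> \int[P]_w (h (xi w))%:E =
    \int[normal_prob (0 : R) 1]_z (h (m + s * z)%R)%:E) ->
  has_gaussian_law P m s xi.
Proof.
move=> mxi s0 hxi; split => // B mB.
pose X : {mfun T >-> measurableTypeR R} :=
  HB.pack xi (isMeasurableFun.Build _ _ T (measurableTypeR R) xi mxi).
have EX h : test_function h ->
    \int[distribution P X]_y (h y)%:E = \int[P]_w (h (xi w))%:E.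
  move=> hT; rewrite ge0_integral_distribution//.
    by apply/measurable_EFinP; apply: continuous_measurable_fun; case: hT.
  by move=> y; rewrite lee_fin test_functionW.
rewrite /gaussian_law; have [s_eq0|sn0] := eqVneq s 0%R.
  pose D : probability (measurableTypeR R) R := @dirac _ (measurableTypeR R) m R.
  apply: (@eq_measure_test_functions (distribution P X) D); last exact: mB.
  move=> h hT; rewrite EX// hxi// s_eq0 integral_dirac//; last first.
    by apply/measurable_EFinP; apply: continuous_measurable_fun; case: hT.
  rewrite diracT mul1e.
  under eq_integral do rewrite mul0r addr0.
  by rewrite integral_probability_cst.
apply: (@eq_measure_test_functions (distribution P X) (normal_prob m s)); last exact: mB.
move=> h hT; rewrite (EX _ hT) (hxi _ hT); apply/esym/integral_normal_affine.
- by rewrite lt_neqAle eq_sym sn0.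
- by case: hT.
- exact: test_functionW.
Qed.

End test_functions.

Section residual_smoothing_limits.
Local Open Scope ereal_scope.
Context {d} {T : measurableType d} {R : realType} (P : probability T R).
Variables (h : R -> R) (hT : test_function h).
Local Notation stdn := (normal_prob (0 : R) 1).

Lemma residual_smoothing01 q p : 0 <= residual_smoothing q h p <= 1.
Proof.
rewrite residual_smoothing_ge0 ?andTb; last exact: test_functionW.
rewrite -(@probability_setT _ _ R stdn) -[X in _ <= X]mul1e -integral_cst//.
apply: ge0_le_integral => //.
- by move=> z _; rewrite lee_fin test_functionW.
- apply/measurable_EFinP; apply: measurableT_comp.
    by apply: continuous_measurable_fun; case: hT.
  by apply: continuous_measurable_fun; exact: continuous_affine.
- by move=> z _; rewrite lee_fin; have [_ /(_ (p.1 + Num.sqrt (q - p.2) * z)%R)/andP[]] := hT.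
Qed.

(** Continuity up to the terminal level, [p.2 = q] included, where the smoothing
    is [h] itself. *)
Lemma residual_smoothing_cvg (q_ : nat -> R) (p_ : nat -> R * R) q p :
  q_ n @[n --> \oo] --> q ->
  (p_ n).1 @[n --> \oo] --> p.1 -> (p_ n).2 @[n --> \oo] --> p.2 ->
  residual_smoothing (q_ n) h (p_ n) @[n --> \oo] --> residual_smoothing q h p.
Proof.
move=> qq p1 p2; have [ch h01] := hT.
have mh (a b : R) : measurable_fun [set: R] (fun z => (h (a + b * z)%R)%:E).
  apply/measurable_EFinP; apply: measurableT_comp.
    by apply: continuous_measurable_fun.
  by apply: continuous_measurable_fun; exact: continuous_affine.
apply: (@bounded_cvg_integral _ _ R stdn
  (fun n z => (h ((p_ n).1 + Num.sqrt (q_ n - (p_ n).2) * z)%R)%:E)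
  (fun z => (h (p.1 + Num.sqrt (q - p.2) * z)%R)%:E)).
- by move=> n; exact: mh.
- exact: mh.
- by move=> n z; rewrite /= !lee_fin.
- apply: aeW => z; apply: cvg_EFin; first exact: nearW.
  apply: continuous_cvg; first exact: ch.
  apply: cvgD => //; apply: cvgM; last exact: cvg_cst.
  apply: continuous_cvg; first exact: sqrt_continuous.
  exact: (@cvgB _ R^o).
Qed.

Lemma integral_residual_smoothing_cvg (q_ : nat -> R)
    (p_ : nat -> T -> R * R) q (p : T -> R * R) :
  q_ n @[n --> \oo] --> q ->
  (forall n, measurable_fun [set: T] (p_ n)) -> measurable_fun [set: T] p ->
  {ae P, forall w, (p_ n w).1 @[n --> \oo] --> (p w).1 /\
                   (p_ n w).2 @[n --> \oo] --> (p w).2} ->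
  \int[P]_w residual_smoothing (q_ n) h (p_ n w) @[n --> \oo] -->
  \int[P]_w residual_smoothing q h (p w).
Proof.
move=> qq mp_ mp p_p; have [ch h01] := hT.
apply: bounded_cvg_integral.
- by move=> n; apply: measurableT_comp => //; apply: measurable_residual_smoothing => //; exact: test_functionW.
- by apply: measurableT_comp => //; apply: measurable_residual_smoothing => //; exact: test_functionW.
- by move=> n w; exact: residual_smoothing01.
- by apply: filterS p_p => w [p1 p2]; exact: residual_smoothing_cvg.
Qed.

End residual_smoothing_limits.

(** * Joint measurability of continuous processes and of the time change *)

Section continuous_on_half_line.
Context {R : realType}.
Implicit Types f : R -> R.

Lemma continuous_max0 : continuous (fun v : R => Num.max v 0).
Proof.
move=> v; have ci : {for v, continuous (id : R -> R^o)} by exact: cvg_id.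
have c0 : {for v, continuous (cst 0 : R -> R^o)} by exact: cvg_cst.
exact: (continuous_max ci c0).
Qed.

Lemma continuous_comp_max0 f : {within `[0, +oo[, continuous f} ->
  continuous (fun v : R => f (Num.max v 0)).
Proof.
move=> /continuous_within_itvcyP[cf f0] v.
have [v0|v0|->] := ltgtP v 0.
- have : (fun _ : R => f 0) @ v --> f (Num.max v 0).
    by rewrite max_r ?(ltW v0)//; exact: cvg_cst.
  apply: cvg_trans; apply: near_eq_cvg; near=> u.
  by rewrite max_r// ltW//; near: u; exact: lt_nbhsl.
- have : f @ v --> f (Num.max v 0).
    by rewrite max_l ?(ltW v0)//; apply: cf; rewrite in_itv/= andbT.
  apply: cvg_trans; apply: near_eq_cvg; near=> u.
  by rewrite max_l// ltW//; near: u; exact: lt_nbhsr.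
- rewrite /continuous_at maxxx.
  apply/cvgrPdist_lt => e e0.
  move/cvgrPdist_lt : f0 => /(_ e e0); rewrite near_withinE => -[r r0 H].
  exists r => // u /= ur.
  have [u0|u0] := leP u 0; first by rewrite subrr normr0.
  by apply: H.
Unshelve. all: by end_near. Qed.

(** Approximation of [v] from below by a countable grid: a process read at these
    times involves countably many random variables, so it is jointly measurable. *)
Definition floor_frac (n : nat) (v : R) : R :=
  (Num.truncn (n.+1%:R * v))%:R / n.+1%:R.

Lemma floor_frac_itv n v : 0 <= v ->
  0 <= floor_frac n v <= v /\ v - floor_frac n v <= n.+1%:R^-1.
Proof.
move=> v0; have nv0 : 0 <= n.+1%:R * v by rewrite mulr_ge0.
have /andP[lo hi] := truncn_itv nv0.
split.
  rewrite /floor_frac divr_ge0//= ler_pdivrMr ?ltr0Sn//.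
  by rewrite [v * _]mulrC.
have n0 : (0 : R) < n.+1%:R by rewrite ltr0Sn.
rewrite lerBlDl /floor_frac -[X in _ + X]mul1r -mulrDl ler_pdivlMr//.
by rewrite [v * _]mulrC natr1 ltW.
Qed.

Lemma floor_frac_cvg v : 0 <= v -> floor_frac n v @[n --> \oo] --> v.
Proof.
move=> v0; apply: (@squeeze_cvgr _ _ _ _ (fun n => v - n.+1%:R^-1) (cst v)).
- apply: nearW => n /=; have [/andP[_ ->] h] := floor_frac_itv n v0.
  by rewrite andbT lerBlDr addrC -lerBlDr.
- rewrite -[X in _ --> X]subr0; apply: (@cvgB _ R^o); first exact: cvg_cst.
  exact: cvg_harmonic.
- exact: cvg_cst.
Qed.

End continuous_on_half_line.

Section joint_measurability.
Context {d} {T : measurableType d} {R : realType}.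
Implicit Types Y : R -> T -> R.

Lemma measurable_continuous_process Y :
  (forall t, 0 <= t -> measurable_fun [set: T] (Y t)) ->
  (forall w, continuous_path Y w) ->
  measurable_fun [set: T * R] (fun p : T * R => Y (Num.max p.2 0) p.1).
Proof.
move=> mY cY.
pose Yn n (p : T * R) := Y (floor_frac n (Num.max p.2 0)) p.1.
apply: (@measurable_fun_cvg _ _ _ setT Yn); last first.
  move=> [w v] _ /=; rewrite /Yn /=.
  have v0 : 0 <= Num.max v 0 by rewrite le_max lexx orbT.
  have := continuous_comp_max0 (cY w) => c.
  move: (Num.max v 0) v0 => u u0.
  have cc : Y (Num.max (floor_frac n u) 0) w @[n --> \oo] --> Y (Num.max u 0) w.
    exact: (cvg_comp _ _ (floor_frac_cvg u0) (c u)).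
  rewrite (max_l u0) in cc.
  rewrite (_ : (fun n => _) = (fun n => Y (Num.max (floor_frac n u) 0) w)) //.
  apply/funext => n; rewrite max_l//.
  by have [/andP[]] := floor_frac_itv n u0.
move=> n.
pose D k := [set p : T * R | Num.truncn (n.+1%:R * Num.max p.2 0) = k].
have mD k : measurable (D k).
  have mg : measurable_fun [set: T * R] (fun p : T * R => n.+1%:R * Num.max p.2 0).
    apply: measurable_funM => //; apply: measurable_maxr => //.
  have -> : D k = (fun p : T * R => n.+1%:R * Num.max p.2 0) @^-1` `[k%:R, k.+1%:R[%classic.
    apply/seteqP; split => [[w v]|[w v]] /=; rewrite /D /= in_itv/=.
      move=> /eqP; rewrite truncn_eq ?mulr_ge0// ?le_max ?lexx ?orbT//.
    by move=> h; apply/eqP; rewrite truncn_eq ?mulr_ge0// ?le_max ?lexx ?orbT.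
  by rewrite -[X in measurable X]setTI; apply: mg => //; exact: measurable_itv.
have -> : [set: T * R] = \bigcup_k D k.
  apply/esym; rewrite -subTset => p _; exists (Num.truncn (n.+1%:R * Num.max p.2 0)) => //.
apply/(measurable_fun_bigcup _ mD) => k.
apply: (@eq_measurable_fun _ _ _ _ _ (Y (k%:R / n.+1%:R) \o fst)).
  move=> p /set_mem Dp; by rewrite /Yn /floor_frac /= Dp.
apply: measurable_funTS; apply: measurableT_comp => //.
by apply: mY; rewrite divr_ge0.
Qed.

Lemma measurable_fine_integral (G : T * R -> R) :
  measurable_fun [set: T * R] G ->
  measurable_fun [set: T] (fun w => \int[@lebesgue_measure R]_v G (w, v)).
Proof.
move=> mG.
have mEG : measurable_fun [set: T * R] (EFin \o G) by exact/measurable_EFinP.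
rewrite /Rintegral; apply: measurableT_comp; first exact: fine_measurable.
under eq_fun do rewrite integralE.
apply: emeasurable_funB.
- have := @measurable_fun_fubini_tonelli_F _ _ _ _ R (@lebesgue_measure R)
    ((EFin \o G)^\+)%E (measurable_funepos mEG) (fun p => funepos_ge0 _ p).
  congr (measurable_fun _ _); apply/funext => w.
  by apply: eq_integral => v _; rewrite !funeposE.
- have := @measurable_fun_fubini_tonelli_F _ _ _ _ R (@lebesgue_measure R)
    ((EFin \o G)^\-)%E (measurable_funeneg mEG) (fun p => funeneg_ge0 _ p).
  congr (measurable_fun _ _); apply/funext => w.
  by apply: eq_integral => v _; rewrite !funenegE.
Qed.

Lemma measurable_fine_integral_set (E : set (T * R)) (G : T * R -> R) :
  measurable E -> measurable_fun [set: T * R] G ->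
  measurable_fun [set: T]
    (fun w => \int[@lebesgue_measure R]_(v in [set v | E (w, v)]) G (w, v)).
Proof.
move=> mE mG.
have mGE : measurable_fun [set: T * R] (G \_ E).
  by apply/measurable_restrict => //; exact: measurable_funTS.
have := measurable_fine_integral mGE.
congr (measurable_fun _ _); apply/funext => w.
by rewrite [RHS]Rintegral_mkcond.
Qed.

(** The condition on the right only involves rational multiples of [v], which
    makes the set of pairs [(w, v)] below the passage time measurable.  It is
    sufficient because a path exceeding [t] before [v] does so at one of them, by
    continuity. *)
Lemma passage_time_lower (C : R -> T -> R) (t : R) (w : T) (v : R) : continuous_path C w -> 0 <= v ->
  ((v%:E <= passage_time C t w)%E <->
   (forall k j : nat, (j <= k)%N -> 0 < v ->
      C (Num.max (j%:R / k.+1%:R * v) 0) w <= t)).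
Proof.
move=> cC v0; split => [vt k j jk v1|H].
  have k0 : (0 : R) < k.+1%:R by rewrite ltr0Sn.
  have jv0 : 0 <= j%:R / k.+1%:R * v by rewrite mulr_ge0// divr_ge0.
  rewrite max_l// leNgt; apply/negP => Ct.
  have : (v%:E <= (j%:R / k.+1%:R * v)%:E)%E.
    apply: le_trans vt _; apply: ereal_inf_lbound.
    by exists (j%:R / k.+1%:R * v).
  rewrite lee_fin leNgt => /negP; apply.
  by rewrite gtr_pMl// ltr_pdivrMr// mul1r ltr_nat ltnS.
apply: le_ereal_inf_tmp => _ [r [r0 Cr] <-]; rewrite lee_fin leNgt; apply/negP => rv.
have v1 : 0 < v by exact: le_lt_trans rv.
have rv0 : 0 <= r / v by rewrite divr_ge0.
have cc : C (Num.max (floor_frac n (r / v) * v) 0) w @[n --> \oo] -->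
    C (Num.max (r / v * v) 0) w.
  have cm : floor_frac n (r / v) * v @[n --> \oo] --> r / v * v.
    by apply: cvgM; [exact: floor_frac_cvg|exact: cvg_cst].
  exact: (cvg_comp (fun n => floor_frac n (r / v) * v) (fun u => C (Num.max u 0) w)
     cm (continuous_comp_max0 cC (x := r / v * v))).
rewrite divfK ?gt_eqF// max_l// in cc.
have : C r w <= t.
  rewrite -(cvg_lim _ cc)//; apply: limr_le; first by apply/cvg_ex; eexists; exact: cc.
  apply: nearW => n; apply: H => //.
  rewrite -ltnS truncn_lt_nat; last exact: mulr_ge0.
  by rewrite gtr_pMr ?ltr0Sn// ltr_pdivrMr// mul1r.
by move=> h; have := le_lt_trans h Cr; rewrite ltxx.
Qed.

Lemma measurable_time_changed_integral (c : R) Z C t :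
  (forall t, 0 <= t -> measurable_fun [set: T] (Z t)) ->
  (forall w, continuous_path Z w) ->
  (forall t, 0 <= t -> measurable_fun [set: T] (C t)) ->
  (forall w, continuous_path C w) ->
  measurable_fun [set: T] (time_changed_integral c Z C t).
Proof.
move=> mZ cZ mC cC.
have mZ' := measurable_continuous_process mZ cZ.
have mC' := measurable_continuous_process mC cC.
pose E1 := [set p : T * R | 0 <= p.2].
pose E2 k j := [set p : T * R | (j <= k)%N -> 0 < p.2 ->
  C (Num.max (j%:R / k.+1%:R * p.2) 0) p.1 <= t].
pose E := E1 `&` \bigcap_k \bigcap_j E2 k j.
have mE1 : measurable E1.
  rewrite (_ : E1 = snd @^-1` `[0, +oo[%classic).
    by rewrite -[X in measurable X]setTI; apply: measurable_snd => //; exact: measurable_itv.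
  by apply/seteqP; split => p; rewrite /E1 /= in_itv/= andbT.
have mE2 k j : measurable (E2 k j).
  have [jk|jk] := leqP j k; last first.
    rewrite (_ : E2 k j = setT) //; apply/seteqP; split => // p _.
    by rewrite /E2 /= leqNgt jk.
  rewrite (_ : E2 k j = (snd @^-1` `]-oo, 0]%classic) `|`
    ((fun p : T * R => C (Num.max (j%:R / k.+1%:R * p.2) 0) p.1) @^-1` `]-oo, t]%classic)).
    apply: measurableU.
      by rewrite -[X in measurable X]setTI; apply: measurable_snd => //; exact: measurable_itv.
    rewrite -[X in measurable X]setTI.
    have m : measurable_fun [set: T * R]
        (fun p : T * R => C (Num.max (j%:R / k.+1%:R * p.2) 0) p.1).
      apply: (measurableT_comp mC' (_ : measurable_fun setT (fun p : T * R => (p.1, j%:R / k.+1%:R * p.2)))).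
      by apply: measurable_fun_pair => //; exact: measurable_funM.
    by apply: m => //; exact: measurable_itv.
  apply/seteqP; split => p; rewrite /E2 /= !in_itv/=.
    by move=> /(_ jk) h; have [|/h] := leP p.2 0; [left|right].
  by move=> [p0|h _ _//] _; rewrite ltNge p0.
have mE : measurable E.
  apply: measurableI => //; apply: bigcapT_measurable => k.
  exact: bigcapT_measurable.
have -> : time_changed_integral c Z C t = (fun w =>
    \int[@lebesgue_measure R]_(v in [set v | E (w, v)])
    ((Z (Num.max v 0) w - c * v) * Z (Num.max v 0) w)).
  apply/funext => w; rewrite /time_changed_integral.
  have -> : [set v | 0 <= v /\ (v%:E <= passage_time C t w)%E] = [set v | E (w, v)].
    apply/seteqP; split => v /=.
      by move=> [v0 /(passage_time_lower _ (cC w) v0) h]; split => // k _ j _; exact: h.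
    move=> [v0 h]; split => //; apply/(passage_time_lower _ (cC w) v0) => k j.
    exact: h.
  apply: eq_Rintegral => v; move=> /set_mem [v0 _].
  by rewrite max_l.
apply: (measurable_fine_integral_set (G := fun p : T * R =>
  (Z (Num.max p.2 0) p.1 - c * p.2) * Z (Num.max p.2 0) p.1) mE).
apply: measurable_funM => //; apply: measurable_funB => //; exact: measurable_funM.
Qed.

End joint_measurability.

(** * Integrals over segments *)

Section interval_integrals.
Context {R : realType}.
Implicit Types (f k j : R -> R) (a b u v : R).
Local Notation mu := (@lebesgue_measure R).

Lemma integrable_segment f a b : continuous f ->
  mu.-integrable `[a, b] (EFin \o f).
Proof.
move=> cf; apply: continuous_compact_integrable; first exact: segment_compact.
exact: continuous_subspaceT.
Qed.

Lemma integrable_subsegment f a b a' b' : a <= a' -> b' <= b ->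
  mu.-integrable `[a, b] (EFin \o f) -> mu.-integrable `[a', b'] (EFin \o f).
Proof.
move=> aa bb; apply: integrableS => //; apply: subset_itv; rewrite bnd_simp//.
Qed.

Lemma Rintegral_itv_cat f a b c : a <= b -> b <= c ->
  mu.-integrable `[a, c] (EFin \o f) ->
  \int[mu]_(x in `[a, c]) f x =
  \int[mu]_(x in `[a, b]) f x + \int[mu]_(x in `[b, c]) f x.
Proof.
move=> ab bc fi; have := Rintegral_itvB (x := b) fi.
rewrite !bnd_simp => /(_ ab bc) /eqP; rewrite subr_eq addrC => /eqP ->.
congr (_ + _); apply: Rintegral_itv_obnd_cbnd.
apply: integrableS fi => //; apply: subset_itv; rewrite bnd_simp//.
Qed.

Lemma Rintegral_itv1 f a : \int[mu]_(x in `[a, a]) f x = 0.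
Proof. by rewrite set_itv1 Rintegral_set1. Qed.

Lemma le_normr_Rintegral_bounded f k a b :
  mu.-integrable `[a, b] (EFin \o f) -> mu.-integrable `[a, b] (EFin \o k) ->
  (forall x, a <= x <= b -> `|f x| <= k x) ->
  `|\int[mu]_(x in `[a, b]) f x| <= \int[mu]_(x in `[a, b]) k x.
Proof.
move=> fi ki fk; apply: le_trans (le_normr_Rintegral _ fi) _ => //.
have afi : mu.-integrable `[a, b] (EFin \o (fun x => `|f x|)).
  by have := integrable_abse fi; apply: eq_integrable.
by apply: (le_Rintegral _ afi ki) => // x /=; rewrite in_itv/= => /fk.
Qed.

Lemma Rintegral_grid f (T : R) n : 0 <= T ->
  mu.-integrable `[0, T] (EFin \o f) ->
  \int[mu]_(x in `[0, T]) f x =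
  \sum_(i < n.+1) \int[mu]_(x in `[T * i%:R / n.+1%:R, T * i.+1%:R / n.+1%:R]) f x.
Proof.
move=> T0 fi.
have tk i : (i <= n.+1)%N -> T * i%:R / n.+1%:R <= T.
  by move=> iN; rewrite ler_pdivrMr ?ltr0Sn// ler_wpM2l// ler_nat.
have tk0 i : 0 <= T * i%:R / n.+1%:R by rewrite divr_ge0// mulr_ge0.
have H m : (m <= n.+1)%N -> \int[mu]_(x in `[0, T * m%:R / n.+1%:R]) f x =
  \sum_(i < m) \int[mu]_(x in `[T * i%:R / n.+1%:R, T * i.+1%:R / n.+1%:R]) f x.
  elim: m => [_|m IH mn].
    by rewrite big_ord0 mulr0 mul0r Rintegral_itv1.
  rewrite big_ord_recr/= -IH ?(ltnW mn)//; apply: Rintegral_itv_cat => //.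
    by rewrite ler_pM2r ?invr_gt0 ?ltr0Sn// ler_wpM2l// ler_nat.
  by apply: integrable_subsegment fi => //; exact: tk.
by rewrite -H// -mulrA divff ?mulr1// pnatr_eq0.
Qed.

Lemma uniform_continuity_segment f (T : R) : continuous f ->
  forall e, 0 < e -> exists2 dl, 0 < dl & forall u v,
    0 <= u <= T -> `|u - v| < dl -> `|f u - f v| < e.
Proof.
move=> cf e e0.
have /compact_near_coveringP := @segment_compact R 0 T.
move=> /(_ R (0^'+) (fun dl u => forall v, `|u - v| < dl -> `|f u - f v| < e)).
have FF : Filter ((0 : R)^'+) by exact: at_right_proper_filter.
move=> /(_ FF) H.
have : \forall dl \near 0^'+, `[0, T]%classic `<=` (fun u => forall v : R, `|u - v| < dl -> `|f u - f v| < e).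
  apply: H => x _.
  have e2 : 0 < e / 2 by rewrite divr_gt0.
  have /cvgrPdist_lt/(_ _ e2) := cf x; rewrite nearE => -[r /= r0 Hr].
  have r2 : 0 < r / 2 by rewrite divr_gt0.
  near=> u dl => v uv.
  have xu : `|x - u| < r / 2 by near: u; exact: nbhsx_ballx.
  have dr : dl < r / 2 by near: dl; exact: nbhs_right_lt.
  have fxu : `|f x - f u| < e / 2.
    by apply: Hr => /=; apply: lt_trans xu _; rewrite ltr_pdivrMr// ltr_pMr// ltr1n.
  have fxv : `|f x - f v| < e / 2.
    apply: Hr => /=; rewrite -(subrK u x) -addrA (le_lt_trans (ler_normD _ _))//.
    by rewrite [ltRHS]splitr ltrD// (lt_trans uv).
  rewrite -(subrK (f x) (f u)) -addrA (le_lt_trans (ler_normD _ _))//.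
  by rewrite [ltRHS]splitr ltrD// distrC.
move=> [dl /= dl0 Hdl]; exists (dl / 2); first by rewrite divr_gt0.
move=> u v uT uv; apply: (Hdl (dl / 2)) => //=.
- by rewrite sub0r normrN gtr0_norm ?divr_gt0// ltr_pdivrMr// ltr_pMr// ltr1n.
- by rewrite divr_gt0.
Unshelve. all: by end_near. Qed.

End interval_integrals.

(** * Clocks and their sublevel sets *)

Section clock.
Context {R : realType}.
Local Notation mu := (@lebesgue_measure R).
Variables (z A : R -> R).
Hypotheses (cz : continuous z) (z0 : forall v, 0 <= z v).
Hypotheses (cA : continuous A) (A_le0 : forall v, v <= 0 -> A v = 0).
Hypothesis AE : forall v, 0 <= v -> A v = \int[mu]_(u in `[0, v]) z u.

Lemma clockB (u v : R) : 0 <= u -> u <= v -> A v = A u + \int[mu]_(y in `[u, v]) z y.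
Proof.
move=> u0 uv; rewrite !AE//; last exact: le_trans uv.
by apply: Rintegral_itv_cat => //; exact: integrable_segment.
Qed.

Lemma clock_nd (u v : R) : u <= v -> A u <= A v.
Proof.
have Age0 y : 0 <= A y.
  have [y0|y0] := leP 0 y; last by rewrite A_le0// ltW.
  by rewrite AE//; apply: Rintegral_ge0.
move=> uv; have [u0|u0] := leP 0 u; last by rewrite A_le0// ltW.
by rewrite (clockB u0 uv) lerDl; apply: Rintegral_ge0.
Qed.

Lemma clock_ge0 (v : R) : 0 <= A v.
Proof.
have [v0|v0] := leP v 0; first by rewrite A_le0.
by rewrite -(A_le0 (lexx 0)) clock_nd// ltW.
Qed.

Lemma is_derive_clock (v : R) : 0 < v -> is_derive v (1 : R) A (z v).
Proof.
move=> v0; have D := is_derive_primitive cz v0.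
apply: near_eq_is_derive D.
near=> u; rewrite AE//.
by rewrite ltW//; near: u; exact: lt_nbhsr.
Unshelve. all: by end_near. Qed.

(** Change of variable [s = A u], by differentiating both sides: [z] may vanish,
    so that [A] need not be invertible. *)
Lemma Rintegral_clock (k : R -> R) (v : R) : continuous k -> 0 <= v ->
  \int[mu]_(u in `[0, v]) (k (A u) * z u) = \int[mu]_(s in `[0, A v]) k s.
Proof.
move=> ck v0.
pose K y := \int[mu]_(s in `[-1, y]) k s.
have N1 : -1 < 0 :> R by rewrite ltrN10.
have dK (y : R) : 0 <= y -> is_derive y (1 : R) K (k y).
  by move=> y0; apply: is_derive_primitive => //; exact: lt_le_trans y0.
have cKA : continuous (K \o A).
  move=> u; apply: continuous_comp; first exact: cA.
  apply: differentiable_continuous; apply/derivable1_diffP.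
  by have [] := dK _ (clock_ge0 u).
transitivity ((K \o A) v - (K \o A) 0).
  apply: Rintegral_is_derive => //.
  - move=> u /andP[u0 _]; apply: is_derive1_comp; last exact: is_derive_clock.
    exact/dK/clock_ge0.
  - move=> u; apply: cvgM; last exact: cz.
    by apply: continuous_comp; [exact: cA|exact: ck].
rewrite /= (A_le0 (lexx 0)) /K (@Rintegral_itv_cat _ k (-1) 0 (A v)) ?clock_ge0 ?(ltW N1)//.
  by rewrite addrC addKr.
exact: integrable_segment.
Qed.

Section sublevel.
Variable t : R.
Hypothesis t0 : 0 <= t.

Definition sublevel := [set v | 0 <= v /\ A v <= t].

(** The last time [tau] at which the clock is at most [t] is finite once the clock
    exceeds [t] somewhere; monotonicity and continuity do the rest. *)
Lemma sublevelE (T : R) : t < A T -> exists tau,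
  [/\ 0 <= tau, tau <= T, A tau = t & sublevel = `[0, tau]%classic].
Proof.
move=> tT.
have T0 : 0 <= T.
  by rewrite leNgt; apply/negP => T0; move: tT; rewrite A_le0 ?(ltW T0)// ltNge t0.
have ub0 : exists u, u \in `[0, T] /\ A u = t.
  have cAT : {within `[0, T], continuous A} by exact: continuous_subspaceT.
  have mm : Num.min (A 0) (A T) <= t <= Num.max (A 0) (A T).
    by rewrite (A_le0 (lexx 0)) ge_min t0/= le_max (ltW tT) orbT.
  by have [u uT Au] := IVT T0 cAT mm; exists u.
have S0 : sublevel 0 by split; rewrite // A_le0.
have SubT u : sublevel u -> u <= T.
  move=> [u0 Aut]; rewrite leNgt; apply/negP => /ltW/clock_nd.
  by rewrite leNgt (le_lt_trans Aut tT).
have hs : has_sup sublevel by split; [exists 0|exists T => u; exact: SubT].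
pose tau := sup sublevel.
have ubt u : sublevel u -> u <= tau by move=> Su; exact: sup_upper_bound.
have tau0 : 0 <= tau by exact: ubt.
have tauT : tau <= T by apply: ge_sup; [exists 0|move=> u; exact: SubT].
have Atau : A tau <= t.
  rewrite leNgt; apply/negP => ttau.
  have e0 : 0 < A tau - t by rewrite subr_gt0.
  have /cvgrPdist_lt/(_ _ e0) := @cA tau.
  rewrite nearE => -[r /= r0 Hr].
  have [u Su tu] := sup_adherent r0 hs.
  have : `|A tau - A u| < A tau - t.
    apply: Hr => /=; rewrite ger0_norm ?subr_ge0 ?ubt//.
    by rewrite ltrBlDr -ltrBlDl.
  rewrite ger0_norm ?subr_ge0; last exact/clock_nd/ubt.
  by rewrite ltrD2l ltrN2 ltNge; case: Su => _ ->.
exists tau; split => //.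
  apply/eqP; rewrite eq_le Atau/=; case: ub0 => u [uT Au]; rewrite -{1}Au.
  apply/clock_nd/ubt; split; last by rewrite Au.
  by move: uT; rewrite in_itv/= => /andP[].
apply/seteqP; split => u /=; rewrite in_itv/=.
  by move=> Su; rewrite ubt// andbT; case: Su.
by move=> /andP[u0 utau]; split => //; exact: le_trans (clock_nd utau) Atau.
Qed.

(** The derivative of the stopped clock [min A t]; it may jump where the clock
    passes [t], so it is integrable rather than continuous. *)
Definition stopped_rate (u : R) := if A u <= t then z u else 0.

Lemma integrable_stopped_rate (k : R -> R) (a b : R) : continuous k ->
  mu.-integrable `[a, b] (EFin \o (fun u => k u * stopped_rate u)).
Proof.
move=> ck.
have kz : mu.-integrable `[a, b] (EFin \o (fun u => k u * z u)).
  by apply: integrable_segment => u; apply: cvgM; [exact: ck|exact: cz].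
apply: le_integrable kz => //.
- apply/measurable_EFinP/measurable_funTS; apply: measurable_funM.
    exact: continuous_measurable_fun.
  apply: measurable_fun_ifT => //.
    by apply: measurable_fun_ler => //; exact: continuous_measurable_fun.
  exact: continuous_measurable_fun.
- move=> u _ /=; rewrite lee_fin !normrM ler_wpM2l// /stopped_rate.
  by case: ifP => // _; rewrite normr0.
Qed.

Lemma stopped_rate_ge0 u : 0 <= stopped_rate u.
Proof. by rewrite /stopped_rate; case: ifP. Qed.

Lemma Rintegral_stopped_rate (k : R -> R) (v : R) : 0 <= v -> continuous k ->
  \int[mu]_(u in `[0, v]) (k u * stopped_rate u) =
  \int[mu]_(u in `[0, v]%classic `&` sublevel) (k u * z u).
Proof.
move=> v0 ck; rewrite Rintegral_mkcondr; apply: eq_Rintegral => u /set_mem.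
rewrite /= in_itv/= => /andP[u0 _]; rewrite patchE /stopped_rate.
case: ifPn => Aut.
  by rewrite mem_set//; split.
by rewrite memNset ?mulr0//= => -[_]; rewrite (negbTE Aut).
Qed.

Lemma stopped_clockE (v : R) : 0 <= v ->
  Num.min (A v) t = \int[mu]_(u in `[0, v]) stopped_rate u.
Proof.
move=> v0.
have -> : \int[mu]_(u in `[0, v]) stopped_rate u =
    \int[mu]_(u in `[0, v]%classic `&` sublevel) z u.
  have := @Rintegral_stopped_rate (cst 1) v v0 (@cst_continuous _ _ _).
  by under eq_Rintegral do rewrite mul1r; under [X in _ = X]eq_Rintegral do rewrite mul1r.
have [Avt|tAv] := leP (A v) t.
  rewrite AE//; congr (Rintegral _ _ _); apply/seteqP; split => u; last by case.
  rewrite /= in_itv/= => /andP[u0 uv]; split; first by rewrite /= u0.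
  split => //.
  exact: le_trans (clock_nd uv) Avt.
have [tau [tau0 tauv At ->]] := sublevelE tAv.
rewrite setIidr; last by apply: subset_itv; rewrite bnd_simp.
by rewrite -AE.
Qed.

End sublevel.
End clock.

(** * Integration by parts along a clock *)

Section primitive.
Context {R : realType}.
Local Notation mu := (@lebesgue_measure R).
Variable f : R -> R.
Hypothesis cf : continuous f.

Definition primitive (y : R) : R := \int[mu]_(s in `[0, y]) f s.

Let K (y : R) := \int[mu]_(s in `[-1, y]) f s.

Let primitiveE (y : R) : 0 <= y -> primitive y = K y - K 0.
Proof.
move=> y0; have N1 : -1 < 0 :> R by rewrite ltrN10.
rewrite /K (@Rintegral_itv_cat _ f (-1) 0 y) ?(ltW N1)//.
  by rewrite addrC addKr.
exact: integrable_segment.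
Qed.

Let dK (y : R) : 0 <= y -> is_derive y (1 : R) K (f y).
Proof.
by move=> y0; apply: is_derive_primitive => //; exact: lt_le_trans (ltrN10 _) y0.
Qed.

Lemma primitive0 : primitive 0 = 0.
Proof. by rewrite /primitive Rintegral_itv1. Qed.

Lemma continuous_primitive : continuous (fun y : R => primitive (Num.max y 0)).
Proof.
have -> : (fun y : R => primitive (Num.max y 0)) = (fun y => K (Num.max y 0) - K 0).
  by apply/funext => y; rewrite primitiveE// le_max lexx orbT.
move=> y; apply: (@cvgB _ R^o); last exact: cvg_cst.
apply: (@continuous_comp _ _ _ (fun y : R => Num.max y 0) K); first exact: continuous_max0.
apply: differentiable_continuous; apply/derivable1_diffP.
have y0 : 0 <= Num.max y 0 by rewrite le_max lexx orbT.
by have [] := dK y0.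
Qed.

Lemma is_derive_primitive_max0 (y : R) : 0 < y ->
  is_derive y (1 : R) (fun y : R => primitive (Num.max y 0)) (f y).
Proof.
move=> y0; have D := is_deriveD (dK (ltW y0)) (is_derive_cst (- K 0) y (1 : R)).
rewrite addr0 in D; apply: near_eq_is_derive D.
near=> u; have u0 : 0 < u by near: u; exact: lt_nbhsr.
by rewrite /= max_l ?(ltW u0)// primitiveE ?(ltW u0).
Unshelve. all: by end_near. Qed.

(** Integration by parts: [(t - s) * primitive s] vanishes at both ends. *)
Lemma Rintegral_primitive (t : R) : 0 <= t ->
  \int[mu]_(s in `[0, t]) primitive (Num.max s 0) =
  \int[mu]_(s in `[0, t]) ((t - s) * f s).
Proof.
move=> t0; pose p (s : R) := primitive (Num.max s 0).
have cp : continuous p by exact: continuous_primitive.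
have cts : continuous (fun s : R => t - s).
  by move=> s; apply: (@cvgB _ R^o); [exact: cvg_cst|exact: cvg_id].
have ctf : continuous (fun s => (t - s) * f s).
  by move=> s; apply: cvgM; [exact: cts|exact: cf].
have H : \int[mu]_(s in `[0, t]) ((t - s) * f s - p s) =
    (t - t) * p t - (t - 0) * p 0.
  apply: (@Rintegral_is_derive _ (fun s => (t - s) * p s)) => //.
  - by move=> s; apply: cvgM; [exact: cts|exact: cp].
  - move=> s /andP[s0 _].
    have D1 : is_derive s (1 : R) (fun s : R => t - s) (- 1).
      have := is_deriveB (is_derive_cst t s (1 : R)) (is_derive_id s (1 : R)).
      by rewrite sub0r.
    have := is_deriveM D1 (is_derive_primitive_max0 s0).
    by move/is_derive_eq; apply; rewrite /GRing.scale/= mulrN1.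
  - by move=> s; apply: (@cvgB _ R^o); [exact: ctf|exact: cp].
rewrite RintegralB// in H; [|exact: integrable_segment|exact: integrable_segment].
move: H; rewrite subrr mul0r sub0r /p (max_l (lexx 0)) primitive0 mulr0 oppr0.
by move/eqP; rewrite subr_eq0 => /eqP.
Qed.

End primitive.

Section clock_formulas.
Context {R : realType}.
Local Notation mu := (@lebesgue_measure R).
Variables (z A : R -> R).
Hypotheses (cz : continuous z) (z0 : forall v, 0 <= z v).
Hypotheses (cA : continuous A) (A_le0 : forall v, v <= 0 -> A v = 0).
Hypothesis AE : forall v, 0 <= v -> A v = \int[mu]_(u in `[0, v]) z u.

(** Along the clock [z v dv] is [dA], so the parts of [z - c v] that depend on
    the clock only integrate to [\int_0^t (x + primitive s) ds]. *)
Lemma sublevel_integralE (x c t T : R) (m f : R -> R) :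
  continuous m -> continuous f -> 0 <= t -> t < A T ->
  (forall v, 0 <= v -> z v - c * v = x + m v + primitive f (A v)) ->
  \int[mu]_(v in sublevel A t) ((z v - c * v) * z v) =
  x * t + \int[mu]_(s in `[0, t]) ((t - s) * f s) +
  \int[mu]_(v in sublevel A t) (m v * z v).
Proof.
move=> cm cf t0 tT zE.
have [tau [tau0 _ At ->]] := sublevelE cz z0 cA A_le0 AE t0 tT.
have cp := continuous_primitive cf.
pose k (y : R) := x + primitive f (Num.max y 0).
have ck : continuous k by move=> y; apply: cvgD; [exact: cvg_cst|exact: cp].
have ckAz : continuous (fun v => k (A v) * z v).
  move=> v; apply: cvgM; last exact: cz.
  by apply: continuous_comp; [exact: cA|exact: ck].
have cmz : continuous (fun v => m v * z v).
  by move=> v; apply: cvgM; [exact: cm|exact: cz].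
transitivity (\int[mu]_(v in `[0, tau]) (k (A v) * z v + m v * z v)).
  apply: eq_Rintegral => v /set_mem; rewrite /= in_itv/= => /andP[v0 _].
  rewrite zE// /k max_l ?(clock_ge0 cz z0 A_le0 AE)//; ring.
rewrite RintegralD//; [|exact: integrable_segment|exact: integrable_segment].
rewrite (Rintegral_clock cz z0 cA A_le0 AE ck tau0) At; congr (_ + _).
rewrite RintegralD//; [|apply: integrable_segment; exact: cst_continuous|
  exact: integrable_segment].
rewrite Rintegral_primitive// Rintegral_cst//= lebesgue_measure_itv/= lte_fin.
case: ltP => [_|t_le0]; first by rewrite sube0.
by rewrite (le_anti (_ : t <= 0 <= t)) ?t0 ?t_le0// !mulr0.
Qed.

Lemma abel_summation (a m : nat -> R) N :
  \sum_(i < N) a i * (m i.+1 - m i) =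
  a N * m N - a 0%N * m 0%N + \sum_(i < N) (a i - a i.+1) * m i.+1.
Proof.
elim: N => [|N IH]; first by rewrite !big_ord0 subrr addr0.
by rewrite !big_ord_recr/= IH; ring.
Qed.

Lemma near_mesh (T dl : R) : 0 < dl ->
  \forall n \near \oo, T / n.+1%:R < dl.
Proof.
move=> dl0; near=> n; rewrite ltr_pdivrMr ?ltr0Sn// mulrC -ltr_pdivrMr//.
apply: lt_le_trans (_ : n%:R <= _); last by rewrite ler_nat.
by near: n; exact: nbhs_infty_gtr.
Unshelve. all: by end_near. Qed.

(** Integration by parts for the integral of [t - min A t] against [m].  The path
    [m] may have unbounded variation, so the sums are summed by parts to move the
    increments onto the clock, where uniform continuity of [m] controls the
    error by the total increase of [min A t], at most [t]. *)
Lemma riemann_stieltjes_clock (m : R -> R) (t T : R) :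
  continuous m -> m 0 = 0 -> 0 <= t -> 0 <= T ->
  \sum_(i < n.+1) (t - Num.min (A (T * i%:R / n.+1%:R)) t) *
     (m (T * i.+1%:R / n.+1%:R) - m (T * i%:R / n.+1%:R)) @[n --> \oo] -->
  (t - Num.min (A T) t) * m T +
  \int[mu]_(u in `[0, T]) (m u * stopped_rate z A t u).
Proof.
move=> cm m0 t0 T0.
pose j := stopped_rate z A t.
have sE v : 0 <= v -> Num.min (A v) t = \int[mu]_(u in `[0, v]) j u.
  exact: (stopped_clockE cz z0 cA A_le0 AE t0).
have ij (k : R -> R) (a b : R) : continuous k -> mu.-integrable `[a, b] (EFin \o (fun u => k u * j u)).
  exact: (integrable_stopped_rate cz cA).
have ij1 (a b : R) : mu.-integrable `[a, b] (EFin \o j).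
  have := ij (cst 1) a b (@cst_continuous _ _ _).
  by apply: eq_integrable => // u _ /=; rewrite mul1r.
apply/cvgrPdist_le => e e0.
pose e1 := e / (t + 1).
have t1 : 0 < t + 1 by rewrite ltr_wpDl.
have e10 : 0 < e1 by rewrite divr_gt0.
have [dl dl0 Hdl] := uniform_continuity_segment T cm e10.
near=> n.
pose tk i : R := T * i%:R / n.+1%:R.
have n0 : 0 < n.+1%:R :> R by rewrite ltr0Sn.
have tk0 i : 0 <= tk i by rewrite divr_ge0// mulr_ge0.
have tkS i : tk i <= tk i.+1 by rewrite ler_pM2r ?invr_gt0// ler_wpM2l// ler_nat.
have tkT i : (i <= n.+1)%N -> tk i <= T.
  by move=> iN; rewrite ler_pdivrMr// ler_wpM2l// ler_nat.
have mesh i : tk i.+1 - tk i < dl.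
  rewrite /tk -mulrBl -mulrBr -natrB// subSnn mulr1.
  by near: n; exact: near_mesh.
(* the boundary terms of the summation by parts match the one in the limit *)
rewrite (abel_summation (fun i => t - Num.min (A (tk i)) t) (fun i => m (tk i))).
have -> : tk n.+1 = T by rewrite /tk -mulrA divff ?mulr1// pnatr_eq0.
have -> : m (tk 0%N) = 0 by rewrite /tk mulr0 mul0r.
rewrite mulr0 subr0 opprD addrACA subrr add0r.
rewrite (Rintegral_grid (f := fun u => m u * j u) n T0); last exact: ij.
rewrite -sumrB.
have jE i : (t - Num.min (A (tk i)) t) - (t - Num.min (A (tk i.+1)) t) =
    \int[mu]_(u in `[tk i, tk i.+1]) j u.
  rewrite !sE// (@Rintegral_itv_cat _ j 0 (tk i) (tk i.+1))//; ring.
have term (i : 'I_n.+1) :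
  `|\int[mu]_(u in `[tk i, tk i.+1]) (m u * j u) -
    ((t - Num.min (A (tk i)) t) - (t - Num.min (A (tk i.+1)) t)) * m (tk i.+1)| <=
  \int[mu]_(u in `[tk i, tk i.+1]) (e1 * j u).
  rewrite jE mulrC -RintegralZl// -RintegralB//; last 2 first.
  - exact: ij.
  - by apply: ij; exact: cst_continuous.
  apply: le_normr_Rintegral_bounded.
  - have cmm : continuous (fun u => m u - m (tk i.+1)).
      by move=> u; apply: (@cvgB _ R^o); [exact: cm|exact: cvg_cst].
    by have := ij _ (tk i) (tk i.+1) cmm; apply: eq_integrable => // u _ /=; rewrite mulrBl.
  - by apply: ij; exact: cst_continuous.
  move=> u /andP[iu ui]; rewrite -mulrBl normrM.
  rewrite (@ger0_norm _ (j u)); last exact: stopped_rate_ge0.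
  apply: ler_wpM2r; [exact: stopped_rate_ge0|apply: ltW; apply: Hdl].
    by rewrite (le_trans _ iu)//= (le_trans ui)// tkT.
  rewrite distrC ger0_norm ?subr_ge0//; apply: le_lt_trans (mesh i).
  by rewrite lerD2l lerN2.
apply: (@le_trans _ _ (\sum_(i < n.+1) \int[mu]_(u in `[tk i, tk i.+1]) (e1 * j u))).
  by apply: le_trans (ler_norm_sum _ _ _) _; apply: ler_sum => i _; exact: term.
rewrite -(Rintegral_grid (f := fun u => e1 * j u) n T0); last by apply: ij; exact: cst_continuous.
rewrite RintegralZl// -sE// /e1 mulrAC ler_pdivrMr//.
rewrite ler_pM2l// ge_min; apply/orP; right.
by rewrite lerDl.
Unshelve. all: by end_near. Qed.

End clock_formulas.

(** * Riemann sums of the quadratic variation *)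

Section grid_energy.
Context {R : realType}.
Local Notation mu := (@lebesgue_measure R).

Lemma integrable_bounded_segment (k : R -> R) (a b K : R) :
  measurable_fun [set: R] k -> (forall u, a <= u <= b -> `|k u| <= K) ->
  mu.-integrable `[a, b] (EFin \o k).
Proof.
move=> mk kK; have iK : mu.-integrable `[a, b] (EFin \o cst K).
  by apply: integrable_segment; exact: cst_continuous.
apply: le_integrable iK => //; first exact/measurable_EFinP/measurable_funTS.
move=> u /=; rewrite in_itv/= => /kK kuK; rewrite lee_fin.
by rewrite (le_trans kuK)// ler_norm.
Qed.

Lemma continuous_bounded_segment (k : R -> R) (a b : R) : continuous k ->
  exists K : R, 0 <= K /\ forall u, a <= u <= b -> `|k u| <= K.
Proof.
move=> ck; have [ab|ba] := leP a b; last first.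
  exists 0; split => // u /andP[au ub].
  by have := le_trans au ub; rewrite leNgt ba.
have cak : {within `[a, b], continuous (fun u => `|k u|)}.
  by apply: continuous_subspaceT => u; apply: cvg_norm; exact: ck.
have [u _ umax] := EVT_max ab cak.
exists `|k u|; split => // v vab; apply: umax; by rewrite in_itv.
Qed.

(** Young's inequality, with the weight left free: it lets the quadratic variation
    of an approximation be compared with its limit at a chosen rate. *)
Lemma sqr_diff_le (x y e : R) : 0 < e ->
  `|x ^+ 2 - y ^+ 2| <= (1 + e^-1) * (x - y) ^+ 2 + e * y ^+ 2.
Proof.
move=> e0; have h1 : 0 <= e^-1 * (x - y - e * y) ^+ 2.
  by rewrite mulr_ge0 ?sqr_ge0// invr_ge0 ltW.
have h2 : 0 <= e^-1 * (x - y + e * y) ^+ 2.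
  by rewrite mulr_ge0 ?sqr_ge0// invr_ge0 ltW.
have E1 : e^-1 * (x - y - e * y) ^+ 2 =
    e^-1 * (x - y) ^+ 2 - 2 * (x - y) * y + e * y ^+ 2.
  by field; rewrite gt_eqF.
have E2 : e^-1 * (x - y + e * y) ^+ 2 =
    e^-1 * (x - y) ^+ 2 + 2 * (x - y) * y + e * y ^+ 2.
  by field; rewrite gt_eqF.
rewrite E1 in h1; rewrite E2 in h2; have h3 := sqr_ge0 (x - y).
rewrite ler_norml; apply/andP; split; nra.
Qed.

(** The weight is frozen at the left end of each grid interval while the
    approximation [S n] of [H] runs through it.  The rate [n^-2] of the mean square
    error beats the factor [n] that comes with splitting [S^2 - H^2] so that
    the remainder is [H^2 / n]. *)
Lemma grid_energy_cvg (p H : R -> R) (S : nat -> R -> R) (T B : R) :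
  continuous p -> continuous H -> 0 <= T -> (forall u, p u ^+ 2 <= B) ->
  (forall n, measurable_fun [set: R] (S n)) ->
  (forall n, exists K, forall u, `|S n u| <= K) ->
  (\forall n \near \oo,
     \int[mu]_(u in `[0, T]) ((S n u - H u) ^+ 2) <= (n.+1%:R ^+ 2)^-1) ->
  \sum_(i < n.+1) p (T * i%:R / n.+1%:R) ^+ 2 *
    \int[mu]_(u in `[T * i%:R / n.+1%:R, T * i.+1%:R / n.+1%:R]) (S n u ^+ 2)
    @[n --> \oo] --> \int[mu]_(u in `[0, T]) (p u ^+ 2 * H u ^+ 2).
Proof.
move=> cp cH T0 pB mS Sbnd Srate.
have B0 : 0 <= B by apply: le_trans (pB 0); exact: sqr_ge0.
pose hh := \int[mu]_(u in `[0, T]) (H u ^+ 2).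
have hh0 : 0 <= hh by apply: Rintegral_ge0 => u _; exact: sqr_ge0.
have cp2 : continuous (fun u => p u ^+ 2).
  by move=> u; apply: (@continuous_comp _ _ _ p (fun x => x ^+ 2)); [exact: cp|exact: exprn_continuous].
have cH2 : continuous (fun u => H u ^+ 2).
  by move=> u; apply: (@continuous_comp _ _ _ H (fun x => x ^+ 2)); [exact: cH|exact: exprn_continuous].
have iS n a b : mu.-integrable `[a, b] (EFin \o (fun u => S n u ^+ 2)).
  have [K SK] := Sbnd n.
  apply: (@integrable_bounded_segment _ _ _ (K ^+ 2)); first exact: measurable_funX.
  by move=> u _; rewrite normrX lerXn2r// nnegrE// (le_trans _ (SK u)).
have iD n a b : mu.-integrable `[a, b] (EFin \o (fun u => (S n u - H u) ^+ 2)).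
  have [K SK] := Sbnd n; have [K' [K'0 HK']] := @continuous_bounded_segment H a b cH.
  apply: (@integrable_bounded_segment _ _ _ ((K + K') ^+ 2)).
    by apply: measurable_funX; apply: measurable_funB => //; exact: continuous_measurable_fun.
  move=> u uab; rewrite normrX lerXn2r// ?nnegrE//.
    by rewrite addr_ge0// (le_trans _ (SK 0)).
  by rewrite (le_trans (ler_normB _ _))// lerD// HK'.
apply/cvgrPdist_le => e e0.
pose e1 := e / 2 / (hh + 1).
have hh1 : 0 < hh + 1 by rewrite ltr_wpDl.
have e10 : 0 < e1 by rewrite !divr_gt0.
have [dl dl0 Hdl] := uniform_continuity_segment T cp2 e10.
near=> n.
pose tk i : R := T * i%:R / n.+1%:R.
have n0 : 0 < n.+1%:R :> R by rewrite ltr0Sn.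
have tk0 i : 0 <= tk i by rewrite divr_ge0// mulr_ge0.
have tkT i : (i <= n.+1)%N -> tk i <= T.
  by move=> iN; rewrite ler_pdivrMr// ler_wpM2l// ler_nat.
have mesh i : tk i.+1 - tk i < dl.
  rewrite /tk -mulrBl -mulrBr -natrB// subSnn mulr1.
  by near: n; exact: near_mesh.
have rate : \int[mu]_(u in `[0, T]) ((S n u - H u) ^+ 2) <= (n.+1%:R ^+ 2)^-1.
  by near: n.
(* first the replacement of H by S n, with n+1 in Young's inequality, then the
   freezing of the weight on a mesh interval *)
pose bnd u := B * ((1 + n.+1%:R) * (S n u - H u) ^+ 2 + n.+1%:R^-1 * H u ^+ 2) +
  e1 * H u ^+ 2.
have iH a b : mu.-integrable `[a, b] (EFin \o (fun u => H u ^+ 2)).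
  exact: integrable_segment.
have mI (a b : R) : @measurable _ (measurableTypeR R) `[a, b]%classic.
  exact: (@measurable_itv R `[a, b]).
have iZ (c : R) (k : R -> R) a b : mu.-integrable `[a, b] (EFin \o k) ->
    mu.-integrable `[a, b] (EFin \o (fun u => c * k u)).
  by move=> ki; have := integrableZl (mI _ _) c ki; apply: eq_integrable.
have iA (k1 k2 : R -> R) a b : mu.-integrable `[a, b] (EFin \o k1) ->
    mu.-integrable `[a, b] (EFin \o k2) ->
    mu.-integrable `[a, b] (EFin \o (fun u => k1 u + k2 u)).
  by move=> i1 i2; have := integrableD (mI _ _) i1 i2; apply: eq_integrable.
have ib1 a b : mu.-integrable `[a, b] (EFin \o
  (fun u => (1 + n.+1%:R) * (S n u - H u) ^+ 2 + n.+1%:R^-1 * H u ^+ 2)).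
  by apply: iA; apply: iZ; [exact: iD|exact: iH].
have ib a b : mu.-integrable `[a, b] (EFin \o bnd).
  by apply: iA; apply: iZ; [exact: ib1|exact: iH].
have ipH a b : mu.-integrable `[a, b] (EFin \o (fun u => p u ^+ 2 * H u ^+ 2)).
  by apply: integrable_segment => u; apply: cvgM; [exact: cp2|exact: cH2].
rewrite (Rintegral_grid (f := fun u => p u ^+ 2 * H u ^+ 2) n T0)// -sumrB.
apply: (@le_trans _ _ (\sum_(i < n.+1) \int[mu]_(u in `[tk i, tk i.+1]) bnd u)).
  apply: le_trans (ler_norm_sum _ _ _) _; apply: ler_sum => i _.
  rewrite -RintegralZl// -RintegralB//; last exact: iZ.
  apply: le_normr_Rintegral_bounded => //.
    have := integrableB (mI (tk i) (tk i.+1)) (ipH (tk i) (tk i.+1))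
      (iZ (p (tk i) ^+ 2) _ _ _ (iS n (tk i) (tk i.+1))).
    by apply: eq_integrable.
  move=> u /andP[iu ui].
  have -> : p u ^+ 2 * H u ^+ 2 - p (tk i) ^+ 2 * S n u ^+ 2 =
     (p u ^+ 2 - p (tk i) ^+ 2) * H u ^+ 2 - p (tk i) ^+ 2 * (S n u ^+ 2 - H u ^+ 2).
    by ring.
  rewrite (le_trans (ler_normB _ _))// addrC /bnd lerD//.
    rewrite normrM ger0_norm ?sqr_ge0// ler_pM ?sqr_ge0//.
    have nv0 : 0 < n.+1%:R^-1 :> R by rewrite invr_gt0.
    by have := sqr_diff_le (S n u) (H u) nv0; rewrite invrK.
  rewrite normrM (@ger0_norm _ (H u ^+ 2)) ?sqr_ge0// ler_wpM2r ?sqr_ge0//.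
  apply: ltW; apply: Hdl; first by rewrite (le_trans (tk0 i) iu)/= (le_trans ui)// tkT.
  rewrite ger0_norm ?subr_ge0//; apply: le_lt_trans (mesh i).
  by rewrite lerD2r.
rewrite -(Rintegral_grid (f := bnd) n T0)//.
rewrite RintegralD//; [|exact: iZ|exact: iZ].
rewrite RintegralZl// RintegralD//; [|exact: iZ|exact: iZ].
rewrite !RintegralZl// -/hh [leRHS]splitr lerD//.
  apply: (@le_trans _ _ (B * ((1 + n.+1%:R) * (n.+1%:R ^+ 2)^-1 + n.+1%:R^-1 * hh))).
    by rewrite ler_wpM2l// lerD2r ler_wpM2l// addr_ge0.
  apply: (@le_trans _ _ (B * (2 + hh) / n.+1%:R)).
    rewrite -mulrA ler_wpM2l//.
    have v1 : 1 <= n.+1%:R :> R by rewrite ler1n.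
    move: (n.+1%:R) n0 v1 => v v0 v1.
    have -> : (1 + v) * (v ^+ 2)^-1 + v^-1 * hh = ((1 + v) / v + hh) / v.
      by field; rewrite gt_eqF.
    rewrite ler_wpM2r ?invr_ge0 ?(ltW v0)// lerD2r ler_pdivrMr//; lra.
  apply: ltW; near: n; apply: near_mesh; by rewrite divr_gt0.
by rewrite /e1 mulrAC ler_pdivrMr// ler_pM2l ?divr_gt0// lerDl.
Unshelve. all: by end_near. Qed.

End grid_energy.

(** * Refining a simple process along a grid *)

Section clamp.
Context {R : realType}.
Local Notation mu := (@lebesgue_measure R).
Implicit Types a b x y : R.

Definition clamp a b x : R := Num.max a (Num.min x b).

Lemma clamp_ge a b x : a <= clamp a b x.
Proof. by rewrite /clamp le_max lexx. Qed.

Lemma clamp_le a b x : a <= b -> clamp a b x <= b.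
Proof. by move=> ab; rewrite /clamp ge_max ab ge_min lexx orbT. Qed.

Lemma clamp_homo a b x y : x <= y -> clamp a b x <= clamp a b y.
Proof.
move=> xy; rewrite /clamp ge_max le_max lexx/= le_max.
by apply/orP; right; rewrite le_min !ge_min xy lexx orbT.
Qed.

(** When the projections differ, the smaller one comes from a point not beyond
    [b]; so the projection lies at or after the point itself. *)
Lemma clamp_lt a b x y : clamp a b x < clamp a b y ->
  x <= clamp a b x.
Proof.
rewrite /clamp => h; have [xb|bx] := leP x b; first by rewrite le_max lexx orbT.
move: h; rewrite (min_r (ltW bx)) ltNge => /negP[].
by rewrite ge_max !le_max !ge_min !lexx !orbT.
Qed.

Lemma clamp_stopped (w : R -> R) a b x : a <= b ->
  w (clamp a b x) = w (Num.min x b) - w (Num.min x a) + w a.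
Proof.
move=> ab; rewrite /clamp; have [xa|ax] := leP x a.
  rewrite (min_l (le_trans xa ab)) (max_l xa); ring.
rewrite max_r; first by ring.
by rewrite le_min (ltW ax).
Qed.

(** The length of the intersection of the two intervals, in a form that
    telescopes and that is zero without case distinction when they are disjoint. *)
Lemma Rintegral_indic_itv a b c d : a <= b -> c <= d ->
  \int[mu]_(u in `[a, b]) (\1_(`]c, d]%classic) u : R) = clamp a b d - clamp a b c.
Proof.
move=> ab cd; rewrite -Rintegral_itv_obnd_cbnd; last first.
  apply: (@integrableS _ _ _ mu `[a, b]%classic) => //.
    by apply: subset_itv; rewrite bnd_simp.
  apply: (@integrable_bounded_segment _ _ _ _ 1); first exact: measurable_indic.
  by move=> u _; rewrite indicE; case: (_ \in _); rewrite ?normr1// normr0.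
rewrite /Rintegral integral_indic//= setIC.
have -> : `]a, b]%classic `&` `]c, d]%classic =
    `]Num.max a c, Num.min b d]%classic.
  apply/seteqP; split => u /=; rewrite !in_itv/= gt_max le_min.
    by move=> [/andP[-> ->] /andP[-> ->]].
  by move=> /andP[/andP[-> ->] /andP[-> ->]].
rewrite lebesgue_measure_itv/= lte_fin /clamp.
have -> : (if Num.max a c < Num.min b d
    then ((Num.min b d)%:E - (Num.max a c)%:E)%E else 0%E) =
    (if Num.max a c < Num.min b d then Num.min b d - Num.max a c else 0)%:E.
  by case: ifP.
rewrite [fine _]/=.
have [ac|ca] := leP a c; have [bd|db] := leP b d;
  (have [cb|bc] := leP c b); (have [ad|da] := leP a d);
  rewrite ?(max_r ac) ?(max_l ab) ?(max_r ad) ?(max_l (ltW da)) /=;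
  try (have -> : Num.max a c = c by apply: max_r);
  try (have -> : Num.max a c = a by apply/max_l/ltW);
  try (have -> : Num.max a b = b by apply: max_r);
  case: ifPn; rewrite -?leNgt; lra.
Qed.

End clamp.

Section simple_process_facts.
Context {d} {T : measurableType d} {R : realType}.
Local Notation mu := (@lebesgue_measure R).
Variables (F : R -> set (set T)) (S : simple_process R T).
Hypothesis pS : simple_predictable F S.

Lemma sp_time_nd (i j : nat) : (i <= j)%N -> (j <= sp_size S)%N ->
  sp_time S i <= sp_time S j.
Proof.
case: pS => _ nd _ _; elim: j => [|j IH]; first by rewrite leqn0 => /eqP ->.
rewrite leq_eqVlt => /orP[/eqP -> //|ij jS].
by apply: le_trans (nd _ jS); apply: IH => //; exact: ltnW.
Qed.

Lemma sp_time_ge0 (i : nat) : (i <= sp_size S)%N -> 0 <= sp_time S i.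
Proof.
by move=> iS; case: pS => s0 _ _ _; apply: le_trans s0 _; exact: sp_time_nd.
Qed.

Let ind (i : nat) (u : R) : R := \1_(`]sp_time S i, sp_time S i.+1]%classic) u.

Lemma simple_value_sqr (u : R) (w : T) :
  simple_value S u w ^+ 2 = \sum_(i < sp_size S) sp_coef S i w ^+ 2 * ind i u.
Proof.
rewrite /simple_value.
suff H n : (n <= sp_size S)%N ->
    (\sum_(i < n) sp_coef S i w * ind i u) ^+ 2 =
    \sum_(i < n) sp_coef S i w ^+ 2 * ind i u by exact: H.
elim: n => [|n IH] nS; first by rewrite !big_ord0 expr0n.
rewrite !big_ord_recr/= -IH ?(ltnW nS)//.
have cross : (\sum_(i < n) sp_coef S i w * ind i u) * ind n u = 0.
  rewrite /ind [\1_(`]sp_time S n, _]%classic) u]indicE.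
  have [|] := boolP (u \in `]sp_time S n, sp_time S n.+1]%classic); last by rewrite mulr0.
  move=> /set_mem; rewrite /= in_itv/= => /andP[nu _]; rewrite big1 ?mul0r// => i _.
  rewrite indicE memNset ?mulr0//= in_itv/= => /andP[_].
  rewrite leNgt => /negP; apply; apply: le_lt_trans nu.
  by apply: sp_time_nd; [exact: ltn_ord|exact: ltnW].
have ind2 : ind n u ^+ 2 = ind n u.
  by rewrite /ind indicE; case: (_ \in _); rewrite ?expr1n ?expr0n.
rewrite sqrrD exprMn ind2; congr (_ + _).
rewrite (_ : _ * (sp_coef S n w * ind n u) = sp_coef S n w *
   ((\sum_(i < n) sp_coef S i w * ind i u) * ind n u)); last by rewrite mulrCA.
by rewrite cross mulr0 mul0rn addr0.
Qed.

Lemma measurable_simple_value (w : T) :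
  measurable_fun [set: R] (fun u => simple_value S u w).
Proof.
apply: measurable_sum => i; apply: measurable_funM => //.
Qed.

Lemma simple_value_bounded (w : T) : exists K, forall u, `|simple_value S u w| <= K.
Proof.
exists (\sum_(i < sp_size S) `|sp_coef S i w|) => u.
apply: le_trans (ler_norm_sum _ _ _) _; apply: ler_sum => i _.
rewrite normrM ler_piMr//.
by rewrite indicE; case: (_ \in _); rewrite ?normr1 ?normr0.
Qed.

Lemma Rintegral_simple_value_sqr (a b : R) (w : T) : a <= b ->
  \int[mu]_(u in `[a, b]) (simple_value S u w ^+ 2) =
  \sum_(i < sp_size S) sp_coef S i w ^+ 2 *
    (clamp a b (sp_time S i.+1) - clamp a b (sp_time S i)).
Proof.
move=> ab; under eq_Rintegral do rewrite simple_value_sqr.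
have ii i : mu.-integrable `[a, b] (EFin \o (fun u => sp_coef S i w ^+ 2 * ind i u)).
  apply: (@integrable_bounded_segment _ _ _ _ (sp_coef S i w ^+ 2)).
    by apply: measurable_funM => //; exact: measurable_indic.
  move=> u _; rewrite normrM (@ger0_norm _ (sp_coef S i w ^+ 2)) ?sqr_ge0//.
  rewrite ler_piMr ?sqr_ge0//.
  by rewrite /ind indicE; case: (_ \in _); rewrite ?normr1 ?normr0.
have H n : (n <= sp_size S)%N ->
    mu.-integrable `[a, b] (EFin \o (fun u => \sum_(i < n) sp_coef S i w ^+ 2 * ind i u)) /\
    \int[mu]_(u in `[a, b]) (\sum_(i < n) sp_coef S i w ^+ 2 * ind i u) =
    \sum_(i < n) sp_coef S i w ^+ 2 *
      (clamp a b (sp_time S i.+1) - clamp a b (sp_time S i)).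
  elim: n => [_|n IH nS].
    split; last by rewrite big_ord0; under eq_Rintegral do rewrite big_ord0; rewrite Rintegral_cst//= mul0r.
    have := integrable_segment a b (@cst_continuous R R 0).
    by apply: eq_integrable => // u _ /=; rewrite big_ord0.
  have [iI eI] := IH (ltnW nS).
  have e u : \sum_(i < n.+1) sp_coef S i w ^+ 2 * ind i u =
    \sum_(i < n) sp_coef S i w ^+ 2 * ind i u + sp_coef S n w ^+ 2 * ind n u.
    by rewrite big_ord_recr.
  have mI : @measurable _ (measurableTypeR R) `[a, b]%classic.
    exact: (@measurable_itv R `[a, b]).
  split.
    have := integrableD mI iI (ii n); apply: eq_integrable => // u _ /=.
    by rewrite e EFinD.
  under eq_Rintegral do rewrite e.
  rewrite RintegralD// eI big_ord_recr/=; congr (_ + _).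
  rewrite RintegralZl//; last first.
    apply: (@integrable_bounded_segment _ _ _ _ 1); first exact: measurable_indic.
    by move=> u _; rewrite /ind indicE; case: (_ \in _); rewrite ?normr1 ?normr0.
  rewrite Rintegral_indic_itv//; case: pS => _ nd _ _; exact: nd.
by have [] := H _ (leqnn _).
Qed.

End simple_process_facts.

Section grid_cells.
Context {d} {T : measurableType d} {R : realType}.
Local Notation mu := (@lebesgue_measure R).
Variables (F : R -> set (set T)) (W : R -> T -> R) (S : simple_process R T).
Hypothesis filF : is_filtration F.
Hypothesis pS : simple_predictable F S.
Variables (tk : nat -> R) (wt : nat -> T -> R).
Hypotheses (tk0 : forall k, 0 <= tk k) (tk_nd : forall k, tk k <= tk k.+1).
Hypothesis mwt : forall k, measurable_wrt (F (tk k)) (wt k).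

(** The part of the [i]-th cell of [S] that falls into the [k]-th grid interval.
    A degenerate part may have been clamped to the left of the time at which the
    coefficient becomes known, so its coefficient is set to zero. *)
Definition grid_cell (k i : nat) : cell :=
  let a := clamp (tk k) (tk k.+1) (sp_time S i) in
  let b := clamp (tk k) (tk k.+1) (sp_time S i.+1) in
  Cell a b (if a < b then fun w => wt k w * sp_coef S i w else cst 0).

Definition grid_cells (n : nat) : seq (@cell d T R) :=
  flatten [seq [seq grid_cell k i | i <- iota 0 (sp_size S)] | k <- iota 0 n].

Lemma cell_chain_le (t t' : R) s : t <= t' -> cell_chain F t' s -> cell_chain F t s.
Proof. by move=> tt; case: s => //= c s [t'c ? ? ?]; split => //; exact: le_trans t'c. Qed.

Lemma measurable_grid_cell k i : (i < sp_size S)%N ->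
  measurable_wrt (F (cell_left (grid_cell k i))) (cell_coef (grid_cell k i)).
Proof.
move=> iS; have [sF _ mF] := filF; have [_ _ cS _] := pS.
set a := cell_left _; have a0 : 0 <= a by exact: le_trans (tk0 k) (clamp_ge _ _ _).
rewrite /grid_cell /=; case: ifPn => [ab|_]; last first.
  move=> B mB; rewrite preimage_cst; case: ifP => _; last by have [] := sF _ a0.
  by rewrite -(setD0 setT); have [S0 SC _] := sF _ a0; apply: SC.
have m1 : measurable_from (F a) (fun w => (wt k w, sp_coef S i w)).
  apply: measurable_from_pair; first exact: sF.
  - by move=> B mB; apply: (mF (tk k)) => //; [exact: clamp_ge|exact: mwt].
  - move=> B mB; apply: (mF (sp_time S i)); last exact: cS.
      by apply: (sp_time_ge0 pS); exact: ltnW.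
    exact: clamp_lt ab.
have mk : measurable_fun [set: R * R] (fun z : R * R => z.1 * z.2) by exact: measurable_funM.
exact: (measurable_from_comp m1 mk).
Qed.

Lemma cell_chain_grid_row k s : cell_chain F (tk k.+1) s ->
  cell_chain F (tk k) ([seq grid_cell k i | i <- iota 0 (sp_size S)] ++ s).
Proof.
move=> chs; suff H m j : (j + m = sp_size S)%N ->
    cell_chain F (clamp (tk k) (tk k.+1) (sp_time S j))
     ([seq grid_cell k i | i <- iota j m] ++ s).
  by apply: cell_chain_le (H _ 0%N _) => //; exact: clamp_ge.
elim: m j => [|m IH] j jm /=.
  by apply: cell_chain_le chs; exact: clamp_le.
have jS : (j < sp_size S)%N by rewrite -jm addnS ltnS leq_addr.
split => //.
- by apply: clamp_homo; apply: (sp_time_nd pS).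
- exact: measurable_grid_cell.
- by apply: IH; rewrite addSn -addnS.
Qed.

Lemma cell_chain_grid n : cell_chain F (tk 0%N) (grid_cells n).
Proof.
rewrite /grid_cells; suff H j : cell_chain F (tk j)
    (flatten [seq [seq grid_cell k i | i <- iota 0 (sp_size S)] | k <- iota j n]).
  exact: H.
by elim: n j => [//|n IH] j /=; apply: cell_chain_grid_row; exact: IH.
Qed.

Lemma sum_grid_cells (h : @cell d T R -> R) n :
  \sum_(c <- grid_cells n) h c =
  \sum_(k < n) \sum_(i < sp_size S) h (grid_cell k i).
Proof.
rewrite /grid_cells big_flatten/= big_map -/(index_iota 0 n).
have -> : iota 0 n = index_iota 0 n by rewrite /index_iota subn0.
rewrite big_mkord; apply: eq_bigr => k _.
rewrite big_map; have -> : iota 0 (sp_size S) = index_iota 0 (sp_size S).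
  by rewrite /index_iota subn0.
by rewrite big_mkord.
Qed.

Lemma sum_grid_gain n w :
  \sum_(c <- grid_cells n) cell_gain W c w =
  \sum_(k < n) wt k w *
    (simple_integral S W (tk k.+1) w - simple_integral S W (tk k) w).
Proof.
rewrite sum_grid_cells; apply: eq_bigr => k _.
rewrite /simple_integral -sumrB mulr_sumr; apply: eq_bigr => i _.
rewrite /cell_gain /=.
set a := clamp _ _ (sp_time S i); set b := clamp _ _ (sp_time S i.+1).
have ab : a <= b by apply: clamp_homo; case: pS => _ nd _ _; exact: nd.
transitivity (wt k w * sp_coef S i w * (W b w - W a w)).
  case: ifPn => //; rewrite -leNgt => ba.
  by rewrite (@le_anti _ _ b a) ?ba ?ab// subrr !mulr0.
rewrite /a /b !(clamp_stopped (fun t => W t w))//; ring.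
Qed.

Lemma sum_grid_energy n w :
  \sum_(c <- grid_cells n) cell_energy c w =
  \sum_(k < n) wt k w ^+ 2 *
    \int[mu]_(u in `[tk k, tk k.+1]) (simple_value S u w ^+ 2).
Proof.
rewrite sum_grid_cells; apply: eq_bigr => k _.
rewrite (Rintegral_simple_value_sqr pS)// mulr_sumr; apply: eq_bigr => i _.
rewrite /cell_energy /=.
set a := clamp _ _ (sp_time S i); set b := clamp _ _ (sp_time S i.+1).
have ab : a <= b by apply: clamp_homo; case: pS => _ nd _ _; exact: nd.
case: ifPn => [_|]; first by rewrite exprMn mulrA.
rewrite -leNgt => ba.
by rewrite (@le_anti _ _ b a) ?ba ?ab// subrr !mulr0.
Qed.

End grid_cells.

(** * Smoothing along an Ito integral *)

Section borel_cantelli_choice.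
Local Open Scope ereal_scope.
Context {d} {T : measurableType d} {R : realType} (P : probability T R).

(** A diagonal Borel-Cantelli argument: [nn m] is taken so large that the [K m]
    bad events of stage [m] have total probability at most [2^-(m+1)]. *)
Lemma ae_eventually_good (K : nat -> nat) (D : nat -> nat -> nat -> set T) :
  (forall m j n, measurable (D m j n)) ->
  (forall m j, (j < K m)%N -> P (D m j n) @[n --> \oo] --> 0) ->
  exists nn : nat -> nat, {ae P, forall w, exists M, forall m j, (M <= m)%N ->
    (j < K m)%N -> ~ D m j (nn m) w}.
Proof.
move=> mD PD.
have pick m : exists n, P (\big[setU/set0]_(j < K m) D m j n) <= (1 / (2 ^ m.+1)%:R)%:E.
  pose dl : R := (1 / (2 ^ m.+1)%:R / (K m).+1%:R)%R.
  have dl0 : (0 < dl)%R by rewrite /dl mul1r divr_gt0// invr_gt0 ltr0n expn_gt0.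
  have nearD : \forall n \near \oo, forall j : 'I_(K m), P (D m j n) < dl%:E.
    apply: filter_forall => j.
    have := PD m j (ltn_ord j).
    move/fine_cvgP => [fD /cvgrPdist_lt /(_ _ dl0) cD].
    near=> n; have fn : P (D m j n) \is a fin_num by near: n.
    rewrite -(fineK fn) lte_fin.
    have : (`|0 - fine (P (D m j n))| < dl)%R by near: n.
    by rewrite sub0r normrN; apply: le_lt_trans; exact: ler_norm.
  have [n Hn] := @filter_ex _ _ _ _ nearD.
  exists n; apply: le_trans (@Boole_inequality _ _ _ P (fun j => D m j n) (K m) (fun i _ => mD m i n)) _.
  apply: (@le_trans _ _ (\sum_(j < K m) dl%:E)).
    by apply: lee_sum => j _; exact/ltW/Hn.
  rewrite sumEFin lee_fin sumr_const card_ord -[X in (X <= _)%R]mulr_natr /dl.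
  by rewrite [X in (X <= _)%R]mulrAC ler_pdivrMr ?ltr0Sn// ler_wpM2l ?divr_ge0// ler_nat leqnSn.
have /choice[nn Hnn] := pick.
exists nn; pose E m := \big[setU/set0]_(j < K m) D m j (nn m).
have mE m : measurable (E m) by apply: bigsetU_measurable => j _; exact: mD.
have sumE : \sum_(m <oo) P (E m) < +oo.
  apply: (@le_lt_trans _ _ (\sum_(m <oo) (1 / (2 ^ m.+1)%:R)%:E)).
    by apply: lee_nneseries => // m _; exact: Hnn.
  apply: le_lt_trans (epsilon_trick0 xpredT (ler01 : (0 <= 1 :> R)%R)) _.
  by rewrite ltry.
have E0 := lim_sup_set_cvg0 mE sumE.
exists (lim_sup_set E); split => //.
  apply: bigcap_measurable => // k _; exact: bigcup_measurable.
move=> w /= nw; apply: contrapT => nl; apply: nw.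
have /existsNP[M HM] : ~ (forall M, (\bigcup_(k >= M) E k) w).
  by move=> h; apply: nl => k _; exact: h.
have EE m : E m = \bigcup_(j in `I_(K m)) D m j (nn m).
  by rewrite /E (bigcup_mkord (K m) (fun j => D m j (nn m))).
by exists M => m j Mm jK Dw; apply: HM; exists m => //; rewrite EE; exists j.
Unshelve. all: by end_near. Qed.

End borel_cantelli_choice.

Section stage.
Context {d} {T : measurableType d} {R : realType} (P : probability T R).
Local Notation mu := (@lebesgue_measure R).
Variables (F : R -> set (set T)) (W H I : R -> T -> R).
Hypotheses (filF : is_filtration F) (bmW : brownian_motion P F W).
Hypothesis itoI : ito_integral P F W H I.
Hypothesis cH : forall w, continuous_path H w.
Hypothesis mH : forall t, 0 <= t -> measurable_fun [set: T] (H t).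

Let mW t : 0 <= t -> measurable_fun [set: T] (W t).
Proof.
move=> t0 _ U mU; rewrite setTI; have [_ Fm _] := filF; have [aW _ _ _ _] := bmW.
by apply: (Fm t t0); exact: aW.
Qed.

Let mcoef S i : simple_predictable F S -> (i < sp_size S)%N ->
  measurable_fun [set: T] (sp_coef S i).
Proof.
move=> pS iS _ U mU; rewrite setTI; have [_ Fm _] := filF.
have [_ _ cS _] := pS; apply: (Fm (sp_time S i)); last exact: cS.
by apply: (sp_time_ge0 pS); exact: ltnW.
Qed.

(** The error is the integral of a nonnegative jointly measurable function, hence
    measurable by Tonelli. *)
Let measurable_error S (hor e : R) : simple_predictable F S ->
  measurable [set w | (e%:E <= \int[mu]_(s in `[0%R, hor])
      ((simple_value S s w - H s w) ^+ 2)%:E)%E].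
Proof.
move=> pS.
pose G (p : T * R) := (simple_value S p.2 p.1 - H (Num.max p.2 0) p.1) ^+ 2.
have mG : measurable_fun [set: T * R] G.
  apply: measurable_funX; apply: measurable_funB.
    rewrite /simple_value; apply: measurable_sum => i.
    apply: measurable_funM.
      by apply: (measurableT_comp (mcoef pS (ltn_ord i))).
    exact: (measurableT_comp (measurable_indic _) measurable_snd).
  exact: measurable_continuous_process.
pose E : set (T * R) := setT `*` `[0, hor]%classic.
have mE : measurable E by apply: measurableX => //; exact: measurable_itv.
pose f w := (\int[mu]_v ((EFin \o G) \_ E) (w, v))%E.
have mf : measurable_fun [set: T] f.
  apply: (@measurable_fun_fubini_tonelli_F _ _ _ _ R mu ((EFin \o G) \_ E)).
    apply/(measurable_restrictT _ mE); apply: measurable_funTS.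
    exact/measurable_EFinP.
  by move=> p; apply: erestrict_ge0 => // q _; rewrite lee_fin sqr_ge0.
have -> : [set w | (e%:E <= \int[mu]_(s in `[0%R, hor])
      ((simple_value S s w - H s w) ^+ 2)%:E)%E] = f @^-1` `[e%:E, +oo[%classic.
  apply/seteqP; split => w /=; rewrite in_itv/= andbT;
  suff -> : f w = (\int[mu]_(s in `[0%R, hor])
      ((simple_value S s w - H s w) ^+ 2)%:E)%E by [].
  - rewrite /f [RHS]integral_mkcond; apply: eq_integral => v _.
    rewrite !patchE; have [v01|v01] := boolP (v \in `[0, hor]%classic).
      rewrite mem_set; last by split => //; exact: set_mem v01.
      by rewrite /G /= max_l//; move/set_mem : v01; rewrite /= in_itv/= => /andP[].
    by rewrite memNset// => -[_ /mem_set]; rewrite (negbTE v01).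
  - rewrite /f [RHS]integral_mkcond; apply: eq_integral => v _.
    rewrite !patchE; have [v01|v01] := boolP (v \in `[0, hor]%classic).
      rewrite mem_set; last by split => //; exact: set_mem v01.
      by rewrite /G /= max_l//; move/set_mem : v01; rewrite /= in_itv/= => /andP[].
    by rewrite memNset// => -[_ /mem_set]; rewrite (negbTE v01).
by rewrite -[X in measurable X]setTI; apply: mf => //; exact: emeasurable_itv.
Qed.

Let measurable_integral_error S (t e : R) : simple_predictable F S -> 0 <= t ->
  measurable [set w | (e%:E <= (`|simple_integral S W t w - I t w|)%:E)%E].
Proof.
move=> pS t0; have [mI _ _] := itoI.
have mD : measurable_fun [set: T] (fun w => `|simple_integral S W t w - I t w|).
  apply: measurableT_comp => //; apply: measurable_funB; last exact: mI.
  rewrite /simple_integral; apply: measurable_sum => i.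
  have i0 : 0 <= sp_time S i by apply: (sp_time_ge0 pS); exact: ltnW.
  have i1 : 0 <= sp_time S i.+1 by exact: (sp_time_ge0 pS).
  apply: measurable_funM; first exact: (mcoef pS).
  by apply: measurable_funB; apply: mW; rewrite le_min t0 ?i0 ?i1.
have -> : [set w | (e%:E <= (`|simple_integral S W t w - I t w|)%:E)%E] =
   (fun w => `|simple_integral S W t w - I t w|) @^-1` `[e, +oo[%classic.
  by apply/seteqP; split => w /=; rewrite in_itv/= andbT lee_fin.
by rewrite -[X in measurable X]setTI; apply: mD => //; exact: measurable_itv.
Qed.

Variable p : R -> T -> R.
Hypothesis mp : forall v, 0 <= v -> measurable_wrt (F v) (p v).
Hypothesis cp : forall w, continuous_path p w.
Variables (B hor q : R).
Hypothesis pB : forall v w, 0 <= v -> p v w ^+ 2 <= B.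
Hypothesis hor0 : 0 <= hor.
Variables (N Q : T -> R).
Hypotheses (mN : measurable_fun [set: T] N) (mQ : measurable_fun [set: T] Q).
Hypothesis cvgN : {ae P, forall w,
  \sum_(i < n.+1) p (hor * i%:R / n.+1%:R) w *
     (I (hor * i.+1%:R / n.+1%:R) w - I (hor * i%:R / n.+1%:R) w)
   @[n --> \oo] --> N w}.
Hypothesis QE : {ae P, forall w,
  Q w = \int[mu]_(u in `[0, hor]) (p u w ^+ 2 * H u w ^+ 2) /\ Q w < q}.
Hypothesis q0 : 0 < q.

(** The identity holds for stopped discrete integrals over a grid of mesh
    [hor / (m+1)] carrying the weight [p] at its nodes and the simple process
    [S (nn m)] in between.  The index [nn m] is taken so large that the integral of
    [S (nn m)] is within [(m+1)^-2] of [I] at every node, and its mean square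
    distance to [H] is as small: summed over the nodes the first error is still
    of order [1 / m], so gains tend to [N]; the second makes energies tend to [Q].
    As [Q < q], the stopping rule ceases to act for large [m]. *)
Lemma ito_residual_smoothing h : test_function h ->
  (\int[P]_w residual_smoothing q h (N w, Q w) = residual_smoothing q h (0%R, 0%R))%E.
Proof.
move=> hT; have [mI cI [S [pS cvgS]]] := itoI.
pose tk m i : R := hor * i%:R / m.+1%:R.
have tk0 m i : 0 <= tk m i by rewrite divr_ge0// mulr_ge0.
have tk_nd m i : tk m i <= tk m i.+1.
  by rewrite ler_pM2r ?invr_gt0 ?ltr0Sn// ler_wpM2l// ler_nat.
pose e m : R := (m.+1%:R ^+ 2)^-1.
have e0 m : 0 < e m by rewrite invr_gt0 exprn_gt0.
(* bad events of stage m: number 0 for the integrand, number i+1 for node i *)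
pose D m j n : set T := if j is i.+1
  then [set w | ((e m)%:E <= (`|simple_integral (S n) W (tk m i) w - I (tk m i) w|)%:E)%E]
  else [set w | ((e m)%:E <= \int[mu]_(s in `[0%R, hor])
         ((simple_value (S n) s w - H s w) ^+ 2)%:E)%E].
have mD m j n : measurable (D m j n).
  by case: j => [|i]; [exact: measurable_error|exact: measurable_integral_error].
have PD m j : (j < m.+3)%N -> P (D m j n) @[n --> \oo] --> 0%E.
  move=> _; case: j => [|i] /=.
    by have [+ _] := cvgS _ hor0; apply; exact: e0.
  by have [_ +] := cvgS _ (tk0 m i); apply; exact: e0.
have [nn good] := ae_eventually_good mD PD.
pose s m := grid_cells (S (nn m)) (tk m) (fun k => p (tk m k)) m.+1.
have chs m : cell_chain F 0 (s m).
  have := @cell_chain_grid _ _ _ F (S (nn m)) filF (pS _) (tk m)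
    (fun k => p (tk m k)) (tk0 m) (tk_nd m) (fun k => mp (tk0 m k)) m.+1.
  by apply: cell_chain_le.
pose st0 : T -> R * R := cst (0, 0).
have mst0 : measurable_from (F 0) st0.
  have [sF _ _] := filF; have [S0 SC _] := sF 0 (lexx 0).
  move=> U mU; rewrite /st0 preimage_cst; case: ifP => _ //.
  by rewrite -(setD0 setT); apply: SC.
have st0q w : (st0 w).2 < q by [].
have run m := stopped_run_preserves filF bmW hT.1 (test_functionW hT) (lexx 0)
   (chs m) mst0 st0q.
have lim : (\int[P]_w residual_smoothing q h (stopped_run W q (s m) st0 w)
    @[m --> \oo] --> \int[P]_w residual_smoothing q h (N w, Q w))%E.
  apply: (@integral_residual_smoothing_cvg _ _ _ P h hT (fun=> q)
    (fun m => stopped_run W q (s m) st0) q (fun w => (N w, Q w))).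
  - exact: cvg_cst.
  - by move=> m; have [] := run m.
  - exact: measurable_fun_pair.
  apply: filterS3 good cvgN QE => w [M goodw] Nw [Qw Qq].
  have cp' := continuous_comp_max0 (@cp w); have cH' := continuous_comp_max0 (@cH w).
  have rate : \forall m \near \oo,
      \int[mu]_(u in `[0, hor]) ((simple_value (S (nn m)) u w - H (Num.max u 0) w) ^+ 2)
      <= (m.+1%:R ^+ 2)^-1.
    near=> m; have Mm : (M <= m)%N by near: m; exact: nbhs_infty_ge.
    have /= /negP := goodw m 0%N Mm isT; rewrite -ltNge => lt_e.
    have -> : \int[mu]_(u in `[0, hor]) ((simple_value (S (nn m)) u w - H (Num.max u 0) w) ^+ 2)
       = \int[mu]_(u in `[0, hor]) ((simple_value (S (nn m)) u w - H u w) ^+ 2).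
      apply: eq_Rintegral => u /set_mem; rewrite /= in_itv/= => /andP[u0 _].
      by rewrite max_l.
    rewrite /Rintegral -lee_fin fineK; first exact: ltW.
    rewrite ge0_fin_numE; first by apply: lt_trans lt_e _; rewrite ltry.
    by apply: integral_ge0 => u _; rewrite lee_fin sqr_ge0.
  have pB' u : p (Num.max u 0) w ^+ 2 <= B by apply: pB; rewrite le_max lexx orbT.
  have energy := @grid_energy_cvg _ (fun u => p (Num.max u 0) w)
    (fun u => H (Num.max u 0) w) (fun m u => simple_value (S (nn m)) u w) hor B
    cp' cH' hor0 pB' (fun m => measurable_simple_value (S (nn m)) w)
    (fun m => simple_value_bounded (S (nn m)) w) rate.
  have sumE m : \sum_(c <- s m) cell_energy c w =
     \sum_(i < m.+1) p (Num.max (hor * i%:R / m.+1%:R) 0) w ^+ 2 *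
     \int[mu]_(u in `[hor * i%:R / m.+1%:R, hor * i.+1%:R / m.+1%:R])
        (simple_value (S (nn m)) u w ^+ 2).
    rewrite (sum_grid_energy (pS _)); last exact: tk_nd.
    by apply: eq_bigr => i _; rewrite (max_l (tk0 m i)).
  have sumG m : \sum_(c <- s m) cell_gain W c w = \sum_(i < m.+1) p (tk m i) w *
     (simple_integral (S (nn m)) W (tk m i.+1) w - simple_integral (S (nn m)) W (tk m i) w).
    by rewrite (sum_grid_gain W (pS _)).
  have Ecvg : \sum_(c <- s m) cell_energy c w @[m --> \oo] --> Q w.
    under eq_fun do rewrite sumE.
    rewrite Qw; have -> : \int[mu]_(u in `[0, hor]) (p u w ^+ 2 * H u w ^+ 2) =
      \int[mu]_(u in `[0, hor]) (p (Num.max u 0) w ^+ 2 * H (Num.max u 0) w ^+ 2).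
      apply: eq_Rintegral => u /set_mem; rewrite /= in_itv/= => /andP[u0 _].
      by rewrite max_l.
    exact: energy.
  have Gcvg : \sum_(c <- s m) cell_gain W c w @[m --> \oo] --> N w.
    pose dI m := \sum_(i < m.+1) p (tk m i) w * (I (tk m i.+1) w - I (tk m i) w).
    have close : \forall m \near \oo,
        `|\sum_(c <- s m) cell_gain W c w - dI m| <= 2 * (B + 1) / m.+1%:R.
      near=> m; have Mm : (M <= m)%N by near: m; exact: nbhs_infty_ge.
      rewrite sumG /dI -sumrB; apply: le_trans (ler_norm_sum _ _ _) _.
      apply: (@le_trans _ _ (\sum_(i < m.+1) (B + 1) * (e m + e m))); last first.
        rewrite sumr_const card_ord -[X in X <= _]mulr_natr /e.
        have v0 : 0 < m.+1%:R :> R by rewrite ltr0Sn.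
        move: (m.+1%:R) v0 => v v0; rewrite le_eqVlt; apply/orP; left; apply/eqP.
        by field; rewrite gt_eqF.
      apply: ler_sum => i _; rewrite -mulrBr normrM.
      have ge i' : (i' < m.+2)%N ->
          `|simple_integral (S (nn m)) W (tk m i') w - I (tk m i') w| <= e m.
        move=> im; have /= /negP := goodw m i'.+1 Mm im.
        by rewrite lee_fin -ltNge => /ltW.
      apply: ler_pM => //.
        have := pB w (tk0 m i); have := sqr_ge0 (`|p (tk m i) w| - 1).
        rewrite -[p _ _ ^+ 2]real_normK ?num_real//.
        move: (`|p (tk m i) w|) (normr_ge0 (p (tk m i) w)) => y y0 h1 h2; nra.
      have -> (a b a' b' : R) : a - b - (a' - b') = (a - a') - (b - b') by ring.
      apply: le_trans (ler_normB _ _) _; apply: lerD; apply: ge.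
        by rewrite ltnS; exact: ltn_ord.
      by rewrite ltnS; apply: ltnW; exact: ltn_ord.
    have dIcvg : dI m @[m --> \oo] --> N w by exact: Nw.
    have diff0 : (\sum_(c <- s m) cell_gain W c w - dI m) @[m --> \oo] --> 0.
      apply/norm_cvg0P; apply: (@squeeze_cvgr _ _ _ _ (cst 0) (fun m => 2 * (B + 1) / m.+1%:R)).
      - near=> m; rewrite /= normr_ge0/=; near: m; exact: close.
      - exact: cvg_cst.
      - rewrite -[X in _ --> X](mulr0 (2 * (B + 1))).
        by apply: cvgM; [exact: cvg_cst|exact: cvg_harmonic].
    have := cvgD diff0 dIcvg; rewrite add0r => sumcvg.
    rewrite (_ : (fun m => _) = (fun m => \sum_(c <- s m) cell_gain W c w - dI m) + dI); last first.
      by apply/funext => m; rewrite fctE subrK.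
    exact: sumcvg.
  have runE : \forall m \near \oo, stopped_run W q (s m) st0 w =
      (\sum_(c <- s m) cell_gain W c w, \sum_(c <- s m) cell_energy c w).
    near=> m; have lt_q : (st0 w).2 + \sum_(c <- s m) cell_energy c w < q.
      by rewrite add0r; near: m; exact: (cvgr_lt _ Ecvg).
    by rewrite (stopped_runE W lt_q (chs m)) /st0 /= !add0r.
  split.
  - apply: cvg_trans Gcvg; apply: near_eq_cvg; near=> m.
    by rewrite (near runE m).
  - apply: cvg_trans Ecvg; apply: near_eq_cvg; near=> m.
    by rewrite (near runE m).
have cst_run m : (\int[P]_w residual_smoothing q h (stopped_run W q (s m) st0 w) =
    residual_smoothing q h (0%R, 0%R))%E.
  have [_ ->] := run m.
  exact: (integral_probability_cst P (residual_smoothing q h (0%R, 0%R))).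
have lim2 : (\int[P]_w residual_smoothing q h (stopped_run W q (s m) st0 w)
    @[m --> \oo] --> residual_smoothing q h (0%R, 0%R))%E.
  by rewrite (eq_cvg _ _ cst_run); exact: cvg_cst.
exact: (cvg_unique _ lim lim2).
Unshelve. all: by end_near. Qed.

End stage.

(** * Passage times and integrals over sublevel sets *)

Section sublevel_paths.
Context {R : realType}.
Local Notation mu := (@lebesgue_measure R).
Variables (z A : R -> R).
Hypotheses (cz : continuous z) (z0 : forall v, 0 <= z v).
Hypotheses (cA : continuous A) (A_le0 : forall v, v <= 0 -> A v = 0).
Hypothesis AE : forall v, 0 <= v -> A v = \int[mu]_(u in `[0, v]) z u.

Lemma clock_gt0 (t T : R) : 0 <= t -> t < A T -> 0 <= T.
Proof.
move=> t0 tT; rewrite leNgt; apply/negP => T0.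
by move: tT; rewrite A_le0 ?(ltW T0)// ltNge t0.
Qed.

Lemma sublevel_integral_stopped (k : R -> R) (t T : R) : continuous k ->
  0 <= t -> t < A T ->
  \int[mu]_(v in sublevel A t) (k v * z v) =
  \int[mu]_(u in `[0, T]) (k u * stopped_rate z A t u).
Proof.
move=> ck t0 tT; rewrite Rintegral_stopped_rate ?(clock_gt0 t0 tT)//.
rewrite setIidr// => v [v0 Avt]; rewrite /= in_itv/= v0/= leNgt; apply/negP => Tv.
have := clock_nd cz z0 A_le0 AE (ltW Tv).
by rewrite leNgt (le_lt_trans Avt tT).
Qed.

(** The clock moves by [t - s] while the level goes from [s] to [t], and [k] is
    bounded on the segment reached before level [tm]. *)
Lemma sublevel_integral_lipschitz (k : R -> R) (tm T : R) : continuous k ->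
  0 <= tm -> tm < A T -> exists K, 0 <= K /\ forall s t, 0 <= s -> s <= t -> t <= tm ->
  `|\int[mu]_(v in sublevel A t) (k v * z v) -
    \int[mu]_(v in sublevel A s) (k v * z v)| <= K * (t - s).
Proof.
move=> ck tm0 tmT; have [K [K0 Kk]] := continuous_bounded_segment 0 T ck.
exists K; split => // s t s0 st ttm.
have t0 : 0 <= t by exact: le_trans st.
have tT : t < A T by exact: le_lt_trans tmT.
have sT : s < A T by exact: le_lt_trans tT.
have T0 := clock_gt0 tm0 tmT.
rewrite !(@sublevel_integral_stopped k _ T)//.
have mT : @measurable _ (measurableTypeR R) `[0, T]%classic by exact: measurable_itv.
have ii (r : R) (h : R -> R) (ch : continuous h) :=
  @integrable_stopped_rate _ z A cz cA r h 0 T ch.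
have i1 (r : R) : mu.-integrable `[0, T] (EFin \o stopped_rate z A r).
  have := ii r (cst 1) (@cst_continuous _ _ _).
  by apply: eq_integrable => // u _ /=; rewrite mul1r.
rewrite -RintegralB//; [|exact: ii|exact: ii].
have <- : \int[mu]_(u in `[0, T])
    (K * (stopped_rate z A t u - stopped_rate z A s u)) = K * (t - s).
  rewrite RintegralZl//; last first.
    by have := integrableB mT (i1 t) (i1 s); apply: eq_integrable.
  rewrite RintegralB; [|exact: mT|exact: i1|exact: i1].
  rewrite -(stopped_clockE cz z0 cA A_le0 AE)//.
  rewrite -(stopped_clockE cz z0 cA A_le0 AE)//.
  by rewrite !min_r// ltW.
apply: le_normr_Rintegral_bounded.
- by have := integrableB mT (ii t k ck) (ii s k ck); apply: eq_integrable.
- have := integrableZl mT K (integrableB mT (i1 t) (i1 s)).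
  by apply: eq_integrable.
move=> u u0T; rewrite -mulrBr normrM ler_pM//; first exact: Kk.
rewrite ger0_norm// subr_ge0 /stopped_rate; case: ifP => [As|_].
  by rewrite (le_trans As st).
by case: ifP.
Qed.

Lemma continuous_sublevel_integral (k : R -> R) : continuous k ->
  (forall t, exists T, t < A T) ->
  {within `[0, +oo[, continuous (fun t => \int[mu]_(v in sublevel A t) (k v * z v))}.
Proof.
move=> ck unb; apply/subspace_continuousP => t0; rewrite /= in_itv/= andbT => t00.
have [T tT] := unb (t0 + 1).
have tm0 : 0 <= t0 + 1 by rewrite addr_ge0.
have [K [K0 KL]] := sublevel_integral_lipschitz ck tm0 tT.
apply/cvgrPdist_le => e e0; rewrite near_withinE; near=> t.
rewrite /= in_itv/= andbT => t_ge0.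
have t1 : t <= t0 + 1.
  by rewrite ltW//; near: t; apply: lt_nbhsl; rewrite ltrDl.
have d1 : `|t0 - t| <= e / (K + 1).
  near: t; apply: (@cvgr_dist_le _ _ _ (nbhs t0) _ id) => //.
  by rewrite divr_gt0// ltr_wpDl.
have Kd : K * `|t0 - t| <= e.
  apply: le_trans (ler_wpM2l K0 d1) _.
  by rewrite mulrCA ger_pMr// ler_pdivrMr ?ltr_wpDl// mul1r lerDl.
apply: le_trans Kd; have [tt|tt] := leP t t0.
  by rewrite (ger0_norm (_ : 0 <= t0 - t)) ?subr_ge0// KL// lerDl.
by rewrite distrC [in leRHS]distrC (ger0_norm (_ : 0 <= t - t0)) ?subr_ge0 ?KL// ltW.
Unshelve. all: by end_near. Qed.

End sublevel_paths.

(** Before the passage time the clock is at most [t]; a clock that exceeds [t] at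
    [v] does so already shortly before [v], by continuity. *)
Lemma passage_sublevel {R : realType} {d} {T : measurableType d}
    (C : R -> T -> R) (t : R) (w : T) : continuous_path C w ->
  (forall u v, 0 <= u -> u <= v -> C u w <= C v w) -> C 0 w <= t ->
  [set v | 0 <= v /\ (v%:E <= passage_time C t w)%E] = [set v | 0 <= v /\ C v w <= t].
Proof.
move=> cC nd C0; apply/seteqP; split => v /= [v0 vt]; split => //.
  rewrite leNgt; apply/negP => tC.
  have vgt0 : 0 < v.
    by rewrite lt_neqAle v0 andbT; apply/eqP => v00; move: tC; rewrite -v00 ltNge C0.
  have cA := @continuous_comp_max0 R (fun t => C t w) cC.
  have near1 : \forall u \near v^'-, t < C (Num.max u 0) w.
    by apply: (cvgr_gt _ (cvg_at_left_filter (cA v))); rewrite max_l.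
  have [u [[u1 u0] uv]] := @filter_ex _ _ _ _ (filterI (filterI near1 (nbhs_left_gt vgt0)) (nbhs_left_lt v)).
  rewrite max_l ?(ltW u0)// in u1.
  have : (v%:E <= u%:E)%E.
    apply: le_trans vt _; apply: ereal_inf_lbound.
    by exists u => //; split => //; exact: ltW.
  by rewrite lee_fin leNgt uv.
apply: le_ereal_inf_tmp => _ [r [r0 tr] <-]; rewrite lee_fin ltW// ltNge.
by apply/negP => rv; move: tr; rewrite ltNge (le_trans (nd _ _ r0 rv) vt).
Qed.

(** * Moments and covariances from Gaussian laws *)

Section gaussian_moments.
Context {d} {T : measurableType d} {R : realType} (P : probability T R).
Local Open Scope ereal_scope.

(** Keeping the shift [a] free gives the first moment as well, by comparing two
    shifts. *)
Lemma gaussian_law_second_moment (m s a : R) (xi : T -> R) :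
  (0 <= s)%R -> has_gaussian_law P m s xi ->
  \int[P]_w ((xi w + a) ^+ 2)%:E = ((m + a) ^+ 2 + s ^+ 2)%:E.
Proof.
move=> s0 [mxi lxi].
pose xi' : {mfun T >-> measurableTypeR R} :=
  HB.pack xi (isMeasurableFun.Build _ _ T (measurableTypeR R) xi mxi).
pose k (y : R) : R := ((y + a) ^+ 2)%R.
have ck : continuous k.
  move=> y; apply: (@continuous_comp _ _ _ (fun y => y + a)%R (fun x => x ^+ 2)%R).
    by apply: (@cvgD _ R^o); [exact: cvg_id|exact: cvg_cst].
  exact: exprn_continuous.
have mk : measurable_fun [set: measurableTypeR R] (EFin \o k).
  by apply/measurable_EFinP; exact: continuous_measurable_fun.
have k0 y : (0 <= k y)%R by exact: sqr_ge0.
transitivity (\int[distribution P xi']_y (EFin \o k) y).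
  by apply/esym; apply: ge0_integral_distribution => // y; rewrite lee_fin.
have [s00|s_neq0] := eqVneq s 0%R.
  transitivity (\int[@dirac _ (measurableTypeR R) m R]_y (EFin \o k) y).
    apply: eq_measure_integral => U mU _.
    by rewrite /= /distribution /pushforward /= lxi// /gaussian_law s00 eqxx.
  by rewrite integral_dirac// diracT mul1e s00 expr0n addr0.
have sgt0 : (0 < s)%R by rewrite lt_neqAle eq_sym s_neq0.
transitivity (\int[normal_prob m s]_y (k y)%:E).
  apply: eq_measure_integral => U mU _.
  by rewrite /= /distribution /pushforward /= lxi// /gaussian_law (negbTE s_neq0).
rewrite integral_normal_affine// -integral_stdn_sqr_affine.
by apply: eq_integral => z _; rewrite /k addrAC.
Qed.

(** Each function is integrable because it is nonnegative with a finite integral. *)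
Lemma integral_half_defect (A B D : T -> R) (a b e : R) :
  measurable_fun [set: T] A -> measurable_fun [set: T] B ->
  measurable_fun [set: T] D ->
  (forall w, 0 <= A w)%R -> (forall w, 0 <= B w)%R -> (forall w, 0 <= D w)%R ->
  \int[P]_w (A w)%:E = a%:E -> \int[P]_w (B w)%:E = b%:E ->
  \int[P]_w (D w)%:E = e%:E ->
  \int[P]_w (2^-1 * (A w - B w - D w))%:E = (2^-1 * (a - b - e))%:E.
Proof.
move=> mA mB mD A0 B0 D0 Aa Bb De.
have ii (h : T -> R) (r : R) : measurable_fun [set: T] h -> (forall w, 0 <= h w)%R ->
    \int[P]_w (h w)%:E = r%:E -> P.-integrable [set: T] (EFin \o h).
  move=> mh h0 hr; apply/integrableP; split; first exact/measurable_EFinP.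
  under eq_integral do rewrite /= ger0_norm//.
  by rewrite hr ltry.
have iA := ii _ _ mA A0 Aa; have iB := ii _ _ mB B0 Bb; have iD := ii _ _ mD D0 De.
have iAB := integrableB measurableT iA iB.
have iABD := integrableB measurableT iAB iD.
have -> : (fun w => (2^-1 * (A w - B w - D w))%:E) =
    (fun w => 2^-1%:E * (((EFin \o A) \- (EFin \o B)) \- (EFin \o D)) w).
  by apply/funext => w; rewrite /= EFinM !EFinB.
rewrite integralZl// integralB// integralB//.
by rewrite Aa Bb De -!EFinB -EFinM.
Qed.

Let msqr (xi : T -> R) (a : R) : measurable_fun [set: T] xi ->
  measurable_fun [set: T] (fun w => (xi w + a) ^+ 2)%R.
Proof.
move=> mxi; apply: (measurableT_comp (f := fun y : R => (y ^+ 2)%R)) => //.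
exact: measurable_funD.
Qed.

(** [x = ((x + 1)^2 - x^2 - 1) / 2] reduces the mean to second moments, which
    also provide the integrability. *)
Lemma gaussian_law_expectation (m s : R) (xi : T -> R) :
  (0 <= s)%R -> has_gaussian_law P m s xi -> 'E_P[xi] = m%:E.
Proof.
move=> s0 lxi; have mxi := lxi.1.
rewrite unlock.
have E1 : \int[P]_w (cst 1%:E w) = 1%:E.
  by rewrite integral_probability_cst.
have := @integral_half_defect (fun w => (xi w + 1) ^+ 2)%R (fun w => (xi w + 0) ^+ 2)%R
  (cst 1%R) _ _ 1 (msqr 1 mxi) (msqr 0 mxi) (measurable_cst _)
  (fun w => sqr_ge0 _) (fun w => sqr_ge0 _) (fun w => ler01)
  (gaussian_law_second_moment 1 s0 lxi) (gaussian_law_second_moment 0 s0 lxi).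
move=> /(_ E1) E; transitivity ((2^-1 * ((m + 1) ^+ 2 + s ^+ 2 - ((m + 0) ^+ 2 + s ^+ 2) - 1))%:E).
  by rewrite -E; apply: eq_integral => w _; congr EFin; rewrite /cst; field.
by congr EFin; field.
Qed.

(** Polarization of the variance. *)
Lemma gaussian_law_covariance (m1 s1 m2 s2 m s : R) (xi1 xi2 : T -> R) :
  (0 <= s1)%R -> (0 <= s2)%R -> (0 <= s)%R ->
  has_gaussian_law P m1 s1 xi1 -> has_gaussian_law P m2 s2 xi2 ->
  has_gaussian_law P m s (fun w => xi1 w + xi2 w)%R ->  m = (m1 + m2)%R ->
  covariance P xi1 xi2 = (2^-1 * (s ^+ 2 - s1 ^+ 2 - s2 ^+ 2))%:E.
Proof.
move=> s10 s20 s0 l1 l2 l mE.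
rewrite unlock (gaussian_law_expectation s10 l1) (gaussian_law_expectation s20 l2) /= unlock.
have := integral_half_defect (msqr (- m) l.1) (msqr (- m1) l1.1) (msqr (- m2) l2.1)
  (fun w => sqr_ge0 _) (fun w => sqr_ge0 _) (fun w => sqr_ge0 _)
  (gaussian_law_second_moment (- m) s0 l) (gaussian_law_second_moment (- m1) s10 l1)
  (gaussian_law_second_moment (- m2) s20 l2).
rewrite !subrr expr0n/= !add0r => <-; apply: eq_integral => w _; congr EFin.
by rewrite mE -[LHS]/((xi1 w - m1) * (xi2 w - m2))%R; field.
Qed.

End gaussian_moments.

(** * The solution of the equation *)

Lemma cvg_sum_ord {R : realType} {X : Type} (F : set_system X) {FF : Filter F}
    (n : nat) (u : 'I_n -> X -> R) (l : 'I_n -> R) :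
  (forall i, u i y @[y --> F] --> l i) ->
  \sum_(i < n) u i y @[y --> F] --> \sum_(i < n) l i.
Proof.
elim: n u l => [|n IH] u l ul.
  rewrite big_ord0 (_ : (fun y => _) = cst 0); first exact: cvg_cst.
  by apply/funext => y; rewrite big_ord0.
rewrite big_ord_recr/= (_ : (fun y => _) =
  (fun y => \sum_(i < n) u (widen_ord (leqnSn n) i) y) + u ord_max).
  by apply: cvgD; [exact: IH|exact: ul].
by apply/funext => y; rewrite big_ord_recr.
Qed.

Lemma continuous_sqr {R : realType} (k : R -> R) : continuous k ->
  continuous (fun u : R => k u ^+ 2).
Proof.
move=> ck u; apply: (@continuous_comp _ _ _ k (fun x => x ^+ 2)).
  exact: ck.
exact: exprn_continuous.
Qed.

Section lower_ramp.
Context {R : realType}.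
Local Notation stdn := (normal_prob (0 : R) 1).

(** A continuous majorant of the indicator of the half-line below [- K]. *)
Definition lower_ramp (K : nat) (y : R) : R :=
  Num.min 1 (Num.max 0 (1 - K%:R - y)).

Lemma lower_ramp_test K : test_function (lower_ramp K).
Proof.
split => [y|y]; last by rewrite /lower_ramp le_min ler01 le_max lexx ge_min lexx.
have cl : {for y, continuous (fun y : R => 1 - K%:R - y : R^o)}.
  by apply: (@cvgB _ R^o); [exact: cvg_cst|exact: cvg_id].
have c0 (r : R) : {for y, continuous (cst r : R -> R^o)} by exact: cvg_cst.
exact: (continuous_min (c0 1) (continuous_max (c0 0) cl)).
Qed.

Lemma lower_ramp_anti K y y' : y <= y' -> lower_ramp K y' <= lower_ramp K y.
Proof.
move=> yy; rewrite /lower_ramp le_min ge_min lexx/= ge_min; apply/orP; right.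
by rewrite ge_max !le_max lexx/= lerD2l lerN2 yy orbT.
Qed.

Lemma lower_ramp1 K y : y <= - K%:R -> lower_ramp K y = 1.
Proof.
move=> yK; rewrite /lower_ramp min_l// le_max; apply/orP; right.
by rewrite -addrA lerDl -opprD oppr_ge0 addrC -lerBrDr sub0r.
Qed.

Lemma lower_ramp0 K y : 1 - K%:R <= y -> lower_ramp K y = 0.
Proof. by move=> yK; rewrite /lower_ramp max_l ?subr_le0// min_r. Qed.

Let mramp K (k : R -> R) : measurable_fun [set: R] k ->
  measurable_fun [set: R] (fun z => (lower_ramp K (k z))%:E).
Proof.
move=> mk; apply/measurable_EFinP; apply: measurableT_comp => //.
by apply: continuous_measurable_fun; case: (lower_ramp_test K).
Qed.

Lemma lower_ramp_residual_cvg0 (q : R) :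
  (residual_smoothing q (lower_ramp K) (0%R, 0%R) @[K --> \oo] --> 0)%E.
Proof.
have -> : (0 = \int[stdn]_z (0 : \bar R))%E by rewrite integral0.
apply: (@bounded_cvg_integral _ _ R stdn
   (fun K z => (lower_ramp K (0 + Num.sqrt (q - 0) * z))%:E) (cst 0%E)).
- by move=> K; apply: mramp; apply: continuous_measurable_fun; exact: continuous_affine.
- exact: measurable_cst.
- by move=> K z; rewrite !lee_fin; case: (lower_ramp_test K) => _.
apply: aeW => z; apply: cvg_near_cst; near=> K.
rewrite lower_ramp0// lerBlDl -lerBlDr.
by near: K; exact: nbhs_infty_ger.
Unshelve. all: by end_near. Qed.

(** A lower bound, uniform in the remaining variance at most [q], for the smoothing
    of [lower_ramp K] at points at most [- 2 K]. *)
Definition ramp_mass (q : R) (K : nat) : \bar R :=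
  (\int[stdn]_z (lower_ramp K (- (K%:R *+ 2) + Num.sqrt q * `|z|))%:E)%E.

Lemma ramp_mass_cvg1 (q : R) : (ramp_mass q K @[K --> \oo] --> 1)%E.
Proof.
have -> : (1 = \int[stdn]_z (cst 1 z : \bar R))%E.
  by rewrite integral_probability_cst.
apply: (@bounded_cvg_integral _ _ R stdn
  (fun K z => (lower_ramp K (- (K%:R *+ 2) + Num.sqrt q * `|z|))%:E) (cst 1%E)).
- by move=> K; apply: mramp; apply: measurable_funD => //; apply: measurable_funM.
- exact: measurable_cst.
- by move=> K z; rewrite !lee_fin; case: (lower_ramp_test K) => _.
apply: aeW => z; apply: cvg_near_cst; near=> K.
rewrite lower_ramp1// mulr2n opprD -addrA gerDl addrC subr_le0.
by near: K; exact: nbhs_infty_ger.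
Unshelve. all: by end_near. Qed.

Lemma ramp_mass_le (q : R) K (p : R * R) : p.1 <= - (K%:R *+ 2) -> 0 <= p.2 ->
  (ramp_mass q K <= residual_smoothing q (lower_ramp K) p)%E.
Proof.
move=> p1 p2; apply: ge0_le_integral => //.
- by move=> z _; rewrite lee_fin (test_functionW (lower_ramp_test K)).
- by apply: mramp; apply: measurable_funD => //; apply: measurable_funM.
- by apply: mramp; apply: continuous_measurable_fun; exact: continuous_affine.
move=> z _; rewrite lee_fin; apply: lower_ramp_anti; apply: lerD => //.
apply: le_trans (ler_norm _) _; rewrite normrM ler_wpM2r//.
by rewrite ger0_norm ?sqrtr_ge0// ler_wsqrtr// gerBl.
Qed.

End lower_ramp.

(** [g] is the square root of [g^2]. *)
Lemma continuous_lipschitz_sqr {R : realType} (g : R -> R) :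
  (exists k : R, k.-lipschitz_(`[0, +oo[) (fun t => g t ^+ 2)) ->
  (forall t, 0 <= t -> 0 <= g t) -> {within `[0, +oo[, continuous g}.
Proof.
move=> [k lip] g0.
have c2 : {within `[0, +oo[, continuous (fun t => g t ^+ 2)}.
  apply/subspace_continuousP => t0; rewrite /= in_itv/= andbT => t00.
  apply/cvgrPdist_le => e e0; rewrite near_withinE; near=> t.
  rewrite /= in_itv/= andbT => t_ge0.
  have := lip (t0, t); rewrite /= !in_itv/= !andbT => /(_ (conj t00 t_ge0)) h.
  apply: le_trans h _.
  have d1 : `|t0 - t| <= e / (`|k| + 1).
    near: t; apply: (@cvgr_dist_le _ _ _ (nbhs t0) _ id) => //.
    by rewrite divr_gt0// ltr_wpDl.
  apply: (@le_trans _ _ ((`|k| + 1) * `|t0 - t|)).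
    by rewrite ler_wpM2r// (le_trans (ler_norm k))// lerDl.
  by rewrite -ler_pdivlMl ?ltr_wpDl// mulrC.
have cs : {within `[0, +oo[, continuous (fun t => Num.sqrt (g t ^+ 2))}.
  apply/subspace_continuousP => t t0.
  apply: (@continuous_cvg _ _ _ _ _ (fun s => g s ^+ 2) (@Num.sqrt R)).
    exact: sqrt_continuous.
  by move/subspace_continuousP: c2; exact.
apply: (@subspace_eq_continuous _ _ _ _ _ _ cs) => t /set_mem.
by rewrite /= in_itv/= andbT => t0; rewrite /from_subspace sqrtr_sqr ger0_norm ?g0.
Unshelve. all: by end_near. Qed.

Section solution.
Context {d} {T : measurableType d} {R : realType} (P : probability T R).
Local Notation mu := (@lebesgue_measure R).
Variables (F : R -> set (set T)) (W Z C I : R -> T -> R) (g f : R -> R) (c x : R).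
Hypotheses (filF : is_filtration F) (bmW : brownian_motion P F W).
Hypotheses (aZ : adapted F Z) (cZ : forall w, continuous_path Z w)
  (Z0 : forall w t, 0 <= t -> 0 <= Z t w).
Hypotheses (aC : adapted F C) (cC : forall w, continuous_path C w)
  (C0 : forall w t, 0 <= t -> 0 <= C t w).
Hypothesis cg : continuous (fun y : R => g (Num.max y 0)).
Hypothesis cf : continuous (fun y : R => f (Num.max y 0)).

Let H v w := g (C v w) * Num.sqrt (Z v w).

Hypothesis itoI : ito_integral P F W H I.
Hypothesis sde : {ae P, forall w, forall v, 0 <= v ->
  Z v w = x + I v w + \int[mu]_(u in `[0, v]) (c + f (C u w) * Z u w)}.
Hypothesis clock : {ae P, forall w, forall v, 0 <= v ->
  C v w = \int[mu]_(u in `[0, v]) Z u w}.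

Lemma measurable_adapted Y t : adapted F Y -> 0 <= t -> measurable_fun [set: T] (Y t).
Proof.
move=> aY t0 _ U mU; rewrite setTI; have [_ Fm _] := filF.
by apply: (Fm t t0); exact: aY.
Qed.

Let mZ t : 0 <= t -> measurable_fun [set: T] (Z t).
Proof. exact: measurable_adapted. Qed.

Let mC t : 0 <= t -> measurable_fun [set: T] (C t).
Proof. exact: measurable_adapted. Qed.

Let mI t : 0 <= t -> measurable_fun [set: T] (I t).
Proof. by have [h _ _] := itoI; exact: h. Qed.

Let cI w : continuous_path I w.
Proof. by have [_ h _] := itoI; exact: h. Qed.

(** Constant extension to the left of the origin, so that paths are continuous on
    the whole line. *)
Definition ext_path (Y : R -> T -> R) (w : T) (v : R) : R := Y (Num.max v 0) w.

Lemma ext_pathE Y w v : 0 <= v -> ext_path Y w v = Y v w.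
Proof. by move=> v0; rewrite /ext_path max_l. Qed.

Let cext Y w : continuous_path Y w -> continuous (ext_path Y w).
Proof. move=> cY; exact: (@continuous_comp_max0 R (fun t => Y t w) cY). Qed.

Let max0_ge0 (v : R) : 0 <= Num.max v 0.
Proof. by rewrite le_max lexx orbT. Qed.

Let mext Y : (forall t, 0 <= t -> measurable_fun [set: T] (Y t)) ->
  (forall w, continuous_path Y w) ->
  measurable_fun [set: T * R] (fun p : T * R => ext_path Y p.1 p.2).
Proof. exact: measurable_continuous_process. Qed.

(** Simple integrals vanish at time 0, and they converge in probability to
    [I 0]. *)
Lemma ae_initial_integral : {ae P, forall w, I 0 w = 0}.
Proof.
have [_ _ [S [pS /(_ 0 (lexx 0)) [_ cvgS]]]] := itoI.
have S00 n w : simple_integral (S n) W 0 w = 0.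
  rewrite /simple_integral big1// => i _.
  have i0 : 0 <= sp_time (S n) i by apply: (sp_time_ge0 (pS n)); exact: ltnW.
  have i1 : 0 <= sp_time (S n) i.+1 by exact: (sp_time_ge0 (pS n)).
  by rewrite !min_r// subrr mulr0.
pose E k := [set w | (k.+1%:R^-1)%:E <= (`|I 0 w|)%:E]%E.
have mE k : measurable (E k).
  have mD : measurable_fun [set: T] (fun w => `|I 0 w|).
    by apply: measurableT_comp => //; exact: mI.
  have -> : E k = (fun w => `|I 0 w|) @^-1` `[k.+1%:R^-1, +oo[%classic.
    by apply/seteqP; split => w /=; rewrite /E /= in_itv/= andbT lee_fin.
  by rewrite -[X in measurable X]setTI; apply: mD => //; exact: measurable_itv.
have E0 k : P (E k) = 0%E.
  have k0 : 0 < k.+1%:R^-1 :> R by rewrite invr_gt0.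
  have := cvgS _ k0.
  rewrite (_ : (fun n => _) = fun=> P (E k)); last first.
    apply/funext => n; congr (P _); apply/seteqP; split => w;
    by rewrite /E /= S00 sub0r normrN.
  by move=> h; apply: (cvg_unique _ _ h) => //; exact: cvg_cst.
exists (\bigcup_k E k); split.
- exact: bigcupT_measurable.
- apply/eqP; rewrite eq_le measure_ge0 andbT.
  apply: le_trans (measure_sigma_subadditive _ _ _ _) _ => //.
  + exact: bigcupT_measurable.
  + by rewrite eseries0// => k _ _; exact: E0.
move=> w /= /eqP I0; have aI0 : 0 < `|I 0 w| by rewrite normr_gt0.
exists (Num.truncn (`|I 0 w|^-1)) => //; rewrite /E /= lee_fin.
by rewrite invf_ple ?posrE// ltW// truncnS_gt.
Qed.

Definition good_path w := [/\ forall v, 0 <= v ->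
  Z v w = x + I v w + \int[mu]_(u in `[0, v]) (c + f (C u w) * Z u w),
  forall v, 0 <= v -> C v w = \int[mu]_(u in `[0, v]) Z u w & I 0 w = 0].

Lemma ae_good_path : {ae P, forall w, good_path w}.
Proof. by apply: filterS3 sde clock ae_initial_integral => w. Qed.

Section good.
Variable w : T.
Hypothesis gw : good_path w.

Let z := ext_path Z w.
Let A := ext_path C w.

Lemma good_cz : continuous z. Proof. exact: cext. Qed.
Lemma good_z0 v : 0 <= z v. Proof. exact: Z0. Qed.
Lemma good_cA : continuous A. Proof. exact: cext. Qed.

Lemma good_AE v : 0 <= v -> A v = \int[mu]_(u in `[0, v]) z u.
Proof.
move=> v0; case: gw => _ CE _; rewrite /A ext_pathE// CE//.
by apply: eq_Rintegral => u /set_mem; rewrite /= in_itv/= => /andP[u0 _]; rewrite /z ext_pathE.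
Qed.

Lemma good_A_le0 v : v <= 0 -> A v = 0.
Proof.
move=> v0; rewrite (_ : A v = A 0); last by rewrite /A /ext_path !max_r.
by rewrite good_AE// Rintegral_itv1.
Qed.

Lemma good_drift v : 0 <= v ->
  z v - c * v = x + ext_path I w v + primitive (fun y => f (Num.max y 0)) (A v).
Proof.
move=> v0; case: gw => /(_ v v0) ZE _ _.
rewrite /z /A !ext_pathE// ZE.
have -> : \int[mu]_(u in `[0, v]) (c + f (C u w) * Z u w) =
    \int[mu]_(u in `[0, v]) (c + f (Num.max (A u) 0) * z u).
  apply: eq_Rintegral => u /set_mem; rewrite /= in_itv/= => /andP[u0 _].
  by rewrite /A /z !ext_pathE// max_l ?C0.
have cfz : continuous (fun u => f (Num.max (A u) 0) * z u).
  move=> u; apply: cvgM; last exact: good_cz.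
  by apply: (@continuous_comp _ _ _ A (fun y => f (Num.max y 0))); [exact: good_cA|exact: cf].
rewrite RintegralD//; [|apply: integrable_segment; exact: cst_continuous|exact: integrable_segment].
rewrite (Rintegral_clock good_cz good_z0 good_cA good_A_le0 good_AE cf v0).
rewrite /primitive /A ext_pathE//.
rewrite (_ : \int[mu]_(_ in `[0, v]) c = c * v); first by ring.
rewrite Rintegral_cst//= lebesgue_measure_itv/= lte_fin.
case: ltP => [_|v_le0]; first by rewrite sube0.
by rewrite (le_anti (_ : v <= 0 <= v)) ?v0 ?v_le0.
Qed.

End good.

(** * Weighted stochastic integrals *)

Section weights.
Variables (n : nat) (a t : 'I_n -> R).
Hypothesis t0 : forall i, 0 <= t i.

(** Seen through the clock, [t_i - min y t_i] is what remains of level [t_i] at clock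
    value [y]. *)
Definition tail_weight (y : R) : R := \sum_(i < n) a i * (t i - Num.min y (t i)).

Lemma continuous_tail_weight : continuous tail_weight.
Proof.
move=> y; apply: cvg_sum_ord => i.
apply: cvgM; first exact: cvg_cst.
apply: (@cvgB _ R^o); first exact: cvg_cst.
have ci : {for y, continuous (id : R -> R^o)} by exact: cvg_id.
have c0 : {for y, continuous (cst (t i) : R -> R^o)} by exact: cvg_cst.
exact: (continuous_min ci c0).
Qed.

Lemma tail_weight_bounded y : 0 <= y -> tail_weight y ^+ 2 <= (\sum_(i < n) `|a i| * t i) ^+ 2.
Proof.
move=> y0; rewrite -[leLHS]real_normK ?num_real// lerXn2r ?nnegrE//.
  by apply: sumr_ge0 => i _; rewrite mulr_ge0.
apply: le_trans (ler_norm_sum _ _ _) _; apply: ler_sum => i _.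
rewrite normrM ler_wpM2l// ger0_norm ?subr_ge0 ?ge_min ?lexx ?orbT//.
by rewrite lerBlDr lerDl le_min y0 t0.
Qed.

(** Quadratic variation of the weighted integral per unit of clock time. *)
Definition energy_density (y : R) : R := tail_weight y ^+ 2 * g (Num.max y 0) ^+ 2.

Lemma energy_density_ge0 y : 0 <= energy_density y.
Proof. by rewrite mulr_ge0 ?sqr_ge0. Qed.

Lemma continuous_energy_density : continuous energy_density.
Proof.
have c1 := continuous_sqr continuous_tail_weight; have c2 := continuous_sqr cg.
by move=> y; apply: cvgM; [exact: c1|exact: c2].
Qed.

Variable tm : R.
Hypothesis ttm : forall i, t i <= tm.

Definition total_energy : R := \int[mu]_(s in `[0, tm]) energy_density s.

Lemma energy_le y : 0 <= y -> primitive energy_density y <= total_energy.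
Proof.
move=> y0; rewrite /primitive /total_energy.
have ii u v := integrable_segment u v continuous_energy_density.
have [ytm|tmy] := leP y tm.
  rewrite (@Rintegral_itv_cat _ _ 0 y tm)// lerDl.
  by apply: Rintegral_ge0 => s _; exact: energy_density_ge0.
have zero u v : tm <= u -> \int[mu]_(s in `[u, v]) energy_density s = 0.
  move=> tmu; transitivity (\int[mu]_(s in `[u, v]) (cst 0 : R -> R) s).
    apply: eq_Rintegral => s /set_mem; rewrite /= in_itv/= => /andP[us _].
    rewrite /energy_density /tail_weight big1 ?expr0n ?mul0r// => i _.
    by rewrite min_r ?subrr ?mulr0// (le_trans (ttm i))// (le_trans tmu).
  by rewrite Rintegral_cst//= mul0r.
have [tm0|tm0] := leP 0 tm; last first.
  rewrite zero ?(ltW tm0)//.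
  by apply: Rintegral_ge0 => s _; exact: energy_density_ge0.
by rewrite (@Rintegral_itv_cat _ _ 0 tm y) ?(ltW tmy)// (zero tm y)// addr0.
Qed.

Lemma energy_eq y : 0 <= y -> tm <= y -> primitive energy_density y = total_energy.
Proof.
move=> y0 tmy; apply/eqP; rewrite eq_le energy_le//= /total_energy /primitive.
have [tm0|tm0] := leP 0 tm; last first.
  rewrite set_itv_ge ?bnd_simp -?ltNge// Rintegral_set0.
  by apply: Rintegral_ge0 => s _; exact: energy_density_ge0.
rewrite [leRHS](@Rintegral_itv_cat _ _ 0 tm y)//.
  by rewrite lerDl; apply: Rintegral_ge0 => s _; exact: energy_density_ge0.
exact: (integrable_segment _ _ continuous_energy_density).
Qed.

Definition stopped_moment (s v : R) (w : T) : R :=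
  \int[mu]_(u in `[0, v]) (ext_path I w u * stopped_rate (ext_path Z w) (ext_path C w) s u).

(** The stochastic integral of [tail_weight] at the clock against [I], in the form
    given by integration by parts; this makes sense path by path. *)
Definition weighted_integral (v : R) (w : T) : R :=
  \sum_(i < n) a i * ((t i - Num.min (C v w) (t i)) * I v w + stopped_moment (t i) v w).

Let measurable_stopped_moment s v : measurable_fun [set: T] (stopped_moment s v).
Proof.
pose E : set (T * R) := setT `*` `[0, v]%classic.
have mE : measurable E by apply: measurableX => //; exact: measurable_itv.
have := measurable_fine_integral_set (E := E)
  (G := fun p : T * R => ext_path I p.1 p.2 *
    stopped_rate (ext_path Z p.1) (ext_path C p.1) s p.2) mE.
have mG : measurable_fun [set: T * R] (fun p : T * R => ext_path I p.1 p.2 *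
    stopped_rate (ext_path Z p.1) (ext_path C p.1) s p.2).
  apply: measurable_funM; first exact: mext.
  apply: measurable_fun_ifT => //; last exact: mext.
  by apply: measurable_fun_ler => //; exact: mext.
move=> /(_ mG); congr (measurable_fun _ _); apply/funext => w /=.
rewrite /stopped_moment; congr (Rintegral _ _ _).
by apply/seteqP; split => u /= => [[]|].
Qed.

Lemma measurable_weighted_integral v : 0 <= v ->
  measurable_fun [set: T] (weighted_integral v).
Proof.
move=> v0; apply: measurable_sum => i; apply: measurable_funM => //.
apply: measurable_funD => //; apply: measurable_funM; last exact: mI.
by apply: measurable_funB => //; apply: measurable_minr => //; exact: mC.
Qed.

Lemma measurable_energy v : 0 <= v ->
  measurable_fun [set: T] (fun w => primitive energy_density (C v w)).
Proof.
move=> v0; rewrite (_ : (fun w => _) =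
   (fun y => primitive energy_density (Num.max y 0)) \o C v); last first.
  by apply/funext => w /=; rewrite max_l ?C0.
apply: measurableT_comp; last exact: mC.
apply: continuous_measurable_fun; apply: continuous_primitive.
exact: continuous_energy_density.
Qed.

Let cH w : continuous_path H w.
Proof.
have c1 : continuous (fun v => g (Num.max (ext_path C w v) 0)).
  move=> v; apply: (@continuous_comp _ _ _ (ext_path C w) (fun y => g (Num.max y 0))).
    exact: cext.
  exact: cg.
have c2 : continuous (fun v => Num.sqrt (ext_path Z w v)).
  move=> v; apply: (@continuous_comp _ _ _ (ext_path Z w) (@Num.sqrt R)).
    exact: cext.
  exact: sqrt_continuous.
have cHe : continuous (fun v => g (Num.max (ext_path C w v) 0) * Num.sqrt (ext_path Z w v)).
  by move=> v; apply: cvgM; [exact: c1|exact: c2].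
rewrite /continuous_path; apply: (@subspace_eq_continuous _ _ _ _ _ _ (continuous_subspaceT cHe)).
move=> v /set_mem; rewrite /= in_itv/= andbT => v0.
by rewrite /from_subspace !ext_pathE// max_l ?C0.
Qed.

Let mH v : 0 <= v -> measurable_fun [set: T] (H v).
Proof.
move=> v0; apply: measurable_funM.
  rewrite (_ : (fun w => g (C v w)) = (fun y => g (Num.max y 0)) \o C v); last first.
    by apply/funext => w /=; rewrite max_l ?C0.
  by apply: measurableT_comp; [exact: continuous_measurable_fun|exact: mC].
apply: measurableT_comp; last exact: mZ.
by apply: continuous_measurable_fun; exact: sqrt_continuous.
Qed.

(** The identity for Ito integrals, applied to [tail_weight] at the clock: its
    Riemann sums converge to [weighted_integral] path by path, and its quadratic
    variation is [primitive energy_density] at the clock. *)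
Lemma weighted_integral_residual h v q : 0 <= v -> 0 < q -> total_energy < q ->
  test_function h ->
  (\int[P]_w residual_smoothing q h (weighted_integral v w, primitive energy_density (C v w)) =
   residual_smoothing q h (0%R, 0%R))%E.
Proof.
move=> v0 q0 Vq hT.
apply: (@ito_residual_smoothing _ _ _ P F W H I filF bmW itoI cH mH
  (fun v w => tail_weight (C v w)) _ _ ((\sum_(i < n) `|a i| * t i) ^+ 2) v q _ v0
  (weighted_integral v) (fun w => primitive energy_density (C v w)) _ _ _ _ q0 h hT).
- move=> u u0; have mC' : measurable_from (F u) (C u) by exact: aC.
  apply: (measurable_from_comp mC').
  exact: (continuous_measurable_fun continuous_tail_weight).
- move=> w; have ce : continuous (fun v => tail_weight (ext_path C w v)).
    move=> u; apply: (@continuous_comp _ _ _ (ext_path C w) tail_weight); first exact: cext.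
    exact: continuous_tail_weight.
  rewrite /continuous_path; apply: (@subspace_eq_continuous _ _ _ _ _ _ (continuous_subspaceT ce)).
  move=> u /set_mem; rewrite /= in_itv/= andbT => u0.
  by rewrite /from_subspace !ext_pathE.
- by move=> u w u0; apply: tail_weight_bounded; exact: C0.
- exact: measurable_weighted_integral.
- exact: measurable_energy.
- apply: filterS ae_good_path => w gw; have [_ _ I0] := gw.
  have rs i := @riemann_stieltjes_clock _ _ _ (@good_cz w) (@good_z0 w) (@good_cA w)
    (@good_A_le0 w gw) (@good_AE w gw) (ext_path I w) (t i) v (cext (@cI w))
    (etrans (ext_pathE I w (lexx 0)) I0) (t0 i) v0.
  have := cvg_sum_ord (fun i => cvgM (cvg_cst (a i)) (rs i)).
  rewrite (_ : (fun y => _) = (fun m => \sum_(k < m.+1) tail_weight (C (v * k%:R / m.+1%:R) w) *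
     (I (v * k.+1%:R / m.+1%:R) w - I (v * k%:R / m.+1%:R) w))); last first.
    apply/funext => m; rewrite /tail_weight.
    under [RHS]eq_bigr do rewrite mulr_suml.
    rewrite exchange_big/=; apply: eq_bigr => i _; rewrite mulr_sumr.
    apply: eq_bigr => k _.
    by rewrite !ext_pathE ?divr_ge0 ?mulr_ge0// mulrA.
  rewrite /weighted_integral /stopped_moment. rewrite !(ext_pathE _ _ v0). by apply; exact: eventually_filter.
- apply: filterS ae_good_path => w gw; split.
    have ck := continuous_energy_density.
    have := Rintegral_clock (@good_cz w) (@good_z0 w) (@good_cA w)
      (@good_A_le0 w gw) (@good_AE w gw) ck v0.
    rewrite ext_pathE// /primitive => <-; apply: eq_Rintegral => u /set_mem.
    rewrite /= in_itv/= => /andP[u0 _]; rewrite !ext_pathE// /energy_density max_l ?C0//.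
    rewrite /H exprMn sqr_sqrtr ?Z0//; ring.
  by apply: le_lt_trans Vq; apply: energy_le; exact: C0.
Qed.

End weights.

(** * The clock passes every level *)

Section divergence.
Hypothesis c0 : 0 < c.
Variable L : R.
Hypothesis L0 : 0 < L.

Let E : set T := [set w | forall n : nat, C n%:R w <= L].

Let mE : measurable E.
Proof.
rewrite (_ : E = \bigcap_n [set w | C n%:R w <= L]).
  apply: bigcapT_measurable => n.
  rewrite (_ : [set w | _] = C n%:R @^-1` `]-oo, L]%classic).
    by rewrite -[X in measurable X]setTI; apply: mC => //; exact: measurable_itv.
  by apply/seteqP; split => w /=; rewrite in_itv.
by apply/seteqP; split => w /= h n; [move=> _|]; exact: h.
Qed.

Let EC w v : good_path w -> E w -> 0 <= v -> C v w <= L.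
Proof.
move=> gw Ew v0; apply: le_trans (Ew (Num.truncn v).+1).
have := @clock_nd _ _ _ (@good_cz w) (@good_z0 w) (@good_A_le0 w gw) (@good_AE w gw)
  v (Num.truncn v).+1%:R (ltW (truncnS_gt v)).
by rewrite !ext_pathE.
Qed.

(* these weights and levels give the weight 2 L - L = L while the clock is below L *)
Let a (i : 'I_2) : R := if i == ord0 then 1 else -1.
Let t (i : 'I_2) : R := if i == ord0 then 2 * L else L.

Let t0 i : 0 <= t i.
Proof. by rewrite /t; case: ifP => _; [rewrite mulr_ge0// ltW|exact: ltW]. Qed.

Let ttm i : t i <= 2 * L.
Proof. by rewrite /t; case: ifP => _; [exact: lexx|move: L0; lra]. Qed.

Let weighted_integralE w v : good_path w -> E w -> 0 <= v ->
  weighted_integral a t v w = L * I v w.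
Proof.
move=> gw Ew v0; have CL u : 0 <= u -> C u w <= L by exact: EC.
have sm s : L <= s -> stopped_moment s v w =
    \int[mu]_(u in `[0, v]) (ext_path I w u * ext_path Z w u).
  move=> Ls; apply: eq_Rintegral => u /set_mem; rewrite /= in_itv/= => /andP[u0 _].
  by rewrite /stopped_rate (_ : ext_path C w u <= s)// ext_pathE// (le_trans (CL _ u0)).
have L2 : L <= 2 * L by move: L0; lra.
rewrite /weighted_integral !big_ord_recl big_ord0 /a /t /= !sm//.
have CLv := CL _ v0; rewrite !min_l//; last exact: le_trans CLv L2.
ring.
Qed.

(* strictly above the largest possible quadratic variation *)
Let q := total_energy a t (2 * L) + 1.

Let V0 : 0 <= total_energy a t (2 * L).
Proof. by apply: Rintegral_ge0 => s _; exact: energy_density_ge0. Qed.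

Let q0 : 0 < q. Proof. by rewrite ltr_wpDl. Qed.
Let Vq : total_energy a t (2 * L) < q. Proof. by rewrite ltrDl. Qed.

(** On the bounded-clock event [Z = x + I + c v + (a bounded term)], so at all
    late times either [Z] is above [M] or [I] is below [- 2 K / L].  The latter is
    charged by the smoothing of [lower_ramp K], whose expectation is [r] at all
    times; Markov's inequality handles the former. *)
Let late_bound (K : nat) (r M : R) : 0 < M ->
  (2^-1%:E <= ramp_mass q K)%E ->
  (residual_smoothing q (lower_ramp K) (0%R, 0%R) = r%:E)%E ->
  exists T0, 0 <= T0 /\ forall v, T0 <= v ->
   (P E <= (2 * r)%:E + \int[P]_w (\1_E w * ext_path Z w v / M)%:E)%E.
Proof.
move=> M0 half rE.
have cp : continuous (fun y : R => primitive (fun y => f (Num.max y 0)) (Num.max y 0)).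
  exact: continuous_primitive.
have [Bf [Bf0 BfP]] := continuous_bounded_segment 0 L cp.
(* from T0 on, c v outweighs M and all the bounded terms by 2 K / L *)
pose T0 := (M + `|x| + Bf + K%:R *+ 2 / L) / c.
have T00 : 0 <= T0.
  by rewrite divr_ge0 ?(ltW c0)// !addr_ge0 ?(ltW M0)// divr_ge0 ?(ltW L0)// mulrn_wge0.
exists T0; split => // v T0v; have v0 : 0 <= v by exact: le_trans T0v.
have [hT0 hT1] := lower_ramp_test (R := R) K.
have h0 (y : R) : 0 <= lower_ramp K y by case/andP: (hT1 y).
have mRS : measurable_fun [set: T] (fun w => residual_smoothing q (lower_ramp K)
    (weighted_integral a t v w, primitive (energy_density a t) (C v w))).
  apply: (measurableT_comp (measurable_residual_smoothing q hT0 h0)).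
  apply: measurable_fun_pair; first exact: measurable_weighted_integral.
  exact: measurable_energy.
have m1E : measurable_fun [set: T] (\1_E : T -> R) by exact: measurable_indic.
have mEZ : measurable_fun [set: T] (fun w => (\1_E w * ext_path Z w v / M)%:E).
  apply/measurable_EFinP; apply: measurable_funM => //; apply: measurable_funM => //.
  exact: mZ.
have EZ0 w : (0 <= (\1_E w * ext_path Z w v / M)%:E)%E.
  by rewrite lee_fin divr_ge0 ?(ltW M0)// mulr_ge0// Z0.
have -> : ((2 * r)%:E = \int[P]_w (2%:E * residual_smoothing q (lower_ramp K)
    (weighted_integral a t v w, primitive (energy_density a t) (C v w))))%E.
  rewrite ge0_integralZl//; first last.
    by move=> w _; exact: residual_smoothing_ge0.
  by rewrite (weighted_integral_residual t0 ttm v0 q0 Vq (lower_ramp_test K)) rE EFinM.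
have m2 := measurable_funeM 2%:E mRS.
have rs2 w : (0 <= 2%:E * residual_smoothing q (lower_ramp K)
    (weighted_integral a t v w, primitive (energy_density a t) (C v w)))%E.
  by rewrite mule_ge0// residual_smoothing_ge0.
rewrite -(ge0_integralD P (@measurableT _ T) (fun w _ => rs2 w) m2 (fun w _ => EZ0 w) mEZ).
have -> : (P E = \int[P]_w (\1_E w)%:E)%E by rewrite integral_indic// setIT.
apply: ae_ge0_le_integral => //.
- exact/measurable_EFinP.
- by move=> w _; exact: adde_ge0 (rs2 w) (EZ0 w).
- exact: (emeasurable_funD m2 mEZ).
apply: filterS ae_good_path => w gw _.
have rs0 := residual_smoothing_ge0 q h0
  (weighted_integral a t v w, primitive (energy_density a t) (C v w)).
rewrite indicE; case: (boolP (w \in E)) => [/set_mem Ew|_]; last first.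
  by rewrite mul0r mul0r adde0 mule_ge0.
rewrite mul1r; have [MZ|ZM] := leP M (ext_path Z w v).
  rewrite -[leLHS]add0e leeD ?mule_ge0// lee_fin ler_pdivlMr//.
  by rewrite mul1r.
have -> : (1%:E = 2%:E * 2^-1%:E :> \bar R)%E by rewrite -EFinM divff.
apply: (@le_trans _ _ (2%:E * residual_smoothing q (lower_ramp K)
    (weighted_integral a t v w, primitive (energy_density a t) (C v w)))%E); last first.
  by rewrite leeDl// lee_fin divr_ge0 ?(ltW M0)// Z0.
apply: lee_wpmul2l => //; apply: le_trans half _; apply: ramp_mass_le.
  rewrite [leLHS]/= weighted_integralE//.
  have := good_drift gw v0.
  have Cv : 0 <= C v w <= L by rewrite C0//= EC.
  have := BfP _ Cv; rewrite max_l ?C0// !ext_pathE// => /ler_normlP[B1 _] dr.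
  have T0E : M + `|x| + Bf + K%:R *+ 2 / L <= c * v.
    by rewrite -ler_pdivrMl// mulrC.
  rewrite ext_pathE// in ZM.
  have x1 := ler_norm (- x); rewrite normrN in x1.
  have : I v w <= - (K%:R *+ 2 / L) by lra.
  by rewrite -(ler_pM2l L0) mulrN mulrCA divff ?mulr1// gt_eqF.
have Cv0 := C0 w v0; rewrite /=; apply: Rintegral_ge0 => s _.
exact: energy_density_ge0.
Qed.

(** The integral of [Z] over a window is an increment of the clock. *)
Let window_mass w v : good_path w -> 0 <= v ->
  (\int[mu]_(u in `[v, (v + 1)%R]) (\1_E w * ext_path Z w u)%:E <= L%:E)%E.
Proof.
move=> gw v0; rewrite indicE; case: (boolP (w \in E)) => [/set_mem Ew|_]; last first.
  under eq_integral do rewrite mul0r.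
  by rewrite integral0 lee_fin ltW.
under eq_integral do rewrite mul1r.
have ii := integrable_segment v (v + 1) (@good_cz w).
have fin : (\int[mu]_(u in `[v, (v + 1)%R]) (ext_path Z w u)%:E \is a fin_num)%E.
  by apply: integrable_fin_num => //; exact: measurable_itv.
rewrite -(fineK fin) lee_fin.
have v1 : v <= v + 1 by rewrite lerDl.
have := clockB (@good_cz w) (@good_AE w gw) v0 v1.
rewrite /Rintegral !ext_pathE ?addr_ge0// => CE.
have := EC gw Ew (addr_ge0 v0 ler01); have := C0 w v0; rewrite CE; lra.
Qed.

(** Averaging the bound at time [v] over a window of length one: by Tonelli the
    average of the term in [Z] is at most [L / M]. *)
Lemma bounded_clock_le (K : nat) (r eta : R) : 0 < eta ->
  (2^-1%:E <= ramp_mass q K)%E ->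
  (residual_smoothing q (lower_ramp K) (0%R, 0%R) = r%:E)%E ->
  (P E <= (2 * r + eta)%:E)%E.
Proof.
move=> eta0 half rE.
have M0 : 0 < L / eta by rewrite divr_gt0.
have [T0 [T00 late]] := late_bound M0 half rE.
pose J : set R := `[T0, T0 + 1]%classic.
have mJ : measurable J by exact: measurable_itv.
pose D := fun p : T * R => ((\1_E p.1 * ext_path Z p.1 p.2 / (L / eta))%:E * (\1_J p.2)%:E)%E.
have mD : measurable_fun [set: T * R] D.
  apply: emeasurable_funM; apply/measurable_EFinP; last first.
    by apply: measurableT_comp => //; exact: measurable_indic.
  apply: measurable_funM => //; apply: measurable_funM; last exact: mext.
  by apply: measurableT_comp => //; exact: measurable_indic.
have D0 p : (0 <= D p)%E.
  by rewrite /D mule_ge0// lee_fin// divr_ge0 ?(ltW M0)// mulr_ge0// Z0.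
have Pfin : P E \is a fin_num by exact: fin_num_measure.
rewrite -(fineK Pfin) lee_fin.
have [neg|pos] := ltP (fine (P E)) (2 * r).
  by rewrite (le_trans (ltW neg))// lerDl ltW.
have := fubini_tonelli (m1 := P) (m2 := mu) _ mD D0.
have lower : ((fine (P E) - 2 * r)%:E <= \int[mu]_v \int[P]_w D (w, v))%E.
  have mG : measurable_fun [set: R] (fun v => \int[P]_w D (w, v))%E.
    exact: (measurable_fun_fubini_tonelli_G (m1 := P) _ mD D0).
  apply: (@le_trans _ _ (\int[mu]_(v in J) \int[P]_w D (w, v))%E); last first.
    by apply: ge0_subset_integral => // v _; exact: integral_ge0.
  have -> : ((fine (P E) - 2 * r)%:E = \int[mu]_(v in J) (fine (P E) - 2 * r)%:E)%E.
    rewrite integral_cst//= lebesgue_measure_itv/= lte_fin ltrDl ltr01.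
    by rewrite -EFinD addrAC subrr add0r mule1.
  apply: ge0_le_integral => //.
  - by move=> v _; rewrite lee_fin subr_ge0.
  - exact: measurable_funTS mG.
  move=> v Jv; have : \1_J v = 1 :> R by rewrite indicE mem_set.
  move: Jv; rewrite /J /= in_itv/= => /andP[Tv _] vJ.
  rewrite EFinB leeBlDl// fineK//; apply: le_trans (late v Tv) _.
  rewrite leeD2l//; apply: ge0_le_integral => //.
  - by move=> w _; rewrite lee_fin divr_ge0 ?(ltW M0)// mulr_ge0// Z0.
  - apply/measurable_EFinP; apply: measurable_funM => //; apply: measurable_funM.
      exact: measurable_indic.
    exact: mZ.
  - exact: (measurableT_comp mD (measurable_pair2 v)).
  by move=> w _; rewrite /D /= vJ mule1.
have upper : (\int[P]_w \int[mu]_v D (w, v) <= eta%:E)%E.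
  have -> : (eta%:E = \int[P]_w (cst eta%:E w))%E.
    by rewrite integral_probability_cst.
  apply: ae_ge0_le_integral => //.
  - by move=> w _; exact: integral_ge0.
  - exact: (measurable_fun_fubini_tonelli_F (m2 := mu) _ mD D0).
  - by move=> w _; rewrite lee_fin ltW.
  apply: filterS ae_good_path => w gw _.
  rewrite (_ : (\int[mu]_v _)%E = (eta / L)%:E * \int[mu]_(v in J) (\1_E w * ext_path Z w v)%:E)%E.
    have := lee_wpmul2l (x := (eta / L)%:E) _ (window_mass gw T00).
    by rewrite -EFinM divfK ?gt_eqF//; apply; rewrite lee_fin divr_ge0 ?ltW.
  rewrite -ge0_integralZl_EFin ?divr_ge0 ?ltW//; first last.
  - apply/measurable_EFinP; apply: measurable_funM => //.
    apply: measurable_funTS; apply: continuous_measurable_fun; exact: good_cz.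
  - by move=> v _; rewrite lee_fin mulr_ge0// Z0.
  rewrite [RHS]integral_mkcond epatch_indic; apply: eq_integral => v _.
  by rewrite /D /= -!EFinM; congr (_ * _)%:E; rewrite invf_div mulrC.
move=> FT; rewrite FT in upper; have := le_trans lower upper.
by rewrite lee_fin lerBlDl.
Qed.

Lemma bounded_clock_negligible : P E = 0%E.
Proof.
apply/eqP; rewrite eq_le measure_ge0 andbT; apply/lee_addgt0Pr => e e0.
rewrite add0e.
have e4 : 0 < e / 4 by rewrite divr_gt0.
have near1 : \forall K \near \oo, (2^-1%:E <= ramp_mass q K)%E.
  have h2 : (2^-1%:E < 1%:E :> \bar R)%E by rewrite lte_fin invf_lt1// ltr1n.
  apply: (@ramp_mass_cvg1 R q [set y | 2^-1%:E <= y]%E).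
  by apply: filterS (open_nbhs_nbhs (conj (@open_ereal_gt_ereal _ _) h2)) => y; exact: ltW.
have near0 : \forall K \near \oo,
    (residual_smoothing q (lower_ramp K) (0%R, 0%R) <= (e / 4)%:E)%E.
  have h2 : (0%:E < (e / 4)%:E :> \bar R)%E by rewrite lte_fin.
  apply: (@lower_ramp_residual_cvg0 R q [set y | y <= (e / 4)%:E]%E).
  by apply: filterS (open_nbhs_nbhs (conj (@open_ereal_lt_ereal _ _) h2)) => y; exact: ltW.
have [K [K1 K2]] := @filter_ex _ _ _ _ (filterI near1 near0).
have /andP[r0 r1] := residual_smoothing01 (lower_ramp_test K) q (0, 0).
have rfin : residual_smoothing q (lower_ramp K) (0, 0) \is a fin_num.
  by rewrite ge0_fin_numE// (le_lt_trans r1)// ltry.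
have e2 : 0 < e / 2 by rewrite divr_gt0.
have := bounded_clock_le e2 K1 (esym (fineK rfin)).
move=> /le_trans; apply; rewrite lee_fin.
rewrite -(fineK rfin) lee_fin in K2; lra.
Qed.

End divergence.

(** * The time-changed integral *)

Section conclusion.
Hypothesis c0 : 0 < c.

Definition unbounded_clock w := forall L, exists v, L < ext_path C w v.

Lemma ae_unbounded_clock : {ae P, forall w, unbounded_clock w}.
Proof.
pose E (k : nat) := [set w | forall n : nat, C n%:R w <= k.+1%:R].
have E0 k : P (E k) = 0%E by exact: (bounded_clock_negligible c0 (ltr0Sn R k)).
have mE k : measurable (E k).
  rewrite (_ : E k = \bigcap_n [set w | C n%:R w <= k.+1%:R]).
    apply: bigcapT_measurable => n.
    rewrite (_ : [set w | _] = C n%:R @^-1` `]-oo, k.+1%:R]%classic).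
      by rewrite -[X in measurable X]setTI; apply: mC => //; exact: measurable_itv.
    by apply/seteqP; split => w /=; rewrite in_itv.
  by apply/seteqP; split => w /= h n; [move=> _|]; exact: h.
exists (\bigcup_k E k); split.
- exact: bigcupT_measurable.
- apply/eqP; rewrite eq_le measure_ge0 andbT.
  apply: le_trans (measure_sigma_subadditive _ _ _ _) _ => //.
  + exact: bigcupT_measurable.
  + by rewrite eseries0// => k _ _; exact: E0.
move=> w /= /existsNP[L nL]; exists (Num.truncn L) => // n.
rewrite leNgt; apply/negP => Cn; apply: nL; exists n%:R; rewrite ext_pathE//.
by apply: lt_trans Cn; exact: truncnS_gt.
Qed.

Definition mean t := x * t + \int[mu]_(s in `[0, t]) ((t - s) * f (Num.max s 0)).

Section path.
Variable w : T.
Hypotheses (gw : good_path w) (uw : unbounded_clock w).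

Let z := ext_path Z w.
Let A := ext_path C w.

Lemma time_changed_integral_sublevel t : 0 <= t ->
  time_changed_integral c Z C t w = \int[mu]_(v in sublevel A t) ((z v - c * v) * z v).
Proof.
move=> t0; rewrite /time_changed_integral.
have nd u v : 0 <= u -> u <= v -> C u w <= C v w.
  move=> u0 uv; have := @clock_nd _ _ _ (@good_cz w) (@good_z0 w)
    (@good_A_le0 w gw) (@good_AE w gw) u v uv.
  by rewrite !ext_pathE// (le_trans u0).
have C00 : C 0 w = 0 by have := good_A_le0 gw (lexx 0); rewrite ext_pathE.
rewrite (passage_sublevel (@cC w) nd) ?C00//.
have -> : [set v | 0 <= v /\ C v w <= t] = sublevel A t.
  by apply/seteqP; split => v [v0 Cv]; split => //; move: Cv; rewrite /A ext_pathE.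
by apply: eq_Rintegral => v /set_mem[v0 _]; rewrite /z ext_pathE.
Qed.

Lemma time_changed_integralE t : 0 <= t ->
  time_changed_integral c Z C t w =
  mean t + \int[mu]_(v in sublevel A t) (ext_path I w v * z v).
Proof.
move=> t0; rewrite time_changed_integral_sublevel//.
have [v tv] := uw t.
rewrite /mean; have cfm : continuous (fun y : R => f (Num.max y 0)) by [].
exact: (@sublevel_integralE _ _ _ (@good_cz w) (@good_z0 w) (@good_cA w)
  (@good_A_le0 w gw) (@good_AE w gw) x c t v (ext_path I w) _ (cext (@cI w)) cfm
  t0 tv (good_drift gw)).
Qed.

Lemma continuous_time_changed_integral :
  continuous_path (time_changed_integral c Z C) w.
Proof.
have ck : continuous (fun v : R => z v - c * v).
  move=> v; apply: (@cvgB _ R^o); first exact: good_cz.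
  by apply: cvgM; [exact: cvg_cst|exact: cvg_id].
have cX := continuous_sublevel_integral (@good_cz w) (@good_z0 w) (@good_cA w)
  (@good_A_le0 w gw) (@good_AE w gw) ck uw.
rewrite /continuous_path; apply: (@subspace_eq_continuous _ _ _ _ _ _ cX) => t /set_mem; rewrite /= in_itv/= andbT => t0.
by rewrite /from_subspace time_changed_integral_sublevel.
Qed.

Section weights.
Variables (n : nat) (a t : 'I_n -> R) (tm : R).
Hypotheses (t0 : forall i, 0 <= t i) (ttm : forall i, t i <= tm).

(** Once the clock exceeds all levels, the weight vanishes and nothing moves any
    more. *)
Lemma weighted_integral_eventually : \forall k \near \oo,
  weighted_integral a t k%:R w =
    \sum_(i < n) a i * time_changed_integral c Z C (t i) w -
    \sum_(i < n) a i * mean (t i) /\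
  primitive (energy_density a t) (C k%:R w) = total_energy a t tm.
Proof.
have [v tv] := uw tm.
near=> k.
have vk : v <= k%:R by near: k; exact: nbhs_infty_ger.
have tk : tm < A k%:R.
  apply: lt_le_trans tv _; exact: (@clock_nd _ _ _ (@good_cz w) (@good_z0 w)
    (@good_A_le0 w gw) (@good_AE w gw)).
have Ak : A k%:R = C k%:R w by rewrite /A ext_pathE.
split; last by apply: energy_eq => //; [exact: C0|rewrite ltW// -Ak].
rewrite -sumrB; apply: eq_bigr => i _; rewrite -mulrBr; congr (_ * _).
have tik : t i < A k%:R by exact: le_lt_trans tk.
rewrite -Ak min_r ?(ltW tik)// subrr mul0r add0r time_changed_integralE//.
rewrite (sublevel_integral_stopped (@good_cz w) (@good_z0 w)
  (@good_A_le0 w gw) (@good_AE w gw) (cext (@cI w)) (t0 i) tik).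
by rewrite addrC addKr.
Unshelve. all: by end_near. Qed.

End weights.

End path.

Lemma measurable_X t : measurable_fun [set: T] (time_changed_integral c Z C t).
Proof. exact: measurable_time_changed_integral. Qed.

(** The smoothing identity is taken to the limit of late times at a fixed level
    [q > V], and then [q] decreases to [V]: at [q = V] no noise is left to add. *)
Lemma gaussian_law_time_changed_integral (n : nat) (a t : 'I_n -> R) (tm : R) :
  (forall i, 0 <= t i) -> (forall i, t i <= tm) ->
  has_gaussian_law P (\sum_(i < n) a i * mean (t i))
    (Num.sqrt (total_energy a t tm))
    (fun w => \sum_(i < n) a i * time_changed_integral c Z C (t i) w).
Proof.
move=> t0 ttm; set m := \sum_(i < n) a i * mean (t i).
set V := total_energy a t tm.
have V0 : 0 <= V by apply: Rintegral_ge0 => s _; exact: energy_density_ge0.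
set Y := fun w => \sum_(i < n) a i * time_changed_integral c Z C (t i) w.
have mY : measurable_fun [set: T] Y.
  apply: measurable_sum => i; apply: measurable_funM => //; exact: measurable_X.
apply: has_gaussian_law_test_functions => // h [ch h01].
(* centring is absorbed into the test function *)
pose k y := h (y + m).
have kT : test_function k.
  split => [y|y]; last exact: h01.
  apply: (@continuous_comp _ _ _ (fun y => y + m) h); last exact: ch.
  by apply: (@cvgD _ R^o); [exact: cvg_id|exact: cvg_cst].
have mp : measurable_fun [set: T] (fun w => (Y w - m, V)).
  by apply: measurable_fun_pair => //; exact: measurable_funB.
have approx q : 0 < q -> V < q ->
    (\int[P]_w residual_smoothing q k ((Y w - m)%R, V) = residual_smoothing q k (0%R, 0%R))%E.
  move=> q0 Vq.
  pose p_ j w := (weighted_integral a t j%:R w, primitive (energy_density a t) (C j%:R w)).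
  have mp_ j : measurable_fun [set: T] (p_ j).
    apply: measurable_fun_pair; first exact: measurable_weighted_integral.
    exact: measurable_energy.
  have p_cvg : {ae P, forall w, (p_ j w).1 @[j --> \oo] --> (Y w - m, V).1 /\
      (p_ j w).2 @[j --> \oo] --> (Y w - m, V).2}.
    apply: filterS2 ae_good_path ae_unbounded_clock => w gw uw.
    have ev := weighted_integral_eventually gw uw a t0 ttm.
    by split; apply: cvg_near_cst; apply: filterS ev => j [].
  have cq : (fun _ : nat => q : R) n @[n --> \oo] --> q by exact: cvg_cst.
  have lim := integral_residual_smoothing_cvg kT cq mp_ mp p_cvg.
  have E j : (\int[P]_w residual_smoothing q k (p_ j w) = residual_smoothing q k (0%R, 0%R))%E.
    exact: (weighted_integral_residual t0 ttm (ler0n R j) q0 Vq kT).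
  rewrite (funext E) in lim.
  by apply: (cvg_unique (@ereal_hausdorff R) lim); exact: cvg_cst.
have qV : V + j.+1%:R^-1 @[j --> \oo] --> V.
  rewrite -[X in _ --> X]addr0; apply: (@cvgD _ R^o); first exact: cvg_cst.
  exact: cvg_harmonic.
have j0 j : 0 < j.+1%:R^-1 :> R by rewrite invr_gt0.
have lim p : measurable_fun [set: T] p ->
    (\int[P]_w residual_smoothing (V + j.+1%:R^-1)%R k (p w) @[j --> \oo] -->
     \int[P]_w residual_smoothing V k (p w))%E.
  move=> mp'; apply: (integral_residual_smoothing_cvg kT qV) => //.
  by apply: aeW => w; split; exact: cvg_cst.
have lim1 := lim _ mp.
have lim2 := lim (fun=> (0, 0)) (measurable_cst _).
have cstE q : (\int[P]_w residual_smoothing q k (0%R, 0%R) = residual_smoothing q k (0%R, 0%R))%E.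
  exact: integral_probability_cst.
have lim12 : (fun j => \int[P]_w residual_smoothing (V + j.+1%:R^-1)%R k ((Y w - m)%R, V))%E =
    (fun j => \int[P]_w residual_smoothing (V + j.+1%:R^-1)%R k (0%R, 0%R))%E.
  apply/funext => j; rewrite cstE; apply: approx; last by rewrite ltrDl.
  by rewrite ltr_wpDl.
rewrite lim12 in lim1.
have := cvg_unique (@ereal_hausdorff R) lim1 lim2; rewrite cstE => E.
transitivity (\int[P]_w residual_smoothing V k ((Y w - m)%R, V))%E.
  apply: eq_integral => w _; rewrite /residual_smoothing/= subrr sqrtr0.
  under eq_integral do rewrite mul0r addr0 /k subrK.
  by rewrite integral_probability_cst.
rewrite E /residual_smoothing/= subr0.
by apply: eq_integral => z _; rewrite /k add0r addrC.
Qed.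

Lemma gaussian_law1 t tm : 0 <= t -> t <= tm ->
  has_gaussian_law P (mean t)
    (Num.sqrt (total_energy (fun _ : 'I_1 => 1) (fun=> t) tm))
    (time_changed_integral c Z C t).
Proof.
move=> t0 ttm; have := @gaussian_law_time_changed_integral 1 (fun=> 1) (fun=> t) tm
  (fun=> t0) (fun=> ttm).
rewrite big_ord1 mul1r; congr (has_gaussian_law _ _ _ _).
by apply/funext => w; rewrite big_ord1 mul1r.
Qed.

Lemma expectation_time_changed_integral t : 0 <= t ->
  ('E_P[time_changed_integral c Z C t] = (mean t)%:E)%E.
Proof.
move=> t0; apply: (gaussian_law_expectation (sqrtr_ge0 _)).
exact: (gaussian_law1 t0 (lexx t)).
Qed.

(** The energies are quadratic in the weights; their polarization is the product of
    the two weights, which vanishes beyond [t1]. *)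
Lemma covariance_time_changed_integral t1 t2 : 0 <= t1 -> t1 <= t2 ->
  covariance P (time_changed_integral c Z C t1) (time_changed_integral c Z C t2) =
  (\int[mu]_(s in `[0, t1]) ((t2 - s) * (t1 - s) * g (Num.max s 0) ^+ 2))%:E.
Proof.
move=> t10 t12; have t20 : 0 <= t2 by exact: le_trans t12.
pose b (i : 'I_2) : R := 1.
pose u (i : 'I_2) : R := if i == ord0 then t1 else t2.
have u0 i : 0 <= u i by rewrite /u; case: ifP.
have ut i : u i <= t2 by rewrite /u; case: ifP.
have law12 : has_gaussian_law P (mean t1 + mean t2) (Num.sqrt (total_energy b u t2))
    (fun w => time_changed_integral c Z C t1 w + time_changed_integral c Z C t2 w).
  have := gaussian_law_time_changed_integral b u0 ut.
  rewrite !big_ord_recl big_ord0 addr0 /b !mul1r /u/=.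
  congr (has_gaussian_law _ _ _ _); apply/funext => w.
  by rewrite !big_ord_recl big_ord0 addr0 !mul1r.
have law1 := gaussian_law1 t10 t12; have law2 := gaussian_law1 t20 (lexx t2).
rewrite (gaussian_law_covariance (sqrtr_ge0 _) (sqrtr_ge0 _) (sqrtr_ge0 _)
  law1 law2 law12 erefl); congr EFin.
have V0 n (a t : 'I_n -> R) : 0 <= total_energy a t t2.
  by apply: Rintegral_ge0 => s _; exact: energy_density_ge0.
rewrite !sqr_sqrtr// /total_energy.
have ii n (a t : 'I_n -> R) r := integrable_segment 0 r (@continuous_energy_density n a t).
have mT r : @measurable _ (measurableTypeR R) `[0, r]%classic by exact: measurable_itv.
set e1 := energy_density _ (fun=> t1); set e2 := energy_density _ (fun=> t2).
set e := energy_density b u.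
have i1 r : mu.-integrable `[0, r] (EFin \o (fun s => e s - e1 s)).
  by have := integrableB (mT r) (ii _ b u r) (ii 1 (fun=> 1) (fun=> t1) r); apply: eq_integrable.
have i2 r : mu.-integrable `[0, r] (EFin \o (fun s => e s - e1 s - e2 s)).
  by have := integrableB (mT r) (i1 r) (ii 1 (fun=> 1) (fun=> t2) r); apply: eq_integrable.
have i3 r : mu.-integrable `[0, r] (EFin \o (fun s => 2^-1 * (e s - e1 s - e2 s))).
  by have := integrableZl (mT r) 2^-1 (i2 r); apply: eq_integrable.
rewrite -RintegralB; [|exact: mT|exact: ii|exact: ii].
rewrite -RintegralB; [|exact: mT|exact: i1|exact: ii].
rewrite -RintegralZl; [|exact: mT|exact: i2].
have KE s : 2^-1 * (e s - e1 s - e2 s) =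
    (t1 - Num.min s t1) * (t2 - Num.min s t2) * g (Num.max s 0) ^+ 2.
  rewrite /e /e1 /e2 /energy_density /tail_weight !big_ord_recl !big_ord0 /b /u /= !addr0.
  by field.
rewrite (@Rintegral_itv_cat _ _ 0 t1 t2)// [X in _ + X](_ : _ = 0) ?addr0.
  apply: eq_Rintegral => s /set_mem; rewrite /= in_itv/= => /andP[s0 st].
  rewrite KE min_l// min_l ?(le_trans st)//; ring.
transitivity (\int[mu]_(s in `[t1, t2]) (cst 0 : R -> R) s); last first.
  by rewrite Rintegral_cst//= mul0r.
apply: eq_Rintegral => s /set_mem; rewrite /= in_itv/= => /andP[ts _].
by rewrite KE min_r// subrr !mul0r.
Qed.

End conclusion.

End solution.

Theorem theorem3 (R : realType) (g f : R -> R) (eps M c x : R)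
    (hglip : exists k : R, k.-lipschitz_(`[0, +oo[) (fun t => g t ^+ 2))
    (heps : 0 < eps)
    (hg : forall t, 0 <= t -> eps < g t /\ g t < M)
    (hc : 2^-1 * sup [set g t ^+ 2 | t in `[0, +oo[] <= c)
    (hf : {within `[0, +oo[, continuous f})
    (hx : 0 < x)
    (d : measure_display) (T : measurableType d) (P : probability T R)
    (F : R -> set (set T)) (W Z C : R -> T -> R)
    (hsol : weak_solution g f c x P F W Z C) :
  let mu := @lebesgue_measure R in
  let X := time_changed_integral c Z C in
  [/\ gaussian_process P X,
      {ae P, forall w, continuous_path X w},
      forall t, 0 <= t ->
        ('E_P[X t] = (x * t + \int[mu]_(s in `[0%R, t]) ((t - s) * f s))%R%:E)%E
    & forall t1 t2, 0 <= t1 -> t1 <= t2 ->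
        covariance P (X t1) (X t2) =
        (\int[mu]_(s in `[0, t1]) ((t2 - s) * (t1 - s) * g s ^+ 2))%:E].
Proof.
move=> mu X.
have g0 t : 0 <= t -> 0 < g t by move=> /hg[]; lra.
have cg : continuous (fun y : R => g (Num.max y 0)).
  exact: continuous_comp_max0 (continuous_lipschitz_sqr hglip (fun t t0 => ltW (g0 t t0))).
have cf : continuous (fun y : R => f (Num.max y 0)) by exact: continuous_comp_max0.
have c0 : 0 < c.
  apply: lt_le_trans hc; rewrite mulr_gt0 ?invr_gt0//.
  have g00 : 0 < g 0 ^+ 2 by rewrite exprn_gt0// g0.
  apply: lt_le_trans g00 _; apply: sup_upper_bound; last first.
    by exists 0 => //; rewrite /= in_itv/= lexx.
  split; first by exists (g 0 ^+ 2), 0 => //; rewrite /= in_itv/= lexx.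
  exists (M ^+ 2) => _ [t + <-]; rewrite /= in_itv/= andbT => t0.
  have [_ gM] := hg t t0; rewrite lerXn2r ?nnegrE ?(ltW gM)// ltW ?g0//.
  exact: lt_trans (g0 t t0) gM.
case: hsol => [[filF bmW] [aZ cZ Z0] [aC cC C0] [I itoI sde] clock].
have law := gaussian_law_time_changed_integral filF bmW aZ cZ Z0 aC cC C0 cg cf itoI sde clock c0.
split.
- move=> n a t t0.
  have [tm ttm] : exists tm, forall i, t i <= tm.
    exists (\sum_(i < n) t i) => i; rewrite (bigD1 i)//= lerDl.
    by apply: sumr_ge0 => j _.
  exists (\sum_(i < n) a i * mean f x (t i)), (Num.sqrt (total_energy g a t tm)).
  by split; [exact: sqrtr_ge0|exact: law].
- apply: filterS2 (ae_good_path itoI sde clock)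
    (ae_unbounded_clock filF bmW aZ cZ Z0 aC cC C0 cg cf itoI sde clock c0) => w gw uw.
  exact: (@continuous_time_changed_integral _ _ _ Z C I f c x cZ Z0 cC w gw uw).
- move=> t t0.
  rewrite (expectation_time_changed_integral filF bmW aZ cZ Z0 aC cC C0 cg cf itoI sde clock c0)//.
  congr (_ + _)%:E; apply: eq_Rintegral => s /set_mem.
  by rewrite /= in_itv/= => /andP[s0 _]; rewrite max_l.
move=> t1 t2 t10 t12.
rewrite (covariance_time_changed_integral filF bmW aZ cZ Z0 aC cC C0 cg cf itoI sde clock c0)//.
congr EFin; apply: eq_Rintegral => s /set_mem.
by rewrite /= in_itv/= => /andP[s0 _]; rewrite max_l.
Qed.
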